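(* Let $N\in\mathbb{N}$ and let $\phi\sim\mathbb{P}_n$ be an $N$-vectorial Dirichlet Gaussian free field on $\Lambda_n$. Let $I=(a,b)$ with $a<b$ real if $N=1$, and $I=\mathcal{B}^N(0,R)\subset\mathbb{R}^N$ with $R>0$ if $N\ge2$. Then, for any $\beta>0$, $$\liminf_{n\to\infty}\frac{\log\mathbb{P}_n[\Omega^I_{D_n}]}{\log^2 n}\ge-\frac2\pi\,\mathrm{cap}_\Lambda(D)$$ and $$\lim_{n\to\infty}\sup_{x\in D_n}\mathbb{P}_n\big[|\phi(x)|\ge(2+\beta)\log n\ \big|\ \Omega^I_{D_n}\big]=0.$$
   Context: $\mathcal{B}^N(0,R)$ is the open ball of radius $R$ centered at $0$ in $\mathbb{R}^N$. $\Lambda=[-1/2,1/2]^2$, $\Lambda_n=[-n/2,n/2]^2\cap\mathbb{Z}^2$. $D\subset\Lambda$ is a fixed open set with smooth boundary, $0\in D$, $\mathrm{dist}(D,\partial\Lambda)>0$; $D_n=(nD)\cap\mathbb{Z}^2$. $\Omega^I_{D_n}=\{\phi(x)\notin I,\ \forall x\in D_n\}$. The relative capacity is $$\mathrm{cap}_\Lambda(D)=\tfrac12\inf\{\|\nabla f\|_{L^2(\Lambda)}^2: f\in H^1_0(\Lambda),\ f\ge1\text{ on }D\}.$$ The $N$-vectorial Dirichlet Gaussian free field on a finite $G\subset\mathbb{Z}^2$ is the random function $\phi:G\to\mathbb{R}^N$ with density (with respect to Lebesgue measure) proportional to $\exp\big(-\frac{\mathfrak g}{4}\sum_{x\sim y}|\phi(x)-\phi(y)|^2\big)$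 with $\mathfrak g=\frac1{2\pi}$. Here the sum runs over ordered pairs $(x,y)$ such that $\{x,y\}$ is a nearest-neighbor edge in $G\cup\partial G$, $\partial G$ is the set of vertices of $\mathbb{Z}^2\setminus G$ having a nearest neighbor in $G$, and $\phi=0$ on $\partial G$. With this normalization, a coordinate at the origin of $\Lambda_n$ has variance asymptotic to $\log n$. *)

(* Defs.v *)
From HB Require Import structures.
From mathcomp Require Import all_boot all_order all_algebra.
From mathcomp Require Import finmap zify.
From mathcomp Require Import all_classical all_reals all_analysis.

Set Implicit Arguments.
Unset Strict Implicit.
Unset Printing Implicit Defensive.

Import Order.TTheory GRing.Theory Num.Theory.
Import numFieldNormedType.Exports.

Local Open Scope classical_set_scope.
Local Open Scope ring_scope.

Definition tuple_cons (R : realType) (m : nat) (z : measurableTypeR R * m.-tuple (measurableTypeR R)) :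
  m.+1.-tuple (measurableTypeR R) := [the m.+1.-tuple (measurableTypeR R) of z.1 :: z.2].

Lemma measurable_tuple_cons (R : realType) (m : nat) :
  measurable_fun [set: measurableTypeR R * m.-tuple (measurableTypeR R)] (@tuple_cons R m).
Proof. exact: measurable_cons. Qed.

Definition lebesgue_cons (R : realType) (m : nat)
    (mu : {sigma_finite_measure set (m.-tuple (measurableTypeR R)) -> \bar R}) :
    set (m.+1.-tuple (measurableTypeR R)) -> \bar R :=
  pushforward (product_measure1 (@lebesgue_measure R) mu) (@tuple_cons R m).

Section lebesgue_cons_measure.
Context (R : realType) (m : nat).
Variable mu : {sigma_finite_measure set (m.-tuple (measurableTypeR R)) -> \bar R}.
Local Open Scope ereal_scope.

Let lebesgue_cons0 : lebesgue_cons mu set0 = 0.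
Proof. by rewrite /lebesgue_cons /pushforward preimage_set0 measure0. Qed.

Let lebesgue_cons_ge0 A : 0 <= lebesgue_cons mu A.
Proof. by rewrite /lebesgue_cons /pushforward; exact: measure_ge0. Qed.

Let lebesgue_cons_sigma_additive : semi_sigma_additive (lebesgue_cons mu).
Proof.
have mc := @measurable_tuple_cons R m.
move=> F mF tF mUF; rewrite /lebesgue_cons /pushforward preimage_bigcup.
apply: measure_semi_sigma_additive.
- by move=> n; rewrite -[X in measurable X]setTI; exact: mc.
- apply/trivIsetP => /= i j _ _ ij; rewrite -preimage_setI.
  by move/trivIsetP : tF => /(_ _ _ _ _ ij) ->//; rewrite preimage_set0.
- by rewrite -preimage_bigcup -[X in measurable X]setTI; exact: mc.
Qed.

HB.instance Definition _ := isMeasure.Build _ _ _ (lebesgue_cons mu)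
  lebesgue_cons0 lebesgue_cons_ge0 lebesgue_cons_sigma_additive.

Let lebesgue_cons_sigma_finite : sigma_finite setT (lebesgue_cons mu).
Proof.
have /sigma_finiteP[F [TF ndF Foo]] := sigma_finiteT (@lebesgue_measure R).
have /sigma_finiteP[G [TG ndG Goo]] := sigma_finiteT mu.
pose u (t : m.+1.-tuple (measurableTypeR R)) := (thead t, [tuple of behead t]).
have mu_ : measurable_fun setT u.
  apply/measurable_fun_pairP; split; first exact: measurable_tnth.
  exact: measurable_behead.
exists (fun k => u @^-1` (F k `*` G k)).
  rewrite predeqE => t; split=> // _.
  have [i _ Fi] : (\bigcup_i F i) (thead t) by rewrite -TF.
  have [j _ Gj] : (\bigcup_j G j) [tuple of behead t] by rewrite -TG.
  exists (maxn i j) => //; split => /=.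
  - by move: Fi; exact/subsetPset/ndF/leq_maxl.
  - by move: Gj; exact/subsetPset/ndG/leq_maxr.
move=> k; have [mFk Fkoo] := Foo k; have [mGk Gkoo] := Goo k; split.
  by rewrite -[X in measurable X]setTI; apply: mu_ => //; exact: measurableX.
rewrite /lebesgue_cons /pushforward.
rewrite (_ : _ @^-1` _ = F k `*` G k).
  by rewrite product_measure1E// lte_mul_pinfty// ge0_fin_numE.
apply/funext => -[x t] /=; rewrite /u /tuple_cons/= theadE.
by rewrite (_ : [tuple of _] = t)//; exact/val_inj.
Qed.

HB.instance Definition _ := Measure_isSigmaFinite.Build _ _ _
  (lebesgue_cons mu) lebesgue_cons_sigma_finite.

End lebesgue_cons_measure.

(* Lebesgue measure on [R^m], built by iterated products with Lebesgue measure
   on [R]; [R^0] carries the unit mass on its only point. *)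
Fixpoint lebesgue_tuple (R : realType) (m : nat) :
    {sigma_finite_measure set (m.-tuple (measurableTypeR R)) -> \bar R} :=
  match m with
  | 0 => [the {sigma_finite_measure set (0.-tuple (measurableTypeR R)) -> \bar R} of
            @dirac _ (0.-tuple (measurableTypeR R)) [tuple] R]
  | k.+1 => [the {sigma_finite_measure set (k.+1.-tuple (measurableTypeR R)) -> \bar R} of
            lebesgue_cons (lebesgue_tuple R k)]
  end.

Definition lebesgue2 (R : realType) :
    {measure set (measurableTypeR R * measurableTypeR R) -> \bar R} :=
  product_measure1 (@lebesgue_measure R) (@lebesgue_measure R).

Definition enorm2 (R : realType) (z : R * R) : R :=
  Num.sqrt (z.1 ^+ 2 + z.2 ^+ 2).

Definition boundary (T : topologicalType) (A : set T) : set T :=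
  closure A `\` A°.

Definition set_dist2 (R : realType) (A B : set (R * R)) : R :=
  inf [set enorm2 (z - w) | z in A & w in B].

Definition unit_square (R : realType) : set (R * R) :=
  [set z | - (1 / 2) <= z.1 <= 1 / 2 /\ - (1 / 2) <= z.2 <= 1 / 2].

Arguments unit_square R _ : clear implicits.

(* Every boundary point has a neighbourhood in which the set is, after
   exchanging the coordinates ([swap]) and reversing the vertical axis
   ([flip]) if necessary, the strict epigraph of a smooth function. *)
Definition smooth_boundary (R : realType) (D : set (R * R)) : Prop :=
  forall p, boundary D p ->
  exists (r : R) (gamma : R -> R) (swap flip : bool),
    [/\ 0 < r,
        forall (k : nat) (s : R), derivable (derive1n k gamma) s 1 &
        forall z, ball p r z ->
          let: (s, t) := if swap then (z.2, z.1) else z in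
          D z <-> (if flip then t < gamma s else gamma s < t)].

(* [false] is the first coordinate direction, [true] the second one. *)
Definition axis (R : realType) (i : bool) : R * R :=
  if i then (0, 1) else (1, 0).

Definition partials (R : realType) (f : R * R -> R) (s : seq bool) :
  R * R -> R := foldr (fun i g z => 'D_(axis R i) g z) f s.

Definition smooth2 (R : realType) (f : R * R -> R) : Prop :=
  forall s : seq bool, continuous (partials f s) /\
    forall i z, derivable (partials f s) z (axis R i).

(* [C_c^oo] functions on the interior of [L] *)
Definition test_function (R : realType) (L : set (R * R)) (eta : R * R -> R) :
    Prop :=
  [/\ smooth2 eta, compact (closure [set z | eta z != 0]) &
      closure [set z | eta z != 0] `<=` L°].

Definition L2_on (R : realType) (L : set (R * R)) (f : R * R -> R) : Prop :=
  measurable_fun (L : set (measurableTypeR R * measurableTypeR R)) f /\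
  (\int[lebesgue2 R]_(z in L) ((f z) ^+ 2)%:E < +oo)%E.

Definition weak_partial (R : realType) (L : set (R * R)) (i : bool)
    (f g : R * R -> R) : Prop :=
  forall eta, test_function L eta ->
    \int[lebesgue2 R]_(z in L) (f z * 'D_(axis R i) eta z) =
    - \int[lebesgue2 R]_(z in L) (g z * eta z).

(* [f] belongs to [H^1(L)], with weak gradient [(g false, g true)] *)
Definition in_H1 (R : realType) (L : set (R * R)) (f : R * R -> R)
    (g : bool -> R * R -> R) : Prop :=
  L2_on L f /\ forall i, L2_on L (g i) /\ weak_partial L i f (g i).

Definition dirichlet_energy (R : realType) (L : set (R * R))
    (g : bool -> R * R -> R) : \bar R :=
  (\int[lebesgue2 R]_(z in L) ((g false z) ^+ 2 + (g true z) ^+ 2)%:E)%E.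

Definition H1_sqnorm (R : realType) (L : set (R * R)) (f : R * R -> R)
    (g : bool -> R * R -> R) : \bar R :=
  (\int[lebesgue2 R]_(z in L) ((f z) ^+ 2)%:E + dirichlet_energy L g)%E.

Definition in_H10 (R : realType) (L : set (R * R)) (f : R * R -> R)
    (g : bool -> R * R -> R) : Prop :=
  in_H1 L f g /\
  exists eta : nat -> R * R -> R,
    (forall k, test_function L (eta k)) /\
    (H1_sqnorm L (fun z => f z - eta k z)
                 (fun i z => g i z - 'D_(axis R i) (eta k) z)
       @[k --> \oo] --> 0%E).

(* As elements of [H^1_0(L)] are classes of functions modulo null sets,
   [f >= 1] on [D] is understood almost everywhere. *)
Definition capacity (R : realType) (L D : set (R * R)) : \bar R :=
  ((1 / 2)%:E * ereal_inf [set e | exists (f : R * R -> R) g,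
     [/\ in_H10 L f g, {ae lebesgue2 R, forall z, D z -> (1 <= f z)%R} &
         e = dirichlet_energy L g]])%E.

Definition Z2 := (int * int)%type.

Definition nbrs (x : Z2) : seq Z2 :=
  [:: (x.1 + 1, x.2); (x.1 - 1, x.2); (x.1, x.2 + 1); (x.1, x.2 - 1)].

Definition outer_boundary (G : {fset Z2}) : {fset Z2} :=
  [fset y in flatten [seq nbrs x | x <- G] | y \notin G]%fset.

Definition centered_range (n : nat) : seq int :=
  [seq i%:Z - n%:Z | i <- iota 0 n.*2.+1 & (`|i%:Z - n%:Z| * 2 <= n)%N].

Definition box (n : nat) : {fset Z2} :=
  [fset x in [seq (i, j) | i <- centered_range n, j <- centered_range n]]%fset.

Lemma mem_centered_range (n : nat) (a : int) :
  (a \in centered_range n) = (`|a| * 2 <= n)%N.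
Proof.
apply/mapP/idP => [[i]|an]; first by rewrite mem_filter => /andP[+ _] ->.
exists (absz (a + n%:Z)); last by lia.
by rewrite mem_filter mem_iota; lia.
Qed.

Lemma in_box (R : realType) (n : nat) (x : Z2) :
  let h : R := n%:R / 2 in
  x \in box n <-> - h <= (x.1%:~R : R) <= h /\ - h <= (x.2%:~R : R) <= h.
Proof.
move=> h.
have half (a : int) : (absz a * 2 <= n)%N = (- h <= (a%:~R : R) <= h).
  rewrite -ler_norml -intr_norm ler_pdivlMr// -[2]/(2%:~R) -intrM.
  by rewrite -[n%:R]/(n%:Z%:~R) ler_int; lia.
rewrite /box inE/= -!half -!mem_centered_range.
case: x => a b /=; split=> [/allpairsP[[i j] /= [ci cj [-> ->]]] //|[ca cb]].
by apply/allpairsP; exists (a, b).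
Qed.

(* [(n D) \cap Z^2] *)
Definition lattice_blowup (R : realType) (D : set (R * R)) (n : nat) : set Z2 :=
  [set x | [set n%:R *: z | z in D] (x.1%:~R, x.2%:~R)].

Definition enorm (R : realType) (N : nat) (v : 'rV[R]_N) : R :=
  Num.sqrt (\sum_j v ord0 j ^+ 2).

Definition zero_ext (R : realType) (N : nat) (G : {fset Z2})
    (phi : G -> 'rV[R]_N) (x : Z2) : 'rV[R]_N :=
  if insub x is Some x' then phi x' else 0.

(* The sum runs over ordered pairs, so each edge is counted twice. *)
Definition gff_weight (R : realType) (N : nat) (G : {fset Z2})
    (phi : G -> 'rV[R]_N) : R :=
  let Gb := (G `|` outer_boundary G)%fset in
  expR (- ((1 / (2 * pi)) / 4 *
    \sum_(x <- Gb) \sum_(y <- Gb | y \in nbrs x)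
      enorm (zero_ext phi x - zero_ext phi y) ^+ 2)).

Definition coord (G : {fset Z2}) (N : nat) : finType := (G * 'I_N)%type.

Definition field_to_tuple (R : realType) (N : nat) (G : {fset Z2})
    (phi : G -> 'rV[R]_N) : #|coord G N|.-tuple (measurableTypeR R) :=
  [tuple phi (enum_val k).1 ord0 (enum_val k).2 | k < #|coord G N|].

Definition tuple_to_field (R : realType) (N : nat) (G : {fset Z2})
    (t : #|coord G N|.-tuple (measurableTypeR R)) : G -> 'rV[R]_N :=
  fun x => \row_(j < N) (tnth t (enum_rank ((x, j) : coord G N)) : R).

Lemma field_to_tupleK (R : realType) (N : nat) (G : {fset Z2}) :
  cancel (@field_to_tuple R N G) (@tuple_to_field R N G).
Proof.
move=> phi; apply/funext => x; apply/rowP => j.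
by rewrite !mxE tnth_mktuple enum_rankK.
Qed.

Lemma tuple_to_fieldK (R : realType) (N : nat) (G : {fset Z2}) :
  cancel (@tuple_to_field R N G) (@field_to_tuple R N G).
Proof.
move=> t; apply: eq_from_tnth => k; rewrite tnth_mktuple mxE.
by rewrite -surjective_pairing enum_valK.
Qed.

(* The law of [phi], on [(R^N)^G] identified with [R^(#|G| * N)], is
   absolutely continuous with density [c * gff_weight], where [c] is the
   normalizing constant. *)
Definition is_dgff (d : measure_display) (T : measurableType d) (R : realType)
    (P : probability T R) (N : nat) (G : {fset Z2}) (phi : T -> G -> 'rV[R]_N) :
    Prop :=
  measurable_fun setT (fun w => field_to_tuple (phi w)) /\
  exists2 c : R, 0 < c & forall A : set (#|coord G N|.-tuple (measurableTypeR R)), measurable A ->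
    P [set w | A (field_to_tuple (phi w))] =
    (\int[lebesgue_tuple R #|coord G N|]_(t in A)
       (c * gff_weight (tuple_to_field t))%:E)%E.

Variant forbidden_set (R : realType) : forall N : nat, set 'rV[R]_N -> Prop :=
| Forbidden_interval (a b : R) :
    a < b -> @forbidden_set R 1 [set v | a < v ord0 ord0 < b]
| Forbidden_ball (N : nat) (r : R) :
    (2 <= N)%N -> 0 < r -> @forbidden_set R N [set v | enorm v < r].

Definition avoids (T : Type) (R : realType) (N : nat) (G : {fset Z2})
    (phi : T -> G -> 'rV[R]_N) (I : set 'rV[R]_N) (D : set Z2) : set T :=
  [set w | forall x : G, D (val x) -> ~ I (phi w x)].

Definition cond_prob (d : measure_display) (T : measurableType d)
    (R : realType) (P : probability T R) (A B : set T) : \bar R :=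
  (P (A `&` B) / P B)%E.

(* Main.v *)
(* Write [l = log n], [mu] for the Gaussian law on the box, [E f g] for the bilinear form
   [(1 / 4 pi) sum_{x ~ y} (f x - f y) (g x - g y)] and [K = l + O(1)] for a constant with
   [f x ^ 2 <= K E f f]; the latter follows by Cauchy-Schwarz from the flow which discretises the
   radial field [z / (2 pi |z|^2)], and makes one component at one site sub-Gaussian with
   variance at most [K].  Hence the field stays below [(2 + e) l] on all [O(n^2)] sites with
   probability at least [1 / 2].

   Lower bound: given [f] in [H^1_0] with [f >= 1] on [D], average a nearby test function over
   the cells of side [1 / n] centred at [x / n].  The averages [h] have discrete Dirichlet energy
   at most that of the test function, and [h >= 1 - o(1)] on the lattice blow-up of [D]: this is
   clear for cells inside [D], smoothness of the boundary provides such a cell within boundedly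
   many lattice steps, and a single lattice step changes [h] by the energy of two cells only.
   Raising one component by about [2 l h] makes it avoid the bounded set [I] on [D] with
   probability at least [1 / 2]; undoing the translation costs [exp (- 2 l^2 E h h - O(l))].

   Conditional tail: the event of avoiding [I] through large values of one component is compared
   by the four functions theorem with the law raised by the constant [S = (2 + e) l].  A constant
   is superharmonic for the zero boundary condition, so the coordinatewise minimum and maximum of
   a field and a raised field do not decrease the product of the densities, and the conditional
   probability that the component exceeds [T > S] is at most twice the unconditional probability
   that it exceeds [T - S].  For a ball, which is rotation invariant, a finite net of rotations of
   coordinate planes passes from one component to the norm. *)

Require Import Defs.
From HB Require Import structures.
From mathcomp Require Import all_boot all_order all_algebra.
From mathcomp Require Import finmap zify ring lra.
From mathcomp Require Import all_classical all_reals all_analysis.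
From mathcomp Require Import measurable_realfun.

Set Implicit Arguments.
Unset Strict Implicit.
Unset Printing Implicit Defensive.

Import Order.TTheory GRing.Theory Num.Theory.
Import numFieldNormedType.Exports.

Local Open Scope classical_set_scope.
Local Open Scope ring_scope.

(** * Integration and the four functions theorem on [R^m] *)

(** No covariance is computed explicitly. One component has precision form [Dform], and its size is
    governed by the single inequality [f x ^+ 2 <= K * Dform f f]. The leading coefficient of [K]
    must be sharp: [2 log n] is exactly the level at which the Gaussian tail balances the [n^2]
    sites. Raising by [2 log n] times [f] then costs half of [(2 log n)^2 (2 pi)^-1 |grad f|^2],
    that is [log^2 n |grad f|^2 / pi], whence [2 / pi] before the capacity.

    The avoidance event is not monotone, as each site may lie on either side of [I], so correlation
    inequalities for increasing events do not cover it. What survives is one-sided: where one field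
    avoids [I] and another lies above [I], the minimum avoids [I].

    A competitor is at least [1] on [D] only almost everywhere and is reached only in [H^1] norm; a
    cell of area [n^-2] notices this only if the squared error is a small multiple of [n^-2]. The
    test function therefore varies with [n], without a uniform bound on its derivatives. *)

Section tuple_integral.
Context (R : realType).
Notation leb := (@lebesgue_measure R).

Lemma ge0_integral_shift (f : R -> \bar R) (a : R) :
  measurable_fun [set: measurableTypeR R] f -> (forall x, (0 <= f x)%E) ->
  (\int[leb]_x f (x + a)%R = \int[leb]_x f x)%E.
Proof.
move=> mf f0.
pose s (x : measurableTypeR R) : measurableTypeR R := (x + a)%R.
have mS : measurable_fun setT s.
  by apply: measurable_funD => //.
pose mu : {measure set (measurableTypeR R) -> \bar R} := measure_function_pushforward__canonical__measure_function_Measure leb mS.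
have E A : measurable A -> leb A = mu A.
  apply: lebesgue_measure_unique => _ [[x y] _ <-].
  rewrite /mu /= /pushforward.
  have -> : s @^-1` `]x, y]%classic = `](x - a), (y - a)]%classic.
    by apply/seteqP; split => z /=; rewrite !in_itv /= /s ltrBlDr lerBrDr.
  rewrite !lebesgue_measure_itv /= !lte_fin ltrD2r.
  by case: ifP => // _; rewrite -!EFinB; congr EFin; ring.
have := @ge0_integral_pushforward _ _ _ _ R s mS leb setT f measurableT mf (fun y _ => f0 y).
rewrite preimage_setT => <-.
by apply: eq_measure_integral => A mA _; rewrite -E.
Qed.

Lemma integral_tupleS (m : nat) (f : m.+1.-tuple (measurableTypeR R) -> \bar R) :
  measurable_fun setT f -> (forall t, (0 <= f t)%E) ->
  (\int[lebesgue_tuple R m.+1]_t f t =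
   \int[leb]_x \int[lebesgue_tuple R m]_t f (tuple_cons (x, t)))%E.
Proof.
move=> mf f0 /=.
rewrite /lebesgue_cons ge0_integral_pushforward//=.
- rewrite preimage_setT.
  rewrite (@fubini_tonelli1 _ _ _ _ _ leb (lebesgue_tuple R m))//=.
  by apply: measurableT_comp => //; exact: measurable_tuple_cons.
- exact: measurable_tuple_cons.
Qed.

Lemma integral_tuple0 (f : 0.-tuple (measurableTypeR R) -> \bar R) :
  measurable_fun setT f -> (\int[lebesgue_tuple R 0]_t f t = f [tuple])%E.
Proof. by move=> mf; rewrite /= integral_dirac//= diracT mul1e. Qed.

Notation vec m := (m.-tuple (measurableTypeR R)).

Lemma tnth_tuple_cons0 m (x : R) (t : vec m) : tnth (tuple_cons (x, t)) ord0 = x.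
Proof. by []. Qed.

Lemma tnth_tuple_consS m (x : R) (t : vec m) k :
  tnth (tuple_cons (x, t)) (lift ord0 k) = tnth t k.
Proof. by rewrite tnthS. Qed.

Lemma tuple_consP m (t u : vec m.+1) :
  tnth t ord0 = tnth u ord0 ->
  (forall k, tnth t (lift ord0 k) = tnth u (lift ord0 k)) -> t = u.
Proof.
move=> h0 hS; apply: eq_from_tnth => i.
by have [j ->|->] := unliftP ord0 i.
Qed.

Definition shear m (A : pred 'I_m) (Phi : vec m -> 'I_m -> R) (t : vec m) : vec m :=
  [tuple if A k then (tnth t k : R) + Phi t k else tnth t k | k < m].

Lemma measurable_shear m (A : pred 'I_m) (Phi : vec m -> 'I_m -> R) :
  (forall k, A k -> measurable_fun setT (Phi ^~ k)) -> measurable_fun setT (shear A Phi).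
Proof.
move=> mPhi; apply/measurable_fun_tnthP => k.
rewrite (_ : _ \o _ = fun t => if A k then (tnth t k : R) + Phi t k else tnth t k); last first.
  by apply/funext => t /=; rewrite tnth_mktuple.
case: (boolP (A k)) => Ak; last exact: measurable_tnth.
by apply: measurable_funD; [exact: measurable_tnth|exact: mPhi].
Qed.

Lemma measurable_tuple_cons1 m (x : R) :
  measurable_fun setT (fun t : vec m => tuple_cons (x, t)).
Proof. by apply: measurable_cons; [exact: measurable_cst|exact: measurable_id]. Qed.

Lemma measurable_tuple_cons2 m (t : vec m) :
  measurable_fun setT (fun x : measurableTypeR R => tuple_cons (x, t)).
Proof. by apply: measurable_cons; [exact: measurable_id|exact: measurable_cst]. Qed.

(** The shifts of the coordinates in [A] depend only on the other coordinates, so the map has unit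
    Jacobian; the proof uses Fubini instead, one coordinate at a time. Translations of the field are
    the case of constant [Phi], and rotations are composed of three such maps. *)
Lemma ge0_integral_shear m (A : pred 'I_m) (Phi : vec m -> 'I_m -> R)
    (f : vec m -> \bar R) :
  (forall k, A k -> measurable_fun setT (Phi ^~ k)) ->
  (forall t t' : vec m, (forall k, ~~ A k -> tnth t k = tnth t' k) ->
    forall k, A k -> Phi t k = Phi t' k) ->
  measurable_fun setT f -> (forall t, (0 <= f t)%E) ->
  (\int[lebesgue_tuple R m]_t f (shear A Phi t) = \int[lebesgue_tuple R m]_t f t)%E.
Proof.
elim: m A Phi f => [|m IH] A Phi f mPhi dPhi mf f0.
  have mfs : measurable_fun setT (fun t => f (shear A Phi t)).
    by apply: measurableT_comp => //; exact: measurable_shear.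
  by rewrite !integral_tuple0// (tuple0 (shear _ _ _)).
pose A' := [pred k : 'I_m | A (lift ord0 k)].
pose Ph x (t : vec m) k := Phi (tuple_cons (x, t)) (lift ord0 k).
have mPh x k : A' k -> measurable_fun setT (Ph x ^~ k).
  move=> Ak; apply: (measurableT_comp (mPhi _ _)) => //.
  exact: measurable_tuple_cons1.
have dPh x (t t' : vec m) : (forall k, ~~ A' k -> tnth t k = tnth t' k) ->
    forall k, A' k -> Ph x t k = Ph x t' k.
  move=> tt' k Ak; apply: dPhi => // j.
  have [i ->|-> _] := unliftP ord0 j; last by rewrite !tnth_tuple_cons0.
  by rewrite !tnth_tuple_consS; exact: tt'.
have mfs : measurable_fun setT (fun t => f (shear A Phi t)).
  by apply: measurableT_comp => //; exact: measurable_shear.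
rewrite !integral_tupleS//.
have [A0|A0] := boolP (A ord0); last first.
  apply: eq_integral => x _.
  rewrite -[RHS](IH A' (Ph x) (fun t => f (tuple_cons (x, t))) (mPh x) (dPh x))//; last first.
    by apply: measurableT_comp => //; exact: measurable_tuple_cons1.
  apply: eq_integral => t _; congr f; apply: tuple_consP => [|k].
    by rewrite tnth_tuple_cons0 tnth_mktuple (negbTE A0) tnth_tuple_cons0.
  by rewrite tnth_tuple_consS !tnth_mktuple tnth_tuple_consS.
(* The head coordinate is itself shifted, hence invisible to every relevant [Phi], and [0] may stand
   for it there. With [t] fixed, the head then undergoes a translation by a constant. *)
pose g x (t : vec m) := f (tuple_cons (x + Phi (tuple_cons (0, t)) ord0, shear A' (Ph 0) t)).
have fg x t : f (shear A Phi (tuple_cons (x, t))) = g x t.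
  have dx k : A k -> Phi (tuple_cons (x, t)) k = Phi (tuple_cons (0, t)) k.
    apply: dPhi => j; have [i ->|->] := unliftP ord0 j; last by rewrite A0.
    by rewrite !tnth_tuple_consS.
  congr f; apply: tuple_consP => [|k].
    by rewrite tnth_tuple_cons0 tnth_mktuple A0 tnth_tuple_cons0 dx.
  rewrite tnth_tuple_consS !tnth_mktuple tnth_tuple_consS /A'/=.
  by case: ifP => // Ak; rewrite dx.
under eq_integral do under eq_integral do rewrite fg.
have mg : measurable_fun setT (fun z : measurableTypeR R * vec m => g z.1 z.2).
  rewrite (_ : (fun _ => _) = (fun t => f (shear A Phi t)) \o @tuple_cons R m); last first.
    by apply/funext => -[x t]/=; rewrite fg.
  by apply: measurableT_comp => //; exact: measurable_tuple_cons.
have mc : measurable_fun setT (fun z : measurableTypeR R * vec m => f (tuple_cons (z.1, z.2))).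
  by apply: measurableT_comp => //; under eq_fun do rewrite -surjective_pairing; exact: measurable_tuple_cons.
rewrite (@fubini_tonelli _ _ _ _ _ leb (lebesgue_tuple R m) (fun z => g z.1 z.2))//=.
transitivity (\int[lebesgue_tuple R m]_t \int[leb]_x f (tuple_cons (x, shear A' (Ph 0%R) t)))%E.
  apply: eq_integral => t _.
  rewrite -[RHS](@ge0_integral_shift _ (Phi (tuple_cons (0, t)) ord0))//.
  apply: measurableT_comp => //; exact: measurable_tuple_cons2.
rewrite -(@fubini_tonelli _ _ _ _ _ leb (lebesgue_tuple R m) (fun z => f (tuple_cons (z.1, shear A' (Ph 0) z.2))))//=; last first.
  apply: (measurableT_comp mf).
  apply: (measurableT_comp (@measurable_tuple_cons R m)) => /=.
  apply: measurable_fun_pair => //.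
  apply: measurableT_comp => //; exact: measurable_shear (mPh 0).
apply: eq_integral => x _; apply: (IH A' (Ph 0) (fun t => f (tuple_cons (x, t))) (mPh 0) (dPh 0)) => //.
by apply: measurableT_comp => //; exact: measurable_tuple_cons1.
by move=> x; rewrite /g.
Qed.

Definition sorting (op : R -> R -> R * R) :=
  [\/ forall x y, op x y = (x, y),
      forall x y, op x y = (Num.min x y, Num.max x y) |
      forall x y, op x y = (Num.max x y, Num.min x y)].

Lemma sorting_cases op : sorting op ->
  (forall x y, op x y = (x, y)) \/
  (forall x y, [/\ op x y = (x, y) & op y x = (x, y)] \/
               [/\ op x y = (y, x) & op y x = (y, x)]).
Proof.
case=> h; [by left|right=> x y; rewrite !h..].
  by have [xy|yx] := leP x y; [left|right]; split.
by have [xy|yx] := leP x y; [right|left]; split.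
Qed.

(** Expand [(C - a) * (C - b) >= 0], insert [a * b <= C * E] and divide by [C]; infinite values and
    [C = 0] are separated first. *)
Lemma lee_sum_swap (a b C E : \bar R) :
  (0 <= a)%E -> (0 <= b)%E -> (0 <= C)%E -> (0 <= E)%E ->
  (a <= C)%E -> (b <= C)%E -> (a * b <= C * E)%E -> (a + b <= C + E)%E.
Proof.
move=> a0 b0 C0 E0 aC bC abCE.
have [->|Coo] := eqVneq C +oo%E.
  by rewrite addye ?leey// gt_eqF// (lt_le_trans _ E0)// ltNyr.
have [->|Eoo] := eqVneq E +oo%E.
  by rewrite addey ?leey// gt_eqF// (lt_le_trans _ C0)// ltNyr.
have Cf : C \is a fin_num by rewrite ge0_fin_numE// ltey.
have Ef : E \is a fin_num by rewrite ge0_fin_numE// ltey.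
have af : a \is a fin_num by rewrite ge0_fin_numE// (le_lt_trans aC)// ltey.
have bf : b \is a fin_num by rewrite ge0_fin_numE// (le_lt_trans bC)// ltey.
move: a b C E Cf Ef af bf a0 b0 C0 E0 aC bC abCE {Coo Eoo}.
move=> [a| |] [b| |] [C| |] [E| |]// _ _ _ _.
rewrite -!EFinM -!EFinD !lee_fin => a0 b0 C0 E0 aC bC abCE.
move: C0; rewrite le_eqVlt => /orP[/eqP C0|C0].
  by move: aC bC; rewrite -C0 => aC bC; lra.
rewrite -(ler_pM2l C0); nra.
Qed.

(** The Ahlswede-Daykin inequality on the line. When [op] sorts, [f1 x * f2 y] need not lie below
    [f3 x * f4 y], but a pointwise comparison holds once the term with [x] and [y] exchanged is
    added; hence both sides are doubled. *)
Lemma four_functions1 (op : R -> R -> R * R) (f1 f2 f3 f4 : R -> \bar R) :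
  sorting op ->
  measurable_fun [set: measurableTypeR R] f1 ->
  measurable_fun [set: measurableTypeR R] f2 ->
  measurable_fun [set: measurableTypeR R] f3 ->
  measurable_fun [set: measurableTypeR R] f4 ->
  (forall x, 0 <= f1 x)%E -> (forall x, 0 <= f2 x)%E ->
  (forall x, 0 <= f3 x)%E -> (forall x, 0 <= f4 x)%E ->
  (forall x y, f1 x * f2 y <= f3 (op x y).1 * f4 (op x y).2)%E ->
  (\int[leb]_x f1 x * \int[leb]_x f2 x <=
   \int[leb]_x f3 x * \int[leb]_x f4 x)%E.
Proof.
move=> /sorting_cases hop m1 m2 m3 m4 p1 p2 p3 p4 h.
pose mT : set (measurableTypeR R) := setT.
have prodE (f g : R -> \bar R) : measurable_fun mT f -> measurable_fun mT g ->
    (forall x, 0 <= f x)%E -> (forall x, 0 <= g x)%E ->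
    (\int[leb]_x f x * \int[leb]_x g x = \int[leb]_x \int[leb]_y (f x * g y))%E.
  move=> mf mg f0 g0.
  under [RHS]eq_integral do rewrite ge0_integralZl//.
  by rewrite ge0_integralZr// integral_ge0.
have mprod (f g : R -> \bar R) : measurable_fun mT f -> measurable_fun mT g ->
    measurable_fun setT (fun z : measurableTypeR R * measurableTypeR R => f z.1 * g z.2)%E.
  by move=> mf mg; apply: emeasurable_funM;
       [exact: (measurableT_comp mf measurable_fst)|exact: (measurableT_comp mg measurable_snd)].
have mI (f : R * R -> \bar R) :
    measurable_fun [set: measurableTypeR R * measurableTypeR R] f ->
    (forall z, 0 <= f z)%E -> measurable_fun mT (fun x => \int[leb]_y f (x, y))%E.
  by move=> mf f0; exact: (@measurable_fun_fubini_tonelli_F _ _ (measurableTypeR R) (measurableTypeR R) R leb f mf f0).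
have mS (x : R) (f : R * R -> \bar R) :
    measurable_fun [set: measurableTypeR R * measurableTypeR R] f ->
    measurable_fun mT (fun y => f (x, y)).
  by move=> mf; apply: measurableT_comp => //; exact: measurable_pair1.
have p12 x y : (0 <= f1 x * f2 y)%E by exact: mule_ge0.
have p34 x y : (0 <= f3 x * f4 y)%E by exact: mule_ge0.
have le_dbl (F G : R * R -> \bar R) :
   measurable_fun [set: measurableTypeR R * measurableTypeR R] F ->
   measurable_fun [set: measurableTypeR R * measurableTypeR R] G ->
   (forall z, 0 <= F z)%E -> (forall z, 0 <= G z)%E -> (forall z, F z <= G z)%E ->
   (\int[leb]_x \int[leb]_y F (x, y) <= \int[leb]_x \int[leb]_y G (x, y))%E.
  move=> mF mG F0 G0 FG; apply: ge0_le_integral => //=.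
  - by move=> x _; apply: integral_ge0.
  - exact: mI.
  - exact: mI.
  - move=> x _; apply: ge0_le_integral => //=; exact: mS.
have [{}hop|{}hop] := hop.
  rewrite !prodE//; apply: (le_dbl (fun z => f1 z.1 * f2 z.2)%E (fun z => f3 z.1 * f4 z.2)%E) => //=.
  - exact: mprod.
  - exact: mprod.
  - by move=> [x y]/=; have := h x y; rewrite hop.
have sw (f g : R -> \bar R) : measurable_fun mT f -> measurable_fun mT g ->
    (forall x, 0 <= f x)%E -> (forall x, 0 <= g x)%E ->
    (\int[leb]_x f x * \int[leb]_x g x + \int[leb]_x f x * \int[leb]_x g x
     = \int[leb]_x \int[leb]_y (f x * g y + f y * g x))%E.
  move=> mf mg f0 g0; rewrite prodE//.
  rewrite [X in (_ + X = _)%E](@fubini_tonelli _ _ _ _ _ leb leb (fun z => f z.1 * g z.2)%E)//=; last 2 first.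
  - exact: mprod.
  - by move=> z; exact: mule_ge0.
  have mp2 : measurable_fun setT (fun z : measurableTypeR R * measurableTypeR R => f z.2 * g z.1)%E.
    by apply: emeasurable_funM;
       [exact: (measurableT_comp mf measurable_snd)|exact: (measurableT_comp mg measurable_fst)].
  rewrite -ge0_integralD//=.
  - apply: eq_integral => x _; rewrite -ge0_integralD//=.
    + by move=> y _; exact: mule_ge0.
    + exact: (mS x _ (mprod _ _ mf mg)).
    + by move=> y _; exact: mule_ge0.
    + exact: (mS x _ mp2).
  - by move=> x _; apply: integral_ge0 => y _; exact: mule_ge0.
  - by apply: (mI _ (mprod _ _ mf mg)) => z; exact: mule_ge0.
  - by move=> x _; apply: integral_ge0 => y _; exact: mule_ge0.
  - by apply: (mI _ mp2) => z; exact: mule_ge0.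
set I12 := (_ * _)%E; set I34 := (_ * _)%E.
have I0 : (0 <= I34)%E by apply: mule_ge0; exact: integral_ge0.
suff : (I12 + I12 <= I34 + I34)%E.
  have J0 : (0 <= I12)%E by apply: mule_ge0; exact: integral_ge0.
  move: I12 I34 I0 J0 => [a| |] [b| |]//= _ _; rewrite ?leey//.
  by rewrite -!EFinD !lee_fin; lra.
rewrite /I12 /I34 !sw//.
have mp (f g : R -> \bar R) : measurable_fun mT f -> measurable_fun mT g ->
    measurable_fun setT (fun z : measurableTypeR R * measurableTypeR R => f z.1 * g z.2 + f z.2 * g z.1)%E.
  move=> mf mg; apply: emeasurable_funD; first exact: mprod.
  by apply: emeasurable_funM;
       [exact: (measurableT_comp mf measurable_snd)|exact: (measurableT_comp mg measurable_fst)].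
apply: (le_dbl (fun z => f1 z.1 * f2 z.2 + f1 z.2 * f2 z.1)%E (fun z => f3 z.1 * f4 z.2 + f3 z.2 * f4 z.1)%E) => /=.
- exact: mp.
- exact: mp.
- by move=> z; apply: adde_ge0.
- by move=> z; apply: adde_ge0.
move=> [x y]/=.
(* The diagonal instances bound the product of the two symmetrised terms, while each term separately
   lies below the product at the sorted pair: these are the hypotheses of [lee_sum_swap]. *)
have hd z : (f1 z * f2 z <= f3 z * f4 z)%E.
  by have := h z z; have [[-> _]|[-> _]] := hop z z.
have prodle : (f1 x * f2 y * (f1 y * f2 x) <= f3 x * f4 y * (f3 y * f4 x))%E.
  have -> : (f1 x * f2 y * (f1 y * f2 x) = f1 x * f2 x * (f1 y * f2 y))%E.
    by rewrite !muleA (muleAC (f1 x)) muleAC -!muleA; congr (_ * _)%E; rewrite muleCA.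
  have -> : (f3 x * f4 y * (f3 y * f4 x) = f3 x * f4 x * (f3 y * f4 y))%E.
    by rewrite !muleA (muleAC (f3 x)) muleAC -!muleA; congr (_ * _)%E; rewrite muleCA.
  by apply: lee_pmul.
have hxy := h x y; have hyx := h y x.
have [[e1 e2]|[e1 e2]] := hop x y; rewrite e1 e2 /= in hxy hyx.
  by apply: lee_sum_swap.
rewrite [X in (_ <= X)%E]addeC; apply: lee_sum_swap => //.
by rewrite [X in (_ <= X)%E]muleC.
Qed.

(** Integrating out all coordinates but the first leaves four functions of one variable, and the
    induction hypothesis is exactly the one-dimensional assumption on them. *)
Lemma four_functions m (op : 'I_m -> R -> R -> R * R) (f1 f2 f3 f4 : vec m -> \bar R) :
  (forall k, sorting (op k)) ->
  measurable_fun setT f1 -> measurable_fun setT f2 ->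
  measurable_fun setT f3 -> measurable_fun setT f4 ->
  (forall t, 0 <= f1 t)%E -> (forall t, 0 <= f2 t)%E ->
  (forall t, 0 <= f3 t)%E -> (forall t, 0 <= f4 t)%E ->
  (forall s t : vec m, f1 s * f2 t <=
     f3 [tuple (op k (tnth s k) (tnth t k)).1 | k < m] *
     f4 [tuple (op k (tnth s k) (tnth t k)).2 | k < m])%E ->
  (\int[lebesgue_tuple R m]_t f1 t * \int[lebesgue_tuple R m]_t f2 t <=
   \int[lebesgue_tuple R m]_t f3 t * \int[lebesgue_tuple R m]_t f4 t)%E.
Proof.
elim: m op f1 f2 f3 f4 => [|m IH] op f1 f2 f3 f4 hop m1 m2 m3 m4 p1 p2 p3 p4 h.
  rewrite !integral_tuple0//; have := h [tuple] [tuple].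
  by rewrite (tuple0 (mktuple _)) (tuple0 (mktuple _)).
have mc (f : vec m.+1 -> \bar R) : measurable_fun setT f -> (forall t, 0 <= f t)%E ->
    measurable_fun [set: measurableTypeR R] (fun x : R => \int[lebesgue_tuple R m]_t f (tuple_cons (x, t)))%E.
  move=> mf f0; apply: (measurable_fun_fubini_tonelli_F (f \o @tuple_cons R m)) => //=.
  by apply: measurableT_comp => //; exact: measurable_tuple_cons.
have mc1 (x : R) (f : vec m.+1 -> \bar R) : measurable_fun setT f ->
   measurable_fun setT (fun t => f (tuple_cons (x, t))).
  by move=> mf; apply: measurableT_comp => //; exact: measurable_tuple_cons1.
rewrite !integral_tupleS//.
apply: (@four_functions1 (op ord0)) => //; try exact: mc;
  try by move=> x; apply: integral_ge0.
move=> x y; apply: (IH (fun k => op (lift ord0 k))) => //; try exact: mc1.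
move=> s t; apply: (le_trans (h _ _)).
rewrite le_eqVlt; apply/orP; left; apply/eqP.
congr (f3 _ * f4 _)%E; apply: tuple_consP => [|k].
- by rewrite tnth_mktuple !tnth_tuple_cons0.
- by rewrite tnth_mktuple !tnth_tuple_consS tnth_mktuple.
- by rewrite tnth_mktuple !tnth_tuple_cons0.
- by rewrite tnth_mktuple !tnth_tuple_consS tnth_mktuple.
Qed.

End tuple_integral.

(** * The radial flow on the square lattice *)

Section green.
Context (R : realType).
Implicit Types x y p q : R.

Lemma atan_add_inv x : 0 < x -> atan x + atan x^-1 = pi / 2.
Proof.
move=> x0; have a0 : 0 < atan x by rewrite -[X in X < _](@atan0 R) lt_atan.
have -> : x^-1 = tan (pi / 2 - atan x).
  by rewrite /tan sinB cosB sin_pihalf cos_pihalf !mul0r !mul1r subr0 add0r -[in LHS](atanK x) /tan invf_div.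
have := atan_ltpi2 x; have := pi_gt0 R => pi0 ax.
by rewrite tanK; [lra|rewrite in_itv/=; apply/andP; split; lra].
Qed.

Lemma atan_diff_bounds x y : 0 <= x -> x <= y ->
  (y - x) / (1 + y ^+ 2) <= atan y - atan x <= (y - x) / (1 + x ^+ 2).
Proof.
move=> x0 xy.
have [|c /[!in_itv]/= /andP[xc cy] ->] := @MVT_segment R atan (fun z => (1 + z ^+ 2)^-1) x y xy (fun z _ => is_derive1_atan z).
  by apply: continuous_subspaceT => z; exact: continuous_atan.
rewrite ![(_ - _) / _]mulrC.
have c0 : 0 <= c := le_trans x0 xc.
have d (z : R) : 0 < 1 + z ^+ 2 by have := sqr_ge0 z; lra.
by apply/andP; split; apply: ler_wpM2r; rewrite ?subr_ge0// lef_pV2 ?posrE// lerD2l ler_sqr ?nnegrE// (le_trans c0).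
Qed.

(* [2 pi] times the flux of the radial field [z / (2 pi |z|^2)] through the unit
   segment dual to the edge from [(a, b)] to [(a + 1, b)] *)
Definition flux (a b : int) : R :=
  atan ((b%:~R + 2^-1) / (a%:~R + 2^-1)) - atan ((b%:~R - 2^-1) / (a%:~R + 2^-1)).

Lemma half_neq0 (a : int) : a%:~R + 2^-1 != 0 :> R.
Proof.
apply/eqP => h; have : (2 * a + 1)%:~R = 0 :> R by rewrite rmorphD rmorphM /=; lra.
by move/eqP; rewrite intr_eq0; lia.
Qed.

Lemma half_sg (a : int) : (0 < a%:~R + 2^-1 :> R) = (0 <= a)%R.
Proof.
have -> : (0 < a%:~R + 2^-1 :> R) = (0 < (2 * a + 1)%:~R :> R).
  by rewrite rmorphD rmorphM /=; apply/idP/idP; lra.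
by rewrite ltr0z; lia.
Qed.

Lemma atan_div (p q : R) : p != 0 -> q != 0 ->
  atan (p / q) + atan (q / p) = (if (0 < p) == (0 < q) then 1 else -1) * (pi / 2).
Proof.
move=> p0 q0.
have H (u v : R) : 0 < u -> 0 < v -> atan (u / v) + atan (v / u) = pi / 2.
  by move=> u0 v0; rewrite -(atan_add_inv (divr_gt0 u0 v0)) invf_div.
case: (ltrgtP 0 p) p0 => // hp _; case: (ltrgtP 0 q) q0 => // hq _ /=.
- by rewrite H// mul1r.
- have := H p (- q) hp; rewrite oppr_gt0 => /(_ hq).
  by rewrite invrN mulrN (mulNr q) !atanN; lra.
- have := H (- p) q; rewrite oppr_gt0 => /(_ hp hq).
  by rewrite invrN mulrN (mulNr p) !atanN; lra.
- have := H (- p) (- q); rewrite !oppr_gt0 => /(_ hp hq).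
  by rewrite !invrN !mulrNN mul1r.
Qed.

(** The four corners of the dual square around [(a, b)] each contribute
    [atan (p / q) + atan (q / p)], which is [pi / 2] or [- pi / 2] by the signs of [p] and [q].
    These cancel unless the square contains the origin, where they add up to the full angle. *)
Lemma flux_div (a b : int) :
  flux a b - flux (a - 1) b + (flux b a - flux (b - 1) a) =
  (if (a == 0) && (b == 0) then 2 * pi else 0).
Proof.
rewrite /flux.
have e (c : int) : (c - 1)%:~R + 2^-1 = c%:~R - 2^-1 :> R by rewrite rmorphB /=; lra.
have n0 c : c%:~R - 2^-1 != 0 :> R by rewrite -e half_neq0.
have s c : (0 < c%:~R - 2^-1 :> R) = (1 <= c)%R by rewrite -e half_sg; lia.
rewrite !e.
have := atan_div (half_neq0 a) (half_neq0 b).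
have := atan_div (half_neq0 a) (n0 b).
have := atan_div (n0 a) (half_neq0 b).
have := atan_div (n0 a) (n0 b).
rewrite !half_sg !s.
set A1 := atan _; set A2 := atan _; set A3 := atan _; set A4 := atan _.
set A5 := atan _; set A6 := atan _; set A7 := atan _; set A8 := atan _.
have tri (c : int) : [\/ [/\ (0 <= c) = false, (1 <= c) = false & (c == 0) = false],
    [/\ (0 <= c), (1 <= c) = false & (c == 0)] |
    [/\ (0 <= c), (1 <= c) & (c == 0) = false]].
  have [c0|c0|->] := ltrgtP c 0; [constructor 1|constructor 3|constructor 2];
    by split => //; lia.
by case: (tri a) => -[-> -> ->]; case: (tri b) => -[-> -> ->] /=; lra.
Qed.

(** The window from [- M] to [M - 1], paired by the reflection [a -> - a - 1]: it preserves the set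
    of horizontal edges from [a] to [a + 1] and reverses the flux through them. *)
Definition crange (M : nat) : seq int :=
  [seq k%:Z | k <- iota 0 M] ++ [seq - k%:Z - 1 | k <- iota 0 M].

Lemma mem_crange M (a : int) : (a \in crange M) = (- M%:Z <= a < M%:Z).
Proof.
rewrite mem_cat; apply/orP/idP => [[/mapP[k]|/mapP[k]]|].
- by rewrite mem_iota => h ->; lia.
- by rewrite mem_iota => h ->; lia.
case: a => k h; [left|right]; apply/mapP.
  by exists k => //; rewrite mem_iota; lia.
by exists k; rewrite ?mem_iota ?NegzE; lia.
Qed.

Lemma crange_uniq M : uniq (crange M).
Proof.
rewrite cat_uniq !map_inj_uniq ?iota_uniq ?andbT/=; last 2 first.
- by move=> i j; lia.
- by move=> i j; lia.
by apply/hasPn => _ /mapP[k _ ->]; apply/mapP => -[j _]; lia.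
Qed.

Lemma big_crange (F : int -> R) M :
  \sum_(a <- crange M) F a = \sum_(k < M) (F k%:Z + F (- k%:Z - 1)).
Proof.
have e (G : nat -> R) : \sum_(k <- iota 0 M) G k = \sum_(k < M) G k.
  by rewrite -(big_mkord xpredT) /index_iota subn0.
by rewrite big_cat/= !big_map big_split/= !e.
Qed.

Local Notation h k := (k%:R + 2^-1 : R).

Lemma h_gt0 (k : nat) : 0 < h k.
Proof. by have := ler0n R k; lra. Qed.

Lemma fluxN (a b : int) : flux (- a - 1) b = - flux a b.
Proof.
rewrite /flux.
have -> : (- a - 1)%:~R + 2^-1 = - (a%:~R + 2^-1) :> R by rewrite rmorphB rmorphN /=; lra.
by rewrite !invrN !mulrN !atanN; lra.
Qed.

Lemma flux_sym (a b : int) : flux a (- b) = flux a b.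
Proof.
rewrite /flux.
have -> : (- b)%:~R + 2^-1 = - (b%:~R - 2^-1) :> R by rewrite rmorphN /=; lra.
have -> : (- b)%:~R - 2^-1 = - (b%:~R + 2^-1) :> R by rewrite rmorphN /=; lra.
by rewrite !mulNr !atanN; lra.
Qed.

Lemma flux0_le (k : nat) : flux k%:Z 0 ^+ 2 <= (h k ^+ 2)^-1.
Proof.
have p0 := h_gt0 k.
rewrite /flux -[(k%:Z)%:~R]/(k%:R : R) add0r sub0r mulNr atanN opprK.
have y0 : 0 <= 2^-1 / h k by rewrite divr_ge0// ltW.
have /andP[A B] := atan_diff_bounds (lexx 0) y0.
move: A B; rewrite atan0 !subr0 expr0n /= addr0 divr1 => A B.
have A0 : 0 <= atan (2^-1 / h k).
  by apply: le_trans A; rewrite divr_ge0// addr_ge0// sqr_ge0.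
rewrite -exprVn ler_sqr ?nnegrE ?invr_ge0 ?(ltW p0)//; last by rewrite addr_ge0.
rewrite [leRHS](_ : (h k)^-1 = 2^-1 / h k + 2^-1 / h k); last by rewrite -mulrDl; lra.
by move: B; lra.
Qed.

(** The segment dual to height [j + 1] starts at height [h j], where the derivative of [atan] is
    largest along it; hence the index [j] on the right. *)
Lemma fluxS_le (k j : nat) :
  flux k%:Z j.+1%:Z ^+ 2 <= (h k / (h k ^+ 2 + h j ^+ 2)) ^+ 2.
Proof.
have p0 := h_gt0 k; have q0 := h_gt0 j.
rewrite /flux -[(k%:Z)%:~R]/(k%:R : R).
have -> : (j.+1%:Z)%:~R + 2^-1 = h j + 1 :> R by rewrite -[(j.+1%:Z)%:~R]/(j.+1%:R) -natr1; lra.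
have -> : (j.+1%:Z)%:~R - 2^-1 = h j :> R by rewrite -[(j.+1%:Z)%:~R]/(j.+1%:R) -natr1; lra.
have x0 : 0 <= h j / h k by rewrite divr_ge0// ltW.
have xy : h j / h k <= (h j + 1) / h k by rewrite ler_pM2r ?invr_gt0// lerDl.
have /andP[_ B] := atan_diff_bounds x0 xy.
rewrite ler_sqr ?nnegrE; last 2 first.
- by rewrite subr_ge0 le_atan.
- by apply: divr_ge0; [exact: ltW|rewrite addr_ge0 ?sqr_ge0].
apply: (le_trans B); rewrite le_eqVlt; apply/orP; left; apply/eqP.
have d1 : h k ^+ 2 + h j ^+ 2 != 0 by rewrite gt_eqF// addr_gt0 ?exprn_gt0.
by field; rewrite !gt_eqF//= ?addr_gt0 ?exprn_gt0.
Qed.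

(** Comparison with the integral of [1 / (p ^+ 2 + y ^+ 2)] in [y], whose primitive is
    [atan (y / p) / p]. The induction carries the [atan] and bounds it by [pi / 2] only at the
    end. *)
Lemma sum_inv_le (k M : nat) :
  \sum_(j < M) (h k ^+ 2 + h j ^+ 2)^-1 <= (h k ^+ 2)^-1 + pi / 2 / h k.
Proof.
have p0 := h_gt0 k.
have t0 j : 0 <= (h k ^+ 2 + h j ^+ 2)^-1 by rewrite invr_ge0 addr_ge0// sqr_ge0.
suff H : \sum_(j < M.+1) (h k ^+ 2 + h j ^+ 2)^-1 <= (h k ^+ 2)^-1 + atan (h M / h k) / h k.
  apply: (@le_trans _ _ (\sum_(j < M.+1) (h k ^+ 2 + h j ^+ 2)^-1)).
    by rewrite big_ord_recr/= lerDl.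
  apply: (le_trans H); rewrite lerD2l ler_pM2r ?invr_gt0//; exact/ltW/atan_ltpi2.
elim: M => [|M IH].
  rewrite big_ord_recr big_ord0/= add0r -[leLHS]addr0 lerD//.
    by rewrite lef_pV2 ?posrE ?addr_gt0 ?exprn_gt0// lerDl sqr_ge0.
  rewrite divr_ge0 ?ltW//.
  by rewrite -[X in X < _](@atan0 R) lt_atan// divr_gt0// add0r.
rewrite big_ord_recr/=.
have q0 := h_gt0 M; have r0 := h_gt0 M.+1.
have x0 : 0 <= h M / h k by rewrite divr_ge0// ltW.
have xy : h M / h k <= h M.+1 / h k by rewrite ler_pM2r ?invr_gt0// lerD2r ler_nat.
have /andP[B _] := atan_diff_bounds x0 xy.
have E : (h M.+1 / h k - h M / h k) / (1 + (h M.+1 / h k) ^+ 2) = h k / (h k ^+ 2 + h M.+1 ^+ 2).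
  rewrite -mulrBl (_ : h M.+1 - h M = 1); last by rewrite -natr1; lra.
  by field; rewrite !gt_eqF//= ?addr_gt0 ?exprn_gt0.
rewrite E in B.
apply: (le_trans (lerD IH (lexx _))).
rewrite -addrA lerD2l -(ler_pM2l p0) mulrDr !(mulrCA (h k)) mulfV ?gt_eqF// !mulr1.
by rewrite addrC -lerBrDr.
Qed.

Lemma sum_hV (M : nat) : \sum_(k < M.+1) (h k)^-1 <= 4 + ln (h M).
Proof.
elim: M => [|M IH].
  rewrite big_ord_recr big_ord0/= !add0r invrK lnV ?posrE//.
  have := @le_ln1Dx R 1; rewrite (_ : 1 + 1 = 2 :> R)//.
  by move=> /(_ _)h; have := h ltac:(lra); lra.
rewrite big_ord_recr/=; apply: (le_trans (lerD IH (lexx _))); rewrite -addrA lerD2l.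
have q0 := h_gt0 M; have r0 := h_gt0 M.+1.
rewrite -lerBrDl -ln_div ?posrE// -lerN2 -lnV ?posrE ?divr_gt0// invf_div.
have -> : h M / h M.+1 = 1 + (- (h M.+1)^-1).
  by rewrite -natr1 in r0 *; field; rewrite gt_eqF//; lra.
apply: le_ln1Dx; rewrite ltrN2 invf_lt1//.
by have := ler0n R M; rewrite -natr1; lra.
Qed.

(** Telescoping against [1 / x]: the induction carries [6 - (h M)^-1] and starts with the equality
    [4 = 6 - 2]. *)
Lemma sum_hV2 (M : nat) : \sum_(k < M) (h k ^+ 2)^-1 <= 6.
Proof.
have t0 k : 0 <= (h k ^+ 2)^-1 by rewrite invr_ge0 sqr_ge0.
suff H : \sum_(k < M.+1) (h k ^+ 2)^-1 <= 6 - (h M)^-1.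
  apply: (@le_trans _ _ (\sum_(j < M.+1) (h j ^+ 2)^-1)).
    by rewrite big_ord_recr/= lerDl.
  by apply: (le_trans H); rewrite gerBl invr_ge0 ltW// h_gt0.
elim: M => [|M IH].
  by rewrite big_ord_recr big_ord0/= !add0r -exprVn invrK; lra.
rewrite big_ord_recr/=; apply: (le_trans (lerD IH (lexx _))); rewrite -addrA lerD2l.
have q0 := h_gt0 M; have r0 := h_gt0 M.+1.
have -> : h M.+1 = h M + 1 by rewrite -natr1; lra.
set x := h M in q0 *.
suff : x^-1 - (x + 1)^-1 - ((x + 1) ^+ 2)^-1 >= 0 by lra.
have -> : x^-1 - (x + 1)^-1 - ((x + 1) ^+ 2)^-1 = (x * (x + 1) ^+ 2)^-1.
  by field; rewrite !gt_eqF// addr_gt0.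
by rewrite invr_ge0 mulr_ge0 ?sqr_ge0// ltW.
Qed.

(** The coefficient [pi] must be exact, as it becomes the leading coefficient [1] in the variance
    bound. It is the [pi / 2] of each row sum, doubled by the reflection to negative [a]. *)
Lemma flux_energy (M : nat) : (0 < M)%N ->
  \sum_(a <- crange M) \sum_(b <- crange M) flux a b ^+ 2 <=
  24 + pi * (4 + ln M%:R).
Proof.
move=> M0.
pose G (k j : nat) := (h k / (h k ^+ 2 + h j ^+ 2)) ^+ 2.
have row (k : nat) : \sum_(b <- crange M) flux k%:Z b ^+ 2 <=
    (h k ^+ 2)^-1 + \sum_(j < M) (G k j + G k j).
  rewrite big_crange big_split/= [X in _ <= _ + X]big_split/= addrA lerD//; last first.
    apply: ler_sum => j _; rewrite -opprD flux_sym.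
    by rewrite (_ : j%:Z + 1 = j.+1%:Z) ?fluxS_le//; lia.
  apply: (@le_trans _ _ (\sum_(j < M.+1) flux k j%:Z ^+ 2)).
    by rewrite big_ord_recr/= lerDl sqr_ge0.
  rewrite big_ord_recl lerD//; first exact: flux0_le.
  by apply: ler_sum => j _; exact: fluxS_le.
(* Exchanging [k] and [j] in one of the two copies adds the squares of both components of the radial
   field, so each term becomes the inverse squared distance to the origin. *)
have sG : \sum_(k < M) \sum_(j < M) (G k j + G k j) =
    \sum_(k < M) \sum_(j < M) (h k ^+ 2 + h j ^+ 2)^-1.
  under eq_bigr do rewrite big_split/=.
  rewrite big_split/= [X in _ + X]exchange_big/= -big_split/=.
  apply: eq_bigr => k _; rewrite -big_split/=; apply: eq_bigr => j _.
  rewrite /G addrC [h j ^+ 2 + _]addrC.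
  have d0 : h k ^+ 2 + h j ^+ 2 != 0 by rewrite gt_eqF// addr_gt0 ?exprn_gt0 ?h_gt0.
  by field.
rewrite big_crange.
have -> : \sum_(k < M) (\sum_(b <- crange M) flux k b ^+ 2 + \sum_(b <- crange M) flux (- k%:Z - 1) b ^+ 2)
   = 2 * \sum_(k < M) \sum_(b <- crange M) flux k b ^+ 2.
  rewrite mulr_sumr; apply: eq_bigr => k _.
  by under [X in _ + X]eq_bigr do rewrite fluxN sqrrN; rewrite mulrDl !mul1r.
have H : \sum_(k < M) \sum_(b <- crange M) flux k b ^+ 2 <= 6 + (6 + pi / 2 * (4 + ln M%:R)).
  apply: le_trans (ler_sum _ (fun (k : 'I_M) _ => row k)) _.
  rewrite big_split/= lerD ?sum_hV2// sG.
  apply: le_trans (ler_sum _ (fun (k : 'I_M) _ => sum_inv_le k M)) _.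
  rewrite big_split/= lerD ?sum_hV2// -mulr_sumr ler_pM2l ?divr_gt0 ?pi_gt0//.
  case: M M0 {row sG} => // M _; apply: (le_trans (sum_hV M)); rewrite lerD2l.
  by rewrite ler_ln ?posrE ?h_gt0 ?ltr0n//; have E : M.+1%:R = M%:R + 1 :> R := esym (natr1 M); lra.
by move: H; have := pi_gt0 R; lra.
Qed.

End green.

(** * Summation by parts on the lattice and the pointwise energy bound *)

Section lattice.
Context (R : realType).

Lemma sum_supp (T : eqType) (V : nmodType) (r1 r2 : seq T) (F : T -> V) :
  uniq r1 -> uniq r2 -> (forall x, F x != 0 -> (x \in r1) && (x \in r2)) ->
  \sum_(x <- r1) F x = \sum_(x <- r2) F x.
Proof.
move=> u1 u2 s.
have red (r : seq T) : \sum_(x <- r) F x = \sum_(x <- [seq x <- r | F x != 0]) F x.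
  rewrite big_filter [RHS]big_mkcond/=; apply: eq_bigr => x _.
  by case: eqP => // ->.
rewrite red [RHS]red; apply: perm_big; apply: uniq_perm; rewrite ?filter_uniq// => x.
by rewrite !mem_filter; case: (boolP (F x != 0)) => //= /s /andP[-> ->].
Qed.

Lemma cauchy_schwarz_sum (T : Type) (r : seq T) (a b : T -> R) :
  (\sum_(i <- r) a i * b i) ^+ 2 <= (\sum_(i <- r) a i ^+ 2) * \sum_(i <- r) b i ^+ 2.
Proof.
set A := \sum_(i <- r) a i ^+ 2; set B := \sum_(i <- r) b i ^+ 2; set C := \sum_(i <- r) _.
have A0 : 0 <= A by apply: sumr_ge0 => i _; exact: sqr_ge0.
have key (u v : R) : 0 <= u ^+ 2 * A + u * v * C *+ 2 + v ^+ 2 * B.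
  have -> : u ^+ 2 * A + u * v * C *+ 2 + v ^+ 2 * B = \sum_(i <- r) (u * a i + v * b i) ^+ 2.
    rewrite /A /B /C -mulrnAr !mulr_sumr -sumrMnl mulr_sumr -!big_split/=.
    by apply: eq_bigr => i _; ring.
  by apply: sumr_ge0 => i _; exact: sqr_ge0.
move: A0; rewrite le_eqVlt => /predU1P[A0|A0]; last first.
  have := key C (- A) => h; suff : 0 <= A * (A * B - C ^+ 2).
    by rewrite pmulr_rge0// subr_ge0.
  by apply: le_trans h _; rewrite le_eqVlt; apply/orP; left; apply/eqP; ring.
have B0 : 0 <= B by apply: sumr_ge0 => i _; exact: sqr_ge0.
rewrite -A0 mul0r; have [->|C0] := eqVneq C 0; first by rewrite expr0n.
(* With [A = 0] the form is affine in [u], and at this value of [u] it would be negative. *)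
have := key (- (1 + B) / C) 1; rewrite -A0 mulr0 add0r expr1n mul1r mulr1.
by rewrite mulfVK//; lra.
Qed.

Definition sq (M : nat) : seq Z2 := [seq (a, b) | a <- crange M, b <- crange M].

Lemma mem_sq M (x : Z2) :
  (x \in sq M) = (- M%:Z <= x.1 < M%:Z) && (- M%:Z <= x.2 < M%:Z).
Proof.
case: x => a b /=; rewrite -!mem_crange; apply/allpairsP/andP => [[[c d]/= [hc hd [-> ->]]]//|[ha hb]].
by exists (a, b).
Qed.

Lemma sq_uniq M : uniq (sq M).
Proof. by apply: allpairs_uniq; rewrite ?crange_uniq// => -[a b] [c d] _ _ [-> ->]. Qed.

Lemma mem_box n (x : Z2) : (x \in box n) = (`|x.1| * 2 <= n)%N && (`|x.2| * 2 <= n)%N.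
Proof.
rewrite /box inE/= -!mem_centered_range; case: x => a b /=.
apply/allpairsP/andP => [[[i j]/= [hi hj [-> ->]]]//|[ha hb]].
by exists (a, b).
Qed.

Definition closure_fset (G : {fset Z2}) := (G `|` outer_boundary G)%fset.

Lemma nbrsP (x y : Z2) : y \in nbrs x -> x \in nbrs y.
Proof.
case: x => a b; case: y => c d; rewrite !inE/= !xpair_eqE.
by move=> /or4P[] /andP[/eqP -> /eqP ->]; apply/or4P;
  [constructor 2|constructor 1|constructor 4|constructor 3]; apply/andP; split; apply/eqP; lia.
Qed.

Lemma nbrs_uniq (x : Z2) : uniq (nbrs x).
Proof.
by case: x => a b; rewrite /nbrs /= !inE !xpair_eqE /=; lia.
Qed.

Lemma mem_closure_fset (G : {fset Z2}) (x y : Z2) :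
  x \in G -> y \in nbrs x -> y \in closure_fset G.
Proof.
move=> xG yx; rewrite /closure_fset in_fsetU /outer_boundary !inE/=.
case: (boolP (y \in G)) => //= _; rewrite andbT.
by apply/flattenP; exists (nbrs x) => //; apply/mapP; exists x.
Qed.

Definition edge_energy (f : Z2 -> R) (x : Z2) : R :=
  (f x - f (x.1 + 1, x.2)) ^+ 2 + (f x - f (x.1, x.2 + 1)) ^+ 2.

Definition edge_pairs (G : {fset Z2}) (F : Z2 -> Z2 -> R) : R :=
  \sum_(x <- closure_fset G) \sum_(y <- closure_fset G | y \in nbrs x) F x y.

Lemma sum_shift M (H : Z2 -> R) (e : Z2) :
  (forall x, H x != 0 -> (x \in sq M) && ((x.1 - e.1, x.2 - e.2) \in sq M)) ->
  \sum_(x <- sq M) H (x.1 + e.1, x.2 + e.2) = \sum_(x <- sq M) H x.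
Proof.
move=> s; pose T (x : Z2) : Z2 := (x.1 + e.1, x.2 + e.2).
rewrite -(big_map T xpredT H); apply: sum_supp; rewrite ?sq_uniq//.
  by rewrite map_inj_uniq ?sq_uniq// => -[a b] [c d] []/= *; congr pair; lia.
move=> x /s /andP[-> h]; rewrite andbT; apply/mapP; exists (x.1 - e.1, x.2 - e.2) => //.
by rewrite /T/=; case: x {h} => a b /=; congr pair; lia.
Qed.

(** The factor [2] counts every edge from both ends; the window [sq M] contains both endpoints of
    every edge along which [f] varies. *)
Lemma edge_pairs_sum (G : {fset Z2}) M (f : Z2 -> R) :
  (forall x, x \notin G -> f x = 0) ->
  (forall x, x \in G -> `|x.1| + 1 < M%:Z /\ `|x.2| + 1 < M%:Z) ->
  edge_pairs G (fun x y => (f x - f y) ^+ 2) = 2 * \sum_(x <- sq M) edge_energy f x.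
Proof.
move=> f0 GM; pose F x y := (f x - f y) ^+ 2.
have FG x y : F x y != 0 -> x \in G \/ y \in G.
  case: (boolP (x \in G)) => xG; first by left.
  case: (boolP (y \in G)) => yG; first by right.
  by rewrite /F !f0// subrr expr0n eqxx.
have fGc x y : y \in nbrs x -> F x y != 0 -> x \in closure_fset G /\ y \in closure_fset G.
  move=> yx /FG[xG|yG]; (split; last by [exact: (mem_closure_fset xG)|rewrite in_fsetU yG]).
    by rewrite in_fsetU xG.
  exact: (mem_closure_fset yG (nbrsP yx)).
have inM x y : y \in nbrs x -> F x y != 0 -> x \in sq M /\ y \in sq M.
  move=> + /FG h; rewrite !mem_sq !inE => yx; case: h => /GM.
    by case: x y yx => a b [c d]/=; rewrite !xpair_eqE => /or4P[] /andP[/eqP -> /eqP ->]; lia.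
  by case: x y yx => a b [c d]/=; rewrite !xpair_eqE => /or4P[] /andP[/eqP -> /eqP ->]; lia.
transitivity (\sum_(x <- closure_fset G) \sum_(y <- nbrs x) F x y).
  apply: eq_big_seq => x xG; rewrite -big_filter.
  rewrite (eq_big_seq (fun y => if y \in nbrs x then F x y else 0)); last first.
    by move=> y; rewrite mem_filter => /andP[->].
  rewrite [RHS](eq_big_seq (fun y => if y \in nbrs x then F x y else 0)); last first.
    by move=> y ->.
  apply: sum_supp; rewrite ?nbrs_uniq ?filter_uniq ?fset_uniq// => y.
  case: ifPn => [yx|]; last by rewrite eqxx.
  by move=> /(fGc _ _ yx)[_ yG]; rewrite mem_filter yx yG.
have nz x : \sum_(y <- nbrs x) F x y != 0 -> exists2 y, y \in nbrs x & F x y != 0.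
  move=> h; have /hasP[y yx Fy] : has (fun y => F x y != 0) (nbrs x).
    apply: contraNT h => /hasPn h; rewrite big_seq big1// => y /h.
    by rewrite negbK => /eqP.
  by exists y.
transitivity (\sum_(x <- sq M) \sum_(y <- nbrs x) F x y).
  apply: sum_supp; rewrite ?sq_uniq ?fset_uniq// => x /nz[y yx Fy].
  by rewrite (fGc _ _ yx Fy).1 (inM _ _ yx Fy).1.
have s1 : \sum_(x <- sq M) F x (x.1 - 1, x.2) = \sum_(x <- sq M) F x (x.1 + 1, x.2).
  rewrite -(@sum_shift M (fun x => F x (x.1 - 1, x.2)) (1, 0))/=; last first.
    move=> x /inM; rewrite !inE eqxx orbT/= => /(_ isT)[-> +].
    by rewrite subr0.
  apply: eq_bigr => x _; rewrite addrK addr0 /F -surjective_pairing.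
  by rewrite -sqrrN opprB.
have s2 : \sum_(x <- sq M) F x (x.1, x.2 - 1) = \sum_(x <- sq M) F x (x.1, x.2 + 1).
  rewrite -(@sum_shift M (fun x => F x (x.1, x.2 - 1)) (0, 1))/=; last first.
    move=> x /inM; rewrite !inE eqxx !orbT/= => /(_ isT)[-> +].
    by rewrite subr0.
  apply: eq_bigr => x _; rewrite addrK addr0 /F -surjective_pairing.
  by rewrite -sqrrN opprB.
under eq_bigr do rewrite /nbrs !big_cons big_nil addr0.
rewrite !big_split/= s1 s2.
ring.
Qed.

Lemma sum_sq (F : Z2 -> R) M :
  \sum_(x <- sq M) F x = \sum_(a <- crange M) \sum_(b <- crange M) F (a, b).
Proof. by rewrite /sq big_allpairs. Qed.

Lemma point_le_energy n (f : Z2 -> R) (x0 : Z2) :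
  (forall x, x \notin box n -> f x = 0) ->
  f x0 ^+ 2 <= (ln (n.+2)%:R + 28) * ((2 * pi)^-1 * \sum_(x <- sq n.+2) edge_energy f x).
Proof.
move=> f0; have [M ME] : {M | M = n.+2} by exists n.+2.
rewrite -ME.
have pi0 := pi_gt0 R; have pi2 := pi_ge2 R.
have l0 : 0 <= ln M%:R :> R by rewrite ln_ge0// ler1n ME.
have e0 x : 0 <= edge_energy f x by rewrite /edge_energy addr_ge0// sqr_ge0.
have [x0G|/f0 ->] := boolP (x0 \in box n); last first.
  rewrite expr0n mulr_ge0//; first by clear -l0; lra.
  by rewrite mulr_ge0 ?sumr_ge0// invr_ge0; lra.
have x0E := x0G; rewrite mem_box in x0E.
(* Recentring at [x0] puts the source of the flow at the origin. Since [x0] lies in the box, the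
   translated support and its neighbours stay in the window of size [n + 2]. *)
pose g (y : Z2) := f (x0.1 + y.1, x0.2 + y.2).
have gs y : g y != 0 -> (`|y.1| <= n)%N /\ (`|y.2| <= n)%N.
  move=> gy; have : (x0.1 + y.1, x0.2 + y.2) \in box n.
    by apply: contraNT gy => /f0; rewrite /g => ->.
  by rewrite mem_box/= => ?; lia.
pose H (y : Z2) : R := flux R y.1 y.2.
pose H' (y : Z2) : R := flux R y.2 y.1.
have divE : \sum_(y <- sq M) g y * (H y - H (y.1 - 1, y.2) + (H' y - H' (y.1, y.2 - 1))) = 2 * pi * f x0.
  rewrite (bigD1_seq (0, 0))/= ?sq_uniq ?mem_sq//; last by move=> /=; lia.
  rewrite big1 ?addr0 => [|y y0]; last first.
    rewrite /H /H'/= flux_div; case: y y0 => a b; rewrite xpair_eqE => /negbTE/= ->.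
    by rewrite mulr0.
  by rewrite /H /H'/= flux_div eqxx/= /g/= !addr0 -surjective_pairing mulrC.
have gS1 : \sum_(y <- sq M) g y * H (y.1 - 1, y.2) = \sum_(y <- sq M) g (y.1 + 1, y.2) * H y.
  rewrite -(@sum_shift M (fun y => g y * H (y.1 - 1, y.2)) (1, 0))/=; last first.
    move=> y; rewrite mulf_eq0 negb_or => /andP[/gs ? _]; rewrite !mem_sq/=; lia.
  by apply: eq_bigr => y _; rewrite addrK addr0 -surjective_pairing.
have gS2 : \sum_(y <- sq M) g y * H' (y.1, y.2 - 1) = \sum_(y <- sq M) g (y.1, y.2 + 1) * H' y.
  rewrite -(@sum_shift M (fun y => g y * H' (y.1, y.2 - 1)) (0, 1))/=; last first.
    move=> y; rewrite mulf_eq0 negb_or => /andP[/gs ? _]; rewrite !mem_sq/=; lia.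
  by apply: eq_bigr => y _; rewrite addrK addr0 -surjective_pairing.
have flowE : 2 * pi * f x0 =
   \sum_(y <- sq M) H y * (g y - g (y.1 + 1, y.2)) + \sum_(y <- sq M) H' y * (g y - g (y.1, y.2 + 1)).
  rewrite -divE -big_split/=.
  transitivity (\sum_(y <- sq M) (g y * H y + g y * H' y) - \sum_(y <- sq M) g y * H (y.1 - 1, y.2) - \sum_(y <- sq M) g y * H' (y.1, y.2 - 1)).
    by rewrite -!sumrB; apply: eq_bigr => y _; ring.
  by rewrite gS1 gS2 -!sumrB; apply: eq_bigr => y _; ring.
pose r := [seq (b, y) | b <- [:: true; false], y <- sq M].
have bigr2 (F : bool * Z2 -> R) : \sum_(z <- r) F z = \sum_(y <- sq M) F (true, y) + \sum_(y <- sq M) F (false, y).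
  by rewrite /r big_allpairs big_cons big_seq1.
pose A (z : bool * Z2) := if z.1 then H z.2 else H' z.2.
pose Bb (z : bool * Z2) := if z.1 then g z.2 - g (z.2.1 + 1, z.2.2) else g z.2 - g (z.2.1, z.2.2 + 1).
have CS := cauchy_schwarz_sum r A Bb.
rewrite !bigr2 /A /Bb/= -flowE in CS.
have EA : \sum_(y <- sq M) H y ^+ 2 + \sum_(y <- sq M) H' y ^+ 2 <= 2 * (24 + pi * (4 + ln M%:R)).
  have M0 : (0 < M)%N by rewrite ME.
  rewrite (_ : 2 = 1 + 1)// mulrDl mul1r lerD//; rewrite sum_sq /H /H'/=; first exact: flux_energy.
  by rewrite exchange_big/=; exact: flux_energy.
have EB : \sum_(y <- sq M) (g y - g (y.1 + 1, y.2)) ^+ 2 + \sum_(y <- sq M) (g y - g (y.1, y.2 + 1)) ^+ 2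
   = \sum_(x <- sq M) edge_energy f x.
  rewrite -big_split/=.
  pose T (y : Z2) : Z2 := (x0.1 + y.1, x0.2 + y.2).
  transitivity (\sum_(x <- [seq T y | y <- sq M]) edge_energy f x).
    by rewrite big_map; apply: eq_bigr => y _; rewrite /edge_energy /g /T/= !addrA.
  apply: sum_supp; rewrite ?sq_uniq//.
    by rewrite map_inj_uniq ?sq_uniq// => -[a b] [c d] []/= *; congr pair; lia.
  move=> x ex; have : x \in sq M /\ (x.1 - x0.1, x.2 - x0.2) \in sq M.
    have [/= xG|xG] := boolP (x \in box n); first by rewrite mem_box in xG; rewrite !mem_sq/=; lia.
    have [/= xG'|xG'] := boolP ((x.1 + 1, x.2) \in box n); first by rewrite mem_box/= in xG'; rewrite !mem_sq/=; lia.
    have [/= xG2|xG2] := boolP ((x.1, x.2 + 1) \in box n); first by rewrite mem_box/= in xG2; rewrite !mem_sq/=; lia.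
    by move: ex; rewrite /edge_energy !f0// subrr expr0n addr0 eqxx.
  move=> [-> xs]; rewrite andbT; apply/mapP; exists (x.1 - x0.1, x.2 - x0.2) => //.
  by rewrite /T/=; case: x {ex xs} => a b/=; congr pair; lia.
rewrite EB in CS.
set E := \sum_(x <- sq M) edge_energy f x in CS *.
have E0 : 0 <= E by apply: sumr_ge0 => x _.
have {}CS := le_trans CS (ler_wpM2r E0 EA).
have -> : f x0 ^+ 2 = (2 * pi * f x0) ^+ 2 / (2 * pi) ^+ 2.
  by field; apply/eqP => h; move: pi0; rewrite ?h; lra.
have t0 : 0 < (2 * pi) ^+ 2 :> R by rewrite exprn_gt0// mulr_gt0.
rewrite ler_pdivrMr//; apply: (le_trans CS).
have -> : (ln M%:R + 28) * ((2 * pi)^-1 * E) * (2 * pi) ^+ 2 = (2 * pi * (ln M%:R + 28)) * E.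
  by field; apply/eqP => h; move: pi0; rewrite ?h; lra.
(* [28] is [4 + 24], with the constant [24] of [flux_energy] bounded by [24 * pi]. *)
by apply: ler_wpM2r => //; lra.
Qed.

End lattice.

(** * Gaussian calculus *)

Section gauss.
Context (R : realType) (G : {fset Z2}) (N : nat).
Notation V := (#|Defs.coord G N|.-tuple (measurableTypeR R)).
Notation leb := (lebesgue_tuple R #|Defs.coord G N|).

(** The inverse covariance of one component: dividing by [2] undoes the double count of ordered
    pairs, so that the density is the exponential of minus half the sum of these forms over the
    components. *)
Definition Dform (f g : Z2 -> R) : R :=
  (2 * pi)^-1 / 2 * edge_pairs G (fun x y => (f x - f y) * (g x - g y)).

Lemma DformC f g : Dform f g = Dform g f.
Proof.
congr (_ * _); apply: eq_bigr => x _; apply: eq_bigr => y _; exact: mulrC.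
Qed.

Lemma DformDl f f' g : Dform (fun x => f x + f' x) g = Dform f g + Dform f' g.
Proof.
rewrite /Dform /edge_pairs -mulrDr -big_split/=; congr (_ * _).
apply: eq_bigr => x _; rewrite -big_split/=; apply: eq_bigr => y _; ring.
Qed.

Lemma DformZl a f g : Dform (fun x => a * f x) g = a * Dform f g.
Proof.
rewrite /Dform /edge_pairs mulrCA; congr (_ * _); rewrite mulr_sumr.
by apply: eq_bigr => x _; rewrite mulr_sumr; apply: eq_bigr => y _; ring.
Qed.

Lemma DformDr f g g' : Dform f (fun x => g x + g' x) = Dform f g + Dform f g'.
Proof. by rewrite DformC DformDl !(DformC _ f). Qed.

Lemma DformZr a f g : Dform f (fun x => a * g x) = a * Dform f g.
Proof. by rewrite DformC DformZl DformC. Qed.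

Lemma Dform_sum (I : finType) (a : I -> R) (e : I -> Z2 -> R) g :
  Dform (fun x => \sum_i a i * e i x) g = \sum_i a i * Dform (e i) g.
Proof.
rewrite /Dform /edge_pairs.
under [RHS]eq_bigr do rewrite mulrCA.
rewrite -mulr_sumr; congr (_ * _).
under [RHS]eq_bigr do rewrite mulr_sumr.
rewrite exchange_big/=; apply: eq_bigr => x _.
under [RHS]eq_bigr do rewrite mulr_sumr.
rewrite exchange_big/=; apply: eq_bigr => y _.
by rewrite -sumrB mulr_suml; apply: eq_bigr => i _; ring.
Qed.

Lemma Dform_ge0 f : 0 <= Dform f f.
Proof.
rewrite mulr_ge0 ?divr_ge0 ?invr_ge0 ?mulr_ge0 ?pi_ge0//.
by apply: sumr_ge0 => x _; apply: sumr_ge0 => y _; rewrite -expr2 sqr_ge0.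
Qed.

Definition supported (f : Z2 -> R) := forall x, x \notin G -> f x = 0.

Definition fcomp (j : 'I_N) (t : V) (x : Z2) : R := zero_ext (tuple_to_field t) x ord0 j.

Lemma fcomp_supported j t : supported (fcomp j t).
Proof. by move=> x xG; rewrite /fcomp /zero_ext insubN// mxE. Qed.

Lemma fcomp_tnth j t (x : G) : fcomp j t (val x) = tnth t (enum_rank ((x, j) : Defs.coord G N)).
Proof. by rewrite /fcomp /zero_ext valK mxE. Qed.

Lemma measurable_fcomp j x : measurable_fun setT (fun t => fcomp j t x).
Proof.
have [xG|xG] := boolP (x \in G); last first.
  rewrite (_ : (fun _ => _) = cst 0)//; apply/funext => t; exact: fcomp_supported.
pose x' : G := [` xG]%fset.
rewrite (_ : (fun _ => _) = (@tnth _ (measurableTypeR R))^~ (enum_rank ((x', j) : Defs.coord G N))); last first.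
  by apply/funext => t; rewrite -fcomp_tnth.
exact: measurable_tnth.
Qed.

Lemma measurable_edge_pairs (F : V -> Z2 -> Z2 -> R) :
  (forall x y, measurable_fun setT (fun t => F t x y)) ->
  measurable_fun setT (fun t => edge_pairs G (F t)).
Proof.
move=> mF; apply: measurable_sum => x.
under eq_fun do rewrite -big_filter.
by apply: measurable_sum => y; exact: mF.
Qed.

Lemma measurable_Dform_fcomp g j : measurable_fun setT (fun t => Dform g (fcomp j t)).
Proof.
apply: measurable_funM => //.
apply: measurable_edge_pairs => x y; apply: measurable_funM => //.
by apply: measurable_funB; exact: measurable_fcomp.
Qed.

Lemma measurable_set_le (f g : V -> R) : measurable_fun setT f -> measurable_fun setT g ->
  measurable [set t | f t <= g t].
Proof.
move=> mf mg; have := measurable_fun_ler mf mg => /(_ measurableT [set true]).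
by rewrite setTI; apply.
Qed.

Definition energy (t : V) : R := \sum_(j < N) Dform (fcomp j t) (fcomp j t).

Lemma measurable_energy : measurable_fun setT energy.
Proof.
apply: measurable_sum => j; apply: measurable_funM => //.
apply: measurable_edge_pairs => x y.
by apply: measurable_funM; apply: measurable_funB; exact: measurable_fcomp.
Qed.

Lemma gff_weightE (t : V) : gff_weight (tuple_to_field t) = expR (- (energy t / 2)).
Proof.
rewrite /gff_weight /energy /Dform -mulr_sumr; congr (expR (- _)).
rewrite /edge_pairs exchange_big/=.
rewrite [X in _ = _ * X / _](_ : _ = \sum_(x <- (G `|` outer_boundary G)%fset) \sum_(y <- (G `|` outer_boundary G)%fset | y \in nbrs x)
      enorm (zero_ext (tuple_to_field t) x - zero_ext (tuple_to_field t) y) ^+ 2); last first.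
  apply: eq_bigr => x _; rewrite exchange_big/=; apply: eq_bigr => y _.
  rewrite /enorm sqr_sqrtr; last by apply: sumr_ge0 => j _; exact: sqr_ge0.
  by apply: eq_bigr => j _; rewrite !mxE -expr2.
set S := \sum_(x <- _) _.
have p0 : pi != 0 :> R by exact: lt0r_neq0 (pi_gt0 R).
by move: (pi) p0 => p p0; field.
Qed.

Definition shiftf (j0 : 'I_N) (h : Z2 -> R) : V -> V :=
  shear predT (fun _ k => if (enum_val k).2 == j0 then h (val (enum_val k).1) else 0).

Lemma fcomp_shiftf j j0 h t : supported h ->
  fcomp j (shiftf j0 h t) = (fun x => fcomp j t x + if j == j0 then h x else 0).
Proof.
move=> hs; apply/funext => x.
have [xG|xG] := boolP (x \in G); last first.
  by rewrite !fcomp_supported// hs// if_same addr0.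
by rewrite -[x]/(val [` xG]%fset) !fcomp_tnth tnth_mktuple/= enum_rankK.
Qed.

Lemma energy_shiftf j0 h t : supported h ->
  energy (shiftf j0 h t) = energy t + 2 * Dform h (fcomp j0 t) + Dform h h.
Proof.
move=> hs; rewrite /energy (bigD1 j0)//= [in RHS](bigD1 j0)//= !(fcomp_shiftf _ _ _ hs) eqxx.
rewrite (eq_bigr (fun j => Dform (fcomp j t) (fcomp j t))); last first.
  move=> j /negbTE jj0; rewrite fcomp_shiftf// jj0.
  by under eq_fun do rewrite addr0.
rewrite DformDl !DformDr (DformC (fcomp j0 t) h); ring.
Qed.

Lemma measurable_shiftf j0 h : measurable_fun setT (shiftf j0 h).
Proof. by apply: measurable_shear => k _; exact: measurable_cst. Qed.

Lemma ge0_integral_shiftf j0 h (F : V -> \bar R) :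
  measurable_fun setT F -> (forall t, (0 <= F t)%E) ->
  (\int[leb]_t F (shiftf j0 h t) = \int[leb]_t F t)%E.
Proof. by move=> mF F0; apply: ge0_integral_shear => // k _; exact: measurable_cst. Qed.

Variable c : R.
Hypothesis c_gt0 : 0 < c.

Definition dens (t : V) : R := c * expR (- (energy t / 2)).

Definition law (A : set V) : \bar R := (\int[leb]_(t in A) (dens t)%:E)%E.

Hypothesis lawT : (law setT = 1)%E.

Lemma measurable_dens : measurable_fun setT dens.
Proof.
apply: measurable_funM => //; apply: measurableT_comp => //.
apply: measurable_funN; apply: measurable_funM => //; exact: measurable_energy.
Qed.

Lemma dens_ge0 t : 0 <= dens t.
Proof. by rewrite mulr_ge0 ?expR_ge0// ltW. Qed.

Lemma law_indic A : measurable A -> law A = (\int[leb]_t (dens t * \1_A t)%:E)%E.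
Proof.
move=> mA; rewrite /law integral_mkcond; apply: eq_integral => t _.
by rewrite /patch indicE; case: ifP => _; rewrite ?mulr1 ?mulr0.
Qed.

(** Completing the square, as in the Cameron-Martin formula: tilting the density by the exponential
    of a linear functional translates it. *)
Lemma dens_tilt j0 g (l : R) t : supported g ->
  dens t * expR (l * Dform g (fcomp j0 t)) =
  expR (l ^+ 2 * Dform g g / 2) * dens (shiftf j0 (fun x => - l * g x) t).
Proof.
move=> gs; rewrite /dens energy_shiftf; last by move=> x xG; rewrite gs// mulr0.
rewrite !DformZl DformZr [RHS]mulrCA -mulrA -!expRD; congr (_ * expR _).
by field.
Qed.

(* Chernoff: tilting by [l * Dform g] turns the law into its translate by [l g]. *)
Lemma law_tail j0 g (l T : R) : supported g -> 0 <= l ->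
  (law [set t | (T <= Dform g (fcomp j0 t))%R] <= (expR (l ^+ 2 * Dform g g / 2 - l * T))%:E)%E.
Proof.
move=> gs l0.
have mA : measurable [set t | T <= Dform g (fcomp j0 t)].
  by apply: measurable_set_le => //; exact: measurable_Dform_fcomp.
pose h x := - l * g x.
have hs : supported h by move=> x xG; rewrite /h gs// mulr0.
have mF : measurable_fun setT (fun t => (dens (shiftf j0 h t))%:E).
  apply/measurable_EFinP; apply: measurableT_comp; [exact: measurable_dens|exact: measurable_shiftf].
rewrite law_indic//.
apply: (@le_trans _ _ (\int[leb]_t ((expR (l ^+ 2 * Dform g g / 2 - l * T))%:E * (dens (shiftf j0 h t))%:E))%E).
  apply: ge0_le_integral => //=.
  - by move=> t _; rewrite lee_fin mulr_ge0// dens_ge0.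
  - by apply/measurable_EFinP; apply: measurable_funM; [exact: measurable_dens|exact: measurable_indic].
  - by apply: emeasurable_funM.
  move=> t _; rewrite -EFinM lee_fin expRD [leRHS]mulrAC /h -dens_tilt// -[leRHS]mulrA.
  apply: ler_wpM2l; first exact: dens_ge0.
  rewrite -expRD indicE; case: (boolP (t \in _)) => [|_]; last exact: expR_ge0.
  rewrite inE/= => Tt; rewrite -expR0 ler_expR -mulrBr mulr_ge0// subr_ge0//.
rewrite ge0_integralZl//=; last by move=> t _; rewrite lee_fin dens_ge0.
rewrite (ge0_integral_shiftf j0 h (F := fun t => (dens t)%:E)); last 2 first.
- by apply/measurable_EFinP; exact: measurable_dens.
- by move=> t; rewrite lee_fin dens_ge0.
by rewrite -/(law setT) lawT mule1.
Qed.

Variable K : R.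
Hypothesis K_ge : forall f x, supported f -> f x ^+ 2 <= K * Dform f f.

(** The representer is the column of the Green function at [x0], obtained by inverting the Gram
    matrix of the point masses. [K_ge] makes the form definite: a kernel vector has zero energy and
    hence vanishes at every site. *)
Lemma Dform_riesz (x0 : G) : exists2 g, supported g &
  forall f, supported f -> Dform g f = f (val x0).
Proof.
pose n := #|{: G}|.
pose e (i : 'I_n) (y : Z2) : R := (y == val (enum_val i))%:R.
have es i : supported (e i).
  move=> x xG; rewrite /e; case: eqP => // xi.
  by move: xG; rewrite xi (valP (enum_val i)).
have exp f : supported f -> f = (fun x => \sum_(i < n) f (val (enum_val i)) * e i x).
  move=> fs; apply/funext => x; have [xG|xG] := boolP (x \in G); last first.
    by rewrite fs// big1// => i _; rewrite es// mulr0.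
  rewrite (bigD1 (enum_rank [` xG]%fset))//= big1 => [|i ix].
    by rewrite /e enum_rankK/= eqxx mulr1 addr0.
  rewrite /e; case: eqP => [xi|_]; last by rewrite mulr0.
  case/negP: ix; apply/eqP; apply: (can_inj enum_valK); rewrite enum_rankK.
  exact/val_inj.
pose M : 'M[R]_n := \matrix_(i, j) Dform (e i) (e j).
have mulM (v : 'rV[R]_n) j : (v *m M) ord0 j = Dform (fun x => \sum_i v ord0 i * e i x) (e j).
  by rewrite Dform_sum mxE; apply: eq_bigr => i _; rewrite mxE.
have Mu : M \in unitmx.
  rewrite -row_free_unit -kermx_eq0; apply/eqP/row_matrixP => i; rewrite row0.
  set v := row i _.
  have vM : v *m M = 0 by rewrite -row_mul mulmx_ker row0.
  pose f x := \sum_i v ord0 i * e i x.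
  have fs : supported f by move=> x xG; rewrite /f big1// => j _; rewrite es// mulr0.
  have ff : Dform f f = 0.
    rewrite {2}(exp _ fs) DformC Dform_sum big1// => j _.
    by rewrite DformC -mulM vM mxE mulr0.
  apply/rowP => j; rewrite [RHS]mxE.
  have := K_ge (val (enum_val j)) fs; rewrite ff mulr0 => h.
  have : f (val (enum_val j)) = 0.
    by apply/eqP; rewrite -sqrf_eq0 eq_le h sqr_ge0.
  rewrite /f (bigD1 j)//= big1 => [|k kj].
    by rewrite /e eqxx mulr1 addr0.
  rewrite /e; case: eqP => [/val_inj/enum_val_inj jk|_]; last by rewrite mulr0.
  by rewrite jk eqxx in kj.
pose v : 'rV[R]_n := delta_mx ord0 (enum_rank x0) *m invmx M.
pose g x := \sum_i v ord0 i * e i x.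
exists g; first by move=> x xG; rewrite /g big1// => j _; rewrite es// mulr0.
move=> f fs; rewrite [in LHS](exp _ fs) DformC Dform_sum (bigD1 (enum_rank x0))//= big1 => [|i ix].
  by rewrite DformC -mulM mulmxKV// mxE !eqxx enum_rankK mulr1 addr0.
by rewrite DformC -mulM mulmxKV// mxE eqxx/= (negbTE ix) mulr0.
Qed.

Lemma law_point_tail (j0 : 'I_N) (x0 : G) (s : bool) (T : R) : 0 < K -> 0 <= T ->
  (law [set t | (T <= (-1) ^+ s * fcomp j0 t (val x0))%R] <= (expR (- (T ^+ 2 / (2 * K))))%:E)%E.
Proof.
move=> K0 T0; have [g gs gE] := Dform_riesz x0.
have ggE : Dform g g = g (val x0) by exact: gE.
(* The variance at [x0] is [Dform g g], which equals [g] at [x0]. The energy bound applied to [g]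
   itself reads [g x0 ^+ 2 <= K * g x0]. *)
have gK : Dform g g <= K.
  have := K_ge (val x0) gs; rewrite ggE expr2 => h.
  have := Dform_ge0 g; rewrite ggE le_eqVlt => /predU1P[<-|g0]; first exact: ltW.
  by rewrite -(ler_pM2r g0).
pose g' x := (-1) ^+ s * g x.
have g's : supported g' by move=> x xG; rewrite /g' gs// mulr0.
have -> : [set t | T <= (-1) ^+ s * fcomp j0 t (val x0)] = [set t | T <= Dform g' (fcomp j0 t)].
  by apply/funext => t /=; rewrite /g' DformZl gE//; exact: fcomp_supported.
(* [T / K] is the tilt that optimises the Chernoff bound for a Gaussian of variance [K]. *)
apply: le_trans (law_tail j0 T g's (divr_ge0 T0 (ltW K0))) _.
rewrite lee_fin ler_expR /g' DformZl DformZr signrMK.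
have -> : - (T ^+ 2 / (2 * K)) = (T / K) ^+ 2 * K / 2 - T / K * T by field; rewrite gt_eqF.
by rewrite lerD2r ler_pM2r// ler_wpM2l// sqr_ge0.
Qed.

End gauss.

(** * Entropic repulsion *)

Section repulsion.
Context (R : realType) (G : {fset Z2}) (N : nat).
Notation V := (#|Defs.coord G N|.-tuple (measurableTypeR R)).
Notation leb := (lebesgue_tuple R #|Defs.coord G N|).
Variables (c : R) (c_gt0 : 0 < c) (mu : probability V R).
Hypothesis muE : forall A, measurable A -> mu A = law c A.
Variables (K : R) (K_gt0 : 0 < K).
Hypothesis K_ge : forall f x, supported G f -> f x ^+ 2 <= K * Dform G f f.
Variables (D : set Z2) (I : set 'rV[R]_N) (j0 : 'I_N) (M : R).
Hypothesis I_bounded : forall v, I v -> `|v ord0 j0| < M.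
Hypothesis mI : forall x : G, measurable [set t : V | I (tuple_to_field t x)].

Let lawT : (law c [set: V] = 1)%E.
Proof. by rewrite -muE// probability_setT. Qed.

Definition avoiding : set V := [set t | forall x : G, D (val x) -> ~ I (tuple_to_field t x)].

Lemma measurable_forall_sites (A : G -> set V) : (forall x, measurable (A x)) ->
  measurable [set t | forall x : G, D (val x) -> A x t].
Proof.
move=> mA; rewrite (_ : [set t | _] = \bigcap_(x in [set x : G | D (val x)]) A x)//.
by apply: fin_bigcap_measurable => //; exact: finite_finset.
Qed.

Lemma measurable_avoiding : measurable avoiding.
Proof.
apply: (measurable_forall_sites (A := fun x => ~` [set t | I (tuple_to_field t x)])) => x.
exact: measurableC.
Qed.

Lemma measurable_site_le (x : G) (s : bool) (T : R) :
  measurable [set t : V | T <= (-1) ^+ s * fcomp j0 t (val x)].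
Proof.
by apply: measurable_set_le => //; apply: measurable_funM => //; exact: measurable_fcomp.
Qed.

Lemma measurable_site_ge (x : G) (s : bool) (T : R) :
  measurable [set t : V | (-1) ^+ s * fcomp j0 t (val x) < T].
Proof.
rewrite (_ : [set t | _] = ~` [set t : V | T <= (-1) ^+ s * fcomp j0 t (val x)]).
  by apply: measurableC; exact: measurable_site_le.
by apply/seteqP; split => t /=; rewrite ltNge => /negP.
Qed.

Lemma mu_point_tail (x : G) (s : bool) (T : R) : 0 <= T ->
  (mu [set t | (T <= (-1) ^+ s * fcomp j0 t (val x))%R] <= (expR (- (T ^+ 2 / (2 * K))))%:E)%E.
Proof.
by move=> T0; rewrite muE; [exact: law_point_tail|exact: measurable_site_le].
Qed.

Lemma union_bound (T0 : Type) (s : seq T0) (F : T0 -> set V) (e : R) : 0 <= e ->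
  (forall x, measurable (F x)) -> (forall x, (mu (F x) <= e%:E)%E) ->
  (mu (\big[setU/set0]_(x <- s) F x) <= ((size s)%:R * e)%:E)%E.
Proof.
move=> e0 mF Fe; elim: s => [|x s IH]; first by rewrite big_nil measure0 mul0r.
rewrite big_cons; apply: le_trans (measureU2 _ _ _) _ => //.
  by apply: bigsetU_measurable.
by rewrite /= -natr1 mulrDl mul1r addrC EFinD leeD.
Qed.

Definition sites_below (s : bool) (T : R) : set V :=
  [set t | forall x : G, D (val x) -> (-1) ^+ s * fcomp j0 t (val x) < T].

Lemma measurable_sites_below s T : measurable (sites_below s T).
Proof. by apply: measurable_forall_sites => x; exact: measurable_site_ge. Qed.

Lemma mu_sites_tail (s : bool) (T : R) : 0 <= T ->
  (mu (~` sites_below s T) <= (#|{: G}|%:R * expR (- (T ^+ 2 / (2 * K))))%:E)%E.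
Proof.
move=> T0.
apply: (@le_trans _ _ (mu (\big[setU/set0]_(x <- enum {: G}) [set t | (T <= (-1) ^+ s * fcomp j0 t (val x))%R]))).
  apply: le_measure; rewrite ?inE.
  - by apply: measurableC; exact: measurable_sites_below.
  - by apply: bigsetU_measurable => x _; exact: measurable_site_le.
  move=> t /=/existsNP[x /not_implyP[Dx /negP]]; rewrite -leNgt => h.
  by rewrite -bigcup_seq; exists x => //=; rewrite mem_enum.
rewrite (cardE {: G}); apply: union_bound; first exact: expR_ge0.
- by move=> x; exact: measurable_site_le.
- by move=> x; exact: mu_point_tail.
Qed.

(** The sign [s] reverses the order, so that one argument serves both tails. *)
Definition sort_op (s : bool) (x y : R) : R * R :=
  if s then (Num.max x y, Num.min x y) else (Num.min x y, Num.max x y).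

Lemma sort_opP (s : bool) (x y : R) :
  (sort_op s x y = (x, y) /\ (-1) ^+ s * x <= (-1) ^+ s * y) \/
  (sort_op s x y = (y, x) /\ (-1) ^+ s * y <= (-1) ^+ s * x).
Proof.
case: s => /=; rewrite ?expr1 ?expr0 ?mulN1r ?mul1r ?lerN2.
  by case: (leP x y) => h; [right|left; rewrite ltW].
by case: (leP x y) => h; [left|right; rewrite ltW].
Qed.

Lemma sort_op0 s : sort_op s 0 0 = (0, 0).
Proof. by case: s; rewrite /sort_op /Num.max /Num.min !ltxx. Qed.

Definition field_op (s : bool) (k : 'I_#|Defs.coord G N|) : R -> R -> R * R :=
  if (enum_val k).2 == j0 then sort_op s else pair.

Lemma sorting_field_op s k : sorting (field_op s k).
Proof.
rewrite /field_op; case: ifP => _; last by constructor 1.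
by case: s; [constructor 3|constructor 2].
Qed.

Definition lower s (t u : V) : V := [tuple (field_op s k (tnth t k) (tnth u k)).1 | k < #|Defs.coord G N|].
Definition upper s (t u : V) : V := [tuple (field_op s k (tnth t k) (tnth u k)).2 | k < #|Defs.coord G N|].

Lemma fcomp_lower s t u j x :
  fcomp j (lower s t u) x = if j == j0 then (sort_op s (fcomp j0 t x) (fcomp j0 u x)).1 else fcomp j t x.
Proof.
have [xG|xG] := boolP (x \in G); last first.
  by rewrite !fcomp_supported//; case: eqP => // _; rewrite sort_op0.
rewrite -[x]/(val [` xG]%fset) !fcomp_tnth tnth_mktuple /field_op enum_rankK/=.
by case: eqP => // ->.
Qed.

Lemma fcomp_upper s t u j x :
  fcomp j (upper s t u) x = if j == j0 then (sort_op s (fcomp j0 t x) (fcomp j0 u x)).2 else fcomp j u x.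
Proof.
have [xG|xG] := boolP (x \in G); last first.
  by rewrite !fcomp_supported//; case: eqP => // _; rewrite sort_op0.
rewrite -[x]/(val [` xG]%fset) !fcomp_tnth tnth_mktuple /field_op enum_rankK/=.
by case: eqP => // ->.
Qed.

Definition plateau (S : R) (x : Z2) : R := if x \in G then S else 0.

Lemma plateau_supported S : supported G (plateau S).
Proof. by move=> x /negbTE xG; rewrite /plateau xG. Qed.

(** The energy of one edge for two fields, the second taken relative to a raise [- h]. With equal
    raises at both ends this is the rearrangement inequality. On an edge leaving [G] both fields
    vanish outside and only the inner end is raised: exchanging wrongly ordered [a] and [b] changes
    the sum by [- 2 * S * |a - b|], which is where [S >= 0] enters. *)
Lemma sort_edge (s : bool) (S a a' b b' h h' : R) : 0 <= S ->
  h = h' \/ (h = - (-1) ^+ s * S /\ [/\ h' = 0, a' = 0 & b' = 0]) ->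
  ((sort_op s a b).1 - (sort_op s a' b').1) ^+ 2 +
  ((sort_op s a b).2 + h - ((sort_op s a' b').2 + h')) ^+ 2 <=
  (a - a') ^+ 2 + (b + h - (b' + h')) ^+ 2.
Proof.
move=> S0; case=> [->|[-> [-> -> ->]]]; last first.
  rewrite sort_op0/=; case: (sort_opP s a b) => -[-> h12]//=.
  case: s h12 => /=; rewrite ?expr1 ?expr0 ?mulN1r ?mul1r => h12; nra.
case: (sort_opP s a b) => -[-> h1]; case: (sort_opP s a' b') => -[-> h2]//=.
- by case: s h1 h2 => /=; rewrite ?expr1 ?expr0 ?mulN1r ?mul1r ?lerN2 => h1 h2; nra.
- by case: s h1 h2 => /=; rewrite ?expr1 ?expr0 ?mulN1r ?mul1r ?lerN2 => h1 h2; nra.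
- nra.
Qed.

Lemma energy_sort (s : bool) (S : R) (t u : V) : 0 <= S ->
  energy (lower s t u) + energy (shiftf j0 (plateau (- (-1) ^+ s * S)) (upper s t u)) <=
  energy t + energy (shiftf j0 (plateau (- (-1) ^+ s * S)) u).
Proof.
move=> S0; set h := plateau _; have hs : supported G h := @plateau_supported _.
rewrite /energy -!big_split/=; apply: ler_sum => j _.
rewrite !(fcomp_shiftf _ _ _ hs).
rewrite (_ : fcomp j (lower s t u) = fun x => if j == j0 then (sort_op s (fcomp j0 t x) (fcomp j0 u x)).1 else fcomp j t x); last first.
  by apply/funext => x; rewrite fcomp_lower.
rewrite (_ : fcomp j (upper s t u) = fun x => if j == j0 then (sort_op s (fcomp j0 t x) (fcomp j0 u x)).2 else fcomp j u x); last first.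
  by apply/funext => x; rewrite fcomp_upper.
have [->|//] := eqVneq j j0.
rewrite /Dform -!mulrDr ler_wpM2l//.
  by rewrite divr_ge0 ?invr_ge0 ?mulr_ge0 ?pi_ge0.
rewrite /edge_pairs -!big_split/=; apply: ler_sum => x _.
rewrite -!big_split/=; apply: ler_sum => y _; rewrite -!expr2.
rewrite /h /plateau.
case: (boolP (x \in G)) => xG; case: (boolP (y \in G)) => yG.
- by apply: (@sort_edge s S) => //; left.
- by apply: (@sort_edge s S) => //; right; rewrite !fcomp_supported.
- have e (p q : R) : (p - q) ^+ 2 = (q - p) ^+ 2 by rewrite -sqrrN opprB.
  rewrite !(e _ (_ (fcomp j0 t y) (fcomp j0 u y)).1) !(e _ ((_ (fcomp j0 t y) (fcomp j0 u y)).2 + _)) (e (fcomp j0 t x)) (e (fcomp j0 u x + _)).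
  by apply: (@sort_edge s S) => //; right; rewrite !fcomp_supported.
- by apply: (@sort_edge s S) => //; left.
Qed.

Lemma dens_sort (s : bool) (S : R) (t u : V) : 0 <= S ->
  dens c t * dens c (shiftf j0 (plateau (- (-1) ^+ s * S)) u) <=
  dens c (lower s t u) * dens c (shiftf j0 (plateau (- (-1) ^+ s * S)) (upper s t u)).
Proof.
move=> S0; rewrite /dens [leLHS]mulrACA [leRHS]mulrACA -!expRD.
apply: ler_wpM2l; first by rewrite mulr_ge0// ltW.
rewrite ler_expR -!opprD lerN2 -!mulrDl ler_pM2r//.
exact: energy_sort.
Qed.

Lemma tuple_to_field_fcomp (t : V) (x : G) j : tuple_to_field t x ord0 j = fcomp j t (val x).
Proof. by rewrite /fcomp /zero_ext valK. Qed.

(* Holley-type domination by the field raised by [S]: the constant is superharmonic in [G] for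
   the zero boundary condition, so raising the field is compatible with the four functions theorem. *)
Lemma repulsion_domination (s : bool) (S T : R) (x0 : G) : 0 <= S ->
  (mu (avoiding `&` [set t | (T <= (-1) ^+ s * fcomp j0 t (val x0))%R]) *
   mu [set t | forall x : G, D (val x) -> (M <= (-1) ^+ s * fcomp j0 t (val x) + S)%R] <=
   mu avoiding * mu [set t | (T - S <= (-1) ^+ s * fcomp j0 t (val x0))%R])%E.
Proof.
move=> S0.
set U := [set t | _]; set W := [set t | forall x : G, _]; set U' := [set t | _].
pose h := plateau (- (-1) ^+ s * S).
have hs : supported G h := @plateau_supported _.
have mU : measurable U by exact: measurable_site_le.
have mU' : measurable U' by exact: measurable_site_le.
have mA := measurable_avoiding.
have mW : measurable W.
  apply: (measurable_forall_sites (A := fun x => [set t | M <= (-1) ^+ s * fcomp j0 t (val x) + S])) => x.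
  apply: measurable_set_le => //; apply: measurable_funD => //.
  by apply: measurable_funM => //; exact: measurable_fcomp.
have mAU : measurable (avoiding `&` U) by exact: measurableI.
have md A (B : V -> V) : measurable A -> measurable_fun setT B ->
    measurable_fun setT (fun t => (dens c (B t) * \1_A (B t))%:E).
  move=> mA' mB; apply/measurable_EFinP; apply: (measurableT_comp (f := fun t => dens c t * \1_A t)) => //.
  by apply: measurable_funM; [exact: measurable_dens|exact: measurable_indic].
have d0 A t : (0 <= (dens c t * \1_A t)%:E)%E.
  by rewrite lee_fin mulr_ge0// dens_ge0.
have lawE A : measurable A -> mu A = (\int[leb]_t (dens c t * \1_A t)%:E)%E.
  by move=> mA'; rewrite muE// law_indic.
(* Translation invariance of Lebesgue measure writes the second and the fourth probability with the
   density of the raised field, the form in which [dens_sort] applies. *)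
have lawSE A : measurable A ->
    mu A = (\int[leb]_t (dens c (shiftf j0 h t) * \1_A (shiftf j0 h t))%:E)%E.
  move=> mA'; rewrite lawE//; apply/esym.
  apply: (ge0_integral_shiftf j0 h (F := fun t => (dens c t * \1_A t)%:E)) => //.
  exact: (md A id).
have mh := @measurable_shiftf R G N j0 h.
rewrite (lawE (avoiding `&` U))// (lawE avoiding)// (lawSE W)// (lawSE U')//.
apply: (@four_functions R _ (field_op s)
    (fun t => (dens c t * \1_(avoiding `&` U) t)%:E)
    (fun t => (dens c (shiftf j0 h t) * \1_W (shiftf j0 h t))%:E)
    (fun t => (dens c t * \1_avoiding t)%:E)
    (fun t => (dens c (shiftf j0 h t) * \1_U' (shiftf j0 h t))%:E)
    (sorting_field_op s) (md _ id mAU (@measurable_id _ _ _)) (md _ _ mW mh)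
    (md _ id mA (@measurable_id _ _ _)) (md _ _ mU' mh)).
- exact: d0.
- by move=> t; exact: d0.
- exact: d0.
- by move=> t; exact: d0.
move=> t u; rewrite -!EFinM lee_fin -/(lower s t u) -/(upper s t u).
have sh (v : V) (x : G) : (-1) ^+ s * fcomp j0 (shiftf j0 h v) (val x) = (-1) ^+ s * fcomp j0 v (val x) - S.
  by rewrite fcomp_shiftf// eqxx /h /plateau (valP x) mulrDr mulNr mulrN signrMK.
rewrite [leLHS]mulrACA [leRHS]mulrACA; apply: ler_pM.
- by rewrite mulr_ge0// dens_ge0.
- by rewrite mulr_ge0.
- exact: dens_sort.
rewrite !indicE.
have [/[!inE]-[At Ut]|_] := boolP (t \in _); last by rewrite mul0r mulr_ge0.
have [/[!inE] Wu|_] := boolP (_ \in W); last by rewrite mulr0 mulr_ge0.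
have {}Wu (x : G) : D (val x) -> M <= (-1) ^+ s * fcomp j0 u (val x).
  by move=> /Wu; rewrite sh subrK.
have so x : (-1) ^+ s * fcomp j0 t x <= (-1) ^+ s * fcomp j0 (upper s t u) x.
  by rewrite fcomp_upper eqxx; case: (sort_opP s (fcomp j0 t x) (fcomp j0 u x)) => -[->].
have U'u : U' (shiftf j0 h (upper s t u)).
  by rewrite /U'/= sh lerD2r; exact: le_trans Ut (so _).
suff Al : avoiding (lower s t u) by rewrite !mem_set ?mulr1.
(* At each site [lower] either agrees with [t] in all components, and [t] avoids [I], or takes
   component [j0] from [u], where its signed value is at least [M] and hence outside [I]. *)
move=> x Dx Il; have Bl := I_bounded Il.
have := Bl; rewrite tuple_to_field_fcomp fcomp_lower eqxx.
case: (sort_opP s (fcomp j0 t (val x)) (fcomp j0 u (val x))) => -[e le]; rewrite e/=; last first.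
  rewrite -(normrMsign s) => h'; have := Wu _ Dx => h''.
  by have := lt_le_trans h' h''; rewrite ltNge ler_norm.
move=> _; apply: (At x Dx).
rewrite (_ : tuple_to_field t x = tuple_to_field (lower s t u) x)//.
apply/rowP => j; rewrite !tuple_to_field_fcomp fcomp_lower.
by case: eqP => // ->; rewrite e.
Qed.

Lemma repulsion_upper (s : bool) (S T : R) (x0 : G) : M <= S -> 0 <= S -> S <= T ->
  #|{: G}|%:R * expR (- ((S - M) ^+ 2 / (2 * K))) <= 2^-1 ->
  (mu (avoiding `&` [set t | (T <= (-1) ^+ s * fcomp j0 t (val x0))%R]) <=
   (2 * expR (- ((T - S) ^+ 2 / (2 * K))))%:E * mu avoiding)%E.
Proof.
move=> MS S0 ST small.
have := repulsion_domination s T x0 S0.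
set A := mu (_ `&` _); set W := [set t | forall x : G, _]; set Q := mu [set t | (T - S <= _)%R] => H.
have Qle : (Q <= (expR (- ((T - S) ^+ 2 / (2 * K))))%:E)%E.
  by apply: mu_point_tail; rewrite subr_ge0.
have Wge : (2^-1%:E <= mu W)%E.
  have WE : sites_below (~~ s) (S - M) `<=` W.
    move=> t /= ht x /ht; case: (s) => /=; rewrite ?expr0 ?expr1; lra.
  have mW : measurable W.
    apply: (measurable_forall_sites (A := fun x => [set t | M <= (-1) ^+ s * fcomp j0 t (val x) + S])) => x.
    apply: measurable_set_le => //; apply: measurable_funD => //.
    by apply: measurable_funM => //; exact: measurable_fcomp.
  have mB := measurable_sites_below (~~ s) (S - M).
  suff Bge : (2^-1%:E <= mu (sites_below (~~ s) (S - M)))%E.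
    exact: le_trans Bge (le_measure mu (mem_set mB) (mem_set mW) WE).
  have := probability_setC mu (measurableC mB); rewrite setCK => ->.
  have := mu_sites_tail (~~ s) (T := S - M); rewrite subr_ge0 => /(_ MS) h.
  have := le_trans h (_ : _ <= 2^-1%:E)%E; rewrite lee_fin => /(_ small).
  have : (0 <= mu (~` sites_below (~~ s) (S - M)))%E by [].
  case: (mu _) => [r| |]//=; rewrite -EFinB !lee_fin; lra.
have A0 : (0 <= A)%E by exact: measure_ge0.
have A2 : (A * 2^-1%:E <= mu avoiding * (expR (- ((T - S) ^+ 2 / (2 * K))))%:E)%E.
  apply: (@le_trans _ _ (A * mu W)%E); first by apply: lee_wpmul2l.
  by apply: (le_trans H); apply: lee_wpmul2l.
have -> : A = (2%:E * (A * 2^-1%:E))%E.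
  by rewrite muleC -muleA -EFinM mulVf ?mule1.
rewrite EFinM -muleA; apply: lee_wpmul2l => //.
by rewrite [leRHS]muleC.
Qed.

(** Change of measure by the translation [h]. The density ratio contains the cross term [Dform h], a
    centred Gaussian of variance [Dform h h], which is cut off at [m]. This cut-off and the dips to
    [- S] or lower lose at most [1 / 4] and [1 / 2] of the probability, which leaves the [1 / 4] of
    the conclusion. *)
Lemma repulsion_lower (h : Z2 -> R) (B m S : R) : supported G h -> 0 < B -> 0 <= m ->
  Dform G h h <= B -> 8 * B <= m ^+ 2 -> 0 <= S ->
  (forall x : G, D (val x) -> M + S <= h (val x)) ->
  #|{: G}|%:R * expR (- (S ^+ 2 / (2 * K))) <= 2^-1 ->
  ((expR (- (m + B / 2)) / 4)%:E <= mu avoiding)%E.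
Proof.
move=> hs B0 m0 DB Bm S0 hM small.
pose A := sites_below true S `&` ~` [set t | m <= Dform G h (fcomp j0 t)].
have mL : measurable [set t : V | m <= Dform G h (fcomp j0 t)].
  apply: (measurable_set_le (f := cst m)) => //.
  exact: measurable_Dform_fcomp.
have mA : measurable A by apply: measurableI; [exact: measurable_sites_below|exact: measurableC].
have Age : (4^-1%:E <= mu A)%E.
  have mS := measurable_sites_below true S.
  have h1 : (mu (~` A) <= mu (~` sites_below true S `|` [set t : V | (m <= Dform G h (fcomp j0 t))%R]))%E.
    apply: le_measure; rewrite ?inE; first exact: measurableC.
      by apply: measurableU => //; exact: measurableC.
    by rewrite /A setCI setCK.
  have h2 := le_trans h1 (measureU2 _ (measurableC mS) mL).
  have h3 : (mu [set t | (m <= Dform G h (fcomp j0 t))%R] <= 4^-1%:E)%E.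
    (* The tilt [m / B] yields at most [exp (- m ^+ 2 / (2 * B))], hence at most [exp (- 4)] by
       [8 * B <= m ^+ 2]. *)
    rewrite muE//; apply: le_trans (law_tail c_gt0 lawT j0 m hs (divr_ge0 m0 (ltW B0))) _.
    rewrite lee_fin.
    have e4 : expR (- 4) <= 4^-1 :> R.
      rewrite expRN lef_pV2 ?posrE ?expR_gt0//.
      by apply: le_trans (expR_ge1Dx 4); lra.
    apply: le_trans e4; rewrite ler_expR.
    have : (m / B) ^+ 2 * Dform G h h / 2 <= m ^+ 2 / B / 2.
      rewrite ler_pM2r// (_ : m ^+ 2 / B = (m / B) ^+ 2 * B); last by field; rewrite gt_eqF.
      by apply: ler_wpM2l => //; exact: sqr_ge0.
    have -> : m / B * m = m ^+ 2 / B by rewrite mulrAC -expr2.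
    have : 8 <= m ^+ 2 / B by rewrite ler_pdivlMr.
    by set q := m ^+ 2 / B; lra.
  have h4 : (mu (~` A) <= 2^-1%:E + 4^-1%:E)%E.
    apply: (le_trans h2); apply: leeD => //.
    by apply: (le_trans (mu_sites_tail true S0)); rewrite lee_fin.
  have := probability_setC mu (measurableC mA); rewrite setCK => ->.
  have : (0 <= mu (~` A))%E by exact: measure_ge0.
  by case: (mu _) h4 => [r| |]//=; rewrite -EFinB -EFinD !lee_fin; lra.
have mF : measurable_fun setT (fun t => (dens c t * \1_avoiding t)%:E).
  apply/measurable_EFinP; apply: measurable_funM; first exact: measurable_dens.
  by apply: measurable_indic; exact: measurable_avoiding.
have F0 t : (0 <= (dens c t * \1_avoiding t)%:E)%E.
  by rewrite lee_fin mulr_ge0// dens_ge0.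
rewrite (muE measurable_avoiding) law_indic; last exact: measurable_avoiding.
rewrite -(ge0_integral_shiftf j0 h mF F0).
apply: (@le_trans _ _ ((expR (- (m + B / 2)))%:E * mu A)%E).
  by rewrite EFinM; apply: lee_wpmul2l => //; rewrite lee_fin expR_ge0.
rewrite muE// law_indic// -ge0_integralZl//=; last 2 first.
- by apply/measurable_EFinP; apply: measurable_funM; [exact: measurable_dens|exact: measurable_indic].
- by move=> t _; rewrite lee_fin mulr_ge0// dens_ge0.
apply: ge0_le_integral => //=.
- by move=> t _; rewrite -EFinM lee_fin mulr_ge0 ?expR_ge0// mulr_ge0// dens_ge0.
- apply: (emeasurable_funM (measurable_cst _)); apply/measurable_EFinP.
  by apply: measurable_funM; [exact: measurable_dens|exact: measurable_indic].
- exact: (measurableT_comp mF (@measurable_shiftf R G N j0 h)).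
move=> t _; rewrite -EFinM lee_fin indicE.
have [/[!inE]-[At /= /negP]|_] := boolP (t \in A); last first.
  by rewrite !mulr0 -lee_fin.
rewrite -ltNge mulr1 => Lt.
(* On [D] the shift is at least [M + S] and the dips of [t] are smaller than [S], so component [j0]
   ends above [M]. *)
have -> : \1_avoiding (shiftf j0 h t) = 1 :> R.
  rewrite indicE mem_set// => x Dx /I_bounded.
  rewrite tuple_to_field_fcomp fcomp_shiftf// eqxx => /ltr_normlW.
  have := At x Dx; have := hM x Dx; rewrite expr1; lra.
rewrite mulr1 /dens mulrCA ler_pM2l// -expRD ler_expR energy_shiftf//.
by lra.
Qed.

End repulsion.

(** * Rotations *)

Section rotation.
Context (R : realType) (G : {fset Z2}) (N : nat).
Notation V := (#|Defs.coord G N|.-tuple (measurableTypeR R)).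
Notation leb := (lebesgue_tuple R #|Defs.coord G N|).

Definition shear_comp (j j' : 'I_N) (a : R) : V -> V :=
  shear (fun k => (enum_val k).2 == j)
    (fun t k => a * tnth t (enum_rank (((enum_val k).1, j') : Defs.coord G N))).

Lemma fcomp_shear j j' a t i :
  fcomp i (shear_comp j j' a t) = (fun x => fcomp i t x + if i == j then a * fcomp j' t x else 0).
Proof.
apply/funext => x; have [xG|xG] := boolP (x \in G); last first.
  by rewrite !fcomp_supported// mulr0 if_same addr0.
rewrite -[x]/(val [` xG]%fset) !fcomp_tnth tnth_mktuple/= enum_rankK/=.
by case: ifP; rewrite ?addr0.
Qed.

Lemma measurable_shear_comp j j' a : measurable_fun setT (shear_comp j j' a).
Proof.
apply: measurable_shear => k _; apply: measurable_funM => //; exact: measurable_tnth.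
Qed.

Lemma ge0_integral_shear_comp j j' a (F : V -> \bar R) : j' != j ->
  measurable_fun setT F -> (forall t, (0 <= F t)%E) ->
  (\int[leb]_t F (shear_comp j j' a t) = \int[leb]_t F t)%E.
Proof.
move=> jj mF F0; apply: ge0_integral_shear => //.
  by move=> k _; apply: measurable_funM => //; exact: measurable_tnth.
move=> t t' tt' k _; rewrite tt'//.
by rewrite enum_rankK.
Qed.

(* A rotation as a product of three shears, so that it preserves Lebesgue measure; this form needs
   [1 + a != 0]. *)
Definition plane_rot j j' (a b : R) (t : V) : V :=
  shear_comp j j' (- (b / (1 + a))) (shear_comp j' j b (shear_comp j j' (- (b / (1 + a))) t)).

Variables (j j' : 'I_N) (jj : j' != j) (a b : R) (a1 : 1 + a != 0) (ab : a ^+ 2 + b ^+ 2 = 1).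

Lemma fcomp_rot t i :
  fcomp i (plane_rot j j' a b t) = (fun x => if i == j then a * fcomp j t x - b * fcomp j' t x
    else if i == j' then b * fcomp j t x + a * fcomp j' t x else fcomp i t x).
Proof.
(* The trigonometric identity [1 - sin^2 / (1 + cos) = cos], which makes the three shears compose to
   a rotation. *)
have e1 : 1 - b / (1 + a) * b = a.
  have -> : 1 - b / (1 + a) * b = (1 + a - b ^+ 2) / (1 + a) by field.
  have -> : b ^+ 2 = 1 - a ^+ 2 by rewrite -ab; ring.
  by field.
have jf : (j' == j) = false by exact: negbTE.
have jf' : (j == j') = false by rewrite eq_sym.
rewrite /plane_rot !fcomp_shear; apply/funext => x; rewrite ?eqxx ?jf ?jf' ?addr0.
have [->|ij] := eqVneq i j.
  rewrite jf' addr0.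
  set X := fcomp j t x; set Y := fcomp j' t x; set q := b / (1 + a) in e1 *.
  have q1 : q * (1 + a) = b by rewrite /q mulfVK.
  have -> : X + - q * Y + - q * (Y + b * (X + - q * Y)) = (1 - q * b) * X - q * (1 + (1 - q * b)) * Y by ring.
  by rewrite e1 q1.
have [->|ij'] := eqVneq i j'; last by rewrite !addr0.
rewrite !addr0; set X := fcomp j t x; set Y := fcomp j' t x.
have -> : Y + b * (X + - (b / (1 + a)) * Y) = b * X + (1 - b / (1 + a) * b) * Y by ring.
by rewrite e1.
Qed.

Lemma measurable_rot : measurable_fun setT (plane_rot j j' a b).
Proof.
apply: (measurableT_comp (measurable_shear_comp _ _ _)).
apply: (measurableT_comp (measurable_shear_comp _ _ _)).
exact: measurable_shear_comp.
Qed.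

Lemma ge0_integral_rot (F : V -> \bar R) :
  measurable_fun setT F -> (forall t, (0 <= F t)%E) ->
  (\int[leb]_t F (plane_rot j j' a b t) = \int[leb]_t F t)%E.
Proof.
move=> mF F0; rewrite /plane_rot.
pose q := - (b / (1 + a)).
have m1 := measurable_shear_comp j j' q; have m2 := measurable_shear_comp j' j b.
rewrite (ge0_integral_shear_comp q jj (F := fun t => F (shear_comp j j' q (shear_comp j' j b t)))) //; last first.
  by apply: (measurableT_comp mF); apply: (measurableT_comp m1).
rewrite (ge0_integral_shear_comp b _ (F := fun t => F (shear_comp j j' q t))) //.
- exact: ge0_integral_shear_comp.
- by rewrite eq_sym.
- by apply: (measurableT_comp mF).
Qed.

Lemma energy_rot t : energy (plane_rot j j' a b t) = energy t.
Proof.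
rewrite /energy (bigD1 j)//= (bigD1 j')//= [in RHS](bigD1 j)//= [in RHS](bigD1 j')//= !addrA.
congr (_ + _); last first.
  apply: eq_bigr => i /andP[ij ij']; rewrite fcomp_rot (negbTE ij) (negbTE ij').
  by [].
rewrite !fcomp_rot !eqxx (negbTE jj).
set X := fcomp j t; set Y := fcomp j' t.
have -> : (fun x => a * X x - b * Y x) = (fun x => a * X x + (- b) * Y x).
  by apply/funext => x; rewrite mulNr.
rewrite !DformDl !DformDr !DformZl !DformZr (DformC G Y X).
transitivity ((a ^+ 2 + b ^+ 2) * (Dform G X X + Dform G Y Y)); first by ring.
by rewrite ab mul1r.
Qed.

Lemma law_rot (c : R) (A : set V) : 0 < c -> measurable A ->
  law c (plane_rot j j' a b @^-1` A) = law c A.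
Proof.
move=> c0 mA; have mr := measurable_rot.
have mA' : measurable (plane_rot j j' a b @^-1` A) by rewrite -[X in measurable X]setTI; exact: mr.
rewrite !law_indic// -[RHS](ge0_integral_rot (F := fun t => (dens c t * \1_A t)%:E)).
- by apply: eq_integral => t _; rewrite /dens energy_rot.
- by apply/measurable_EFinP; apply: measurable_funM; [exact: measurable_dens|exact: measurable_indic].
- by move=> t; rewrite lee_fin mulr_ge0// dens_ge0.
Qed.

Lemma field_norm_rot t (x : G) :
  \sum_(i < N) tuple_to_field (plane_rot j j' a b t) x ord0 i ^+ 2 = \sum_(i < N) tuple_to_field t x ord0 i ^+ 2.
Proof.
under eq_bigr do rewrite tuple_to_field_fcomp fcomp_rot.
under [RHS]eq_bigr do rewrite tuple_to_field_fcomp.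
rewrite (bigD1 j)//= (bigD1 j')//= [in RHS](bigD1 j)//= [in RHS](bigD1 j')//= !addrA.
congr (_ + _); last by apply: eq_bigr => i /andP[/negbTE -> /negbTE ->].
rewrite !eqxx (negbTE jj); set X := fcomp j t _; set Y := fcomp j' t _.
transitivity ((a ^+ 2 + b ^+ 2) * (X ^+ 2 + Y ^+ 2)); first by ring.
by rewrite ab mul1r.
Qed.

End rotation.

(** * A finite net of plane rotations *)

Section net.
Context (R : realType).
Implicit Types u w a b : R.

Definition hyp (k : R) : R := Num.sqrt (1 + k ^+ 2).

(** Cosine and sine of the rotations that carry a vector of slope [i / L], or of inverse slope
    [i / L] in the second list, onto the first axis. Slopes in [[-1, 1]] suffice because the larger
    coordinate serves as denominator, and in both lists the cosine exceeds [-1]. *)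
Definition net (L : nat) : seq (R * R) :=
  [seq ((hyp (i%:~R / L%:R))^-1, - (i%:~R / L%:R / hyp (i%:~R / L%:R))) | i <- crange L.+1] ++
  [seq (i%:~R / L%:R / hyp (i%:~R / L%:R), - (hyp (i%:~R / L%:R))^-1) | i <- crange L.+1].

Lemma hyp_sqr (k : R) : hyp k ^+ 2 = 1 + k ^+ 2.
Proof. by rewrite sqr_sqrtr// addr_ge0// sqr_ge0. Qed.

Lemma hyp_gt0 (k : R) : 0 < hyp k.
Proof. by rewrite sqrtr_gt0 ltr_pwDl// sqr_ge0. Qed.

Lemma netP L z : z \in net L -> z.1 ^+ 2 + z.2 ^+ 2 = 1 /\ 1 + z.1 != 0.
Proof.
rewrite mem_cat => /orP[] /mapP[i _ ->]/=; set k := i%:~R / _; have h0 := hyp_gt0 k;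
  have hs := hyp_sqr k; have hn : hyp k ^+ 2 != 0 by rewrite gt_eqF// exprn_gt0.
  split; last by rewrite gt_eqF// addr_gt0// invr_gt0.
  by rewrite sqrrN expr_div_n exprVn -[X in X + _]mul1r -mulrDl -hs mulfV.
split; first by rewrite sqrrN expr_div_n exprVn -[X in _ + X]mul1r -mulrDl addrC -hs mulfV.
rewrite gt_eqF// -(mulfV (lt0r_neq0 h0)) -mulrDl divr_gt0//.
have : hyp k ^+ 2 > k ^+ 2 by rewrite hs ltrDr.
by rewrite !expr2 => hk; nra.
Qed.

(** Rounding the slope [r] down to a multiple [k] of [1 / L] gives [(r - k) ^+ 2 <= L ^- 2], and
    Lagrange's identity [(1 + k * r) ^+ 2 + (r - k) ^+ 2 = (1 + r ^+ 2) * (1 + k ^+ 2)] turns this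
    into a relative loss of length. *)
Lemma net_cover L u w : (0 < L)%N ->
  exists2 z, z \in net L & (1 - (L%:R ^+ 2)^-1) * (u ^+ 2 + w ^+ 2) <= (z.1 * u - z.2 * w) ^+ 2.
Proof.
move=> L0.
have L0' : 0 < L%:R :> R by rewrite ltr0n.
have key p q : `|q| <= `|p| -> exists2 i : int, i \in crange L.+1 &
   (1 - (L%:R ^+ 2)^-1) * (p ^+ 2 + q ^+ 2) <= ((p + i%:~R / L%:R * q) / hyp (i%:~R / L%:R)) ^+ 2.
  move=> qp; pose r := if p == 0 then 0 else q / p.
  have qr : q = r * p.
    rewrite /r; case: eqP => [p0|/eqP p0]; last by rewrite mulfVK.
    by move: qp; rewrite p0 normr0 normr_le0 mul0r => /eqP.
  have r1 : `|r| <= 1.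
    rewrite /r; case: eqP => [_|/eqP p0]; first by rewrite normr0.
    by rewrite normf_div ler_pdivrMr ?normr_gt0// mul1r.
  pose i := Num.floor (L%:R * r).
  have f1 : i%:~R <= L%:R * r by apply: real_floor_le; rewrite num_real.
  have f2 : L%:R * r < i%:~R + 1 by have := @real_floorD1_gt R (L%:R * r) (num_real _); rewrite intrD.
  exists i.
    rewrite mem_crange.
    move: r1; rewrite ler_norml => /andP[r1 r2].
    have : (- (L.+1%:Z))%:~R < i%:~R + 1 :> R.
      rewrite rmorphN/= -[(L.+1%:Z)%:~R]/(L.+1%:R) -natr1; nra.
    have : i%:~R < (L.+1%:Z)%:~R :> R.
      rewrite -[(L.+1%:Z)%:~R]/(L.+1%:R) -natr1; nra.
    by rewrite (_ : i%:~R + 1 = (i + 1)%:~R :> R); [rewrite !ltr_int; lia|rewrite intrD].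
  set k := i%:~R / _.
  have kr : (r - k) ^+ 2 <= (L%:R ^+ 2)^-1.
    have aux (x l z : R) : l != 0 -> z - x / l = (l * z - x) / l by move=> l0; field.
    rewrite /k aux ?gt_eqF//.
    rewrite expr_div_n ler_pdivrMr ?exprn_gt0// mulVf; last by rewrite gt_eqF// exprn_gt0.
    by rewrite expr2; nra.
  rewrite qr expr_div_n hyp_sqr ler_pdivlMr; last by rewrite ltr_pwDl// sqr_ge0.
  set y := (L%:R ^+ 2)^-1 in kr *; rewrite -subr_ge0.
  have -> : (p + k * (r * p)) ^+ 2 - (1 - y) * (p ^+ 2 + (r * p) ^+ 2) * (1 + k ^+ 2) =
     p ^+ 2 * (y * ((1 + r ^+ 2) * (1 + k ^+ 2)) - (r - k) ^+ 2) by ring.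
  apply: mulr_ge0; first exact: sqr_ge0.
  rewrite subr_ge0; apply: (le_trans kr).
  have y0 : 0 <= y by rewrite /y invr_ge0 sqr_ge0.
  rewrite -[leLHS]mulr1; apply: ler_wpM2l => //.
  by have := sqr_ge0 r; have := sqr_ge0 k; nra.
have [wu|uw] := leP `|w| `|u|.
  have [i iL h] := key _ _ wu.
  exists ((hyp (i%:~R / L%:R))^-1, - (i%:~R / L%:R / hyp (i%:~R / L%:R))).
    by rewrite mem_cat; apply/orP; left; apply/mapP; exists i.
  by apply: (le_trans h); rewrite le_eqVlt; apply/orP; left; apply/eqP; congr (_ ^+ 2) => /=; ring.
have [i iL h] := key _ _ (ltW uw).
exists (i%:~R / L%:R / hyp (i%:~R / L%:R), - (hyp (i%:~R / L%:R))^-1).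
  by rewrite mem_cat; apply/orP; right; apply/mapP; exists i.
rewrite [u ^+ 2 + _]addrC.
by apply: (le_trans h); rewrite le_eqVlt; apply/orP; left; apply/eqP; congr (_ ^+ 2) => /=; ring.
Qed.
End net.

Section norm_tail.
Context (R : realType) (G : {fset Z2}) (n : nat).
Notation N := n.+1.
Notation V := (#|Defs.coord G N|.-tuple (measurableTypeR R)).
Variables (c : R) (c_gt0 : 0 < c) (mu : probability V R).
Hypothesis muE : forall A, measurable A -> mu A = law c A.
Variable (Om : set V).
Hypothesis mOm : measurable Om.
Hypothesis Om_rot : forall (j : 'I_N) a b t, j != ord0 -> a ^+ 2 + b ^+ 2 = 1 -> 1 + a != 0 ->
  Om (plane_rot ord0 j a b t) <-> Om t.
Variables (x0 : G) (L : nat) (L0 : (0 < L)%N).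

Definition pnorm (k : nat) (t : V) : R := \sum_(i < N | (i < k)%N) fcomp i t (val x0) ^+ 2.

Let theta : R := 1 - (L%:R ^+ 2)^-1.

Lemma measurable_pnorm k (q : R) : measurable [set t | q <= pnorm k t].
Proof.
apply: (measurable_set_le (f := cst q)) => //.
rewrite /pnorm; under eq_fun do rewrite -big_filter.
apply: measurable_sum => i; apply: measurable_funX; exact: measurable_fcomp.
Qed.

(** For each configuration some rotation of the net moves most of component [k] into component [0].
    All rotated events have the same probability, so the size of the net is the price of a union
    bound. *)
Lemma pnorm_step (k : nat) (q : R) : (0 < k)%N -> (k < N)%N ->
  (mu (Om `&` [set t | (q <= pnorm k.+1 t)%R]) <=
   (size (net R L))%:R%:E * mu (Om `&` [set t | (theta * q <= pnorm k t)%R]))%E.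
Proof.
move=> k0 kN; pose j : 'I_N := Ordinal kN.
have j0 : j != ord0 by rewrite -val_eqE/= -lt0n.
pose B : set V := Om `&` [set t | theta * q <= pnorm k t].
have mB : measurable B by apply: measurableI => //; exact: measurable_pnorm.
have muB : mu B \is a fin_num by apply: fin_num_measure.
pose F (z : R * R) : set V := if z \in net R L then plane_rot ord0 j z.1 z.2 @^-1` B else set0.
have mF z : measurable (F z).
  rewrite /F; case: ifP => // _.
  rewrite -[X in measurable X]setTI; exact: measurable_rot.
have muF z : (mu (F z) <= (fine (mu B))%:E)%E.
  rewrite fineK// /F; case: ifPn => [zn|_]; last by rewrite measure0 measure_ge0.
  have [z1 z2] := netP zn.
  have mF' : measurable (plane_rot ord0 j z.1 z.2 @^-1` B) by have := mF z; rewrite /F zn.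
  by rewrite !muE// law_rot.
have muB0 : 0 <= fine (mu B) by rewrite fine_ge0// measure_ge0.
have H := union_bound (net R L) muB0 mF muF.
rewrite EFinM fineK// in H; apply: le_trans H.
apply: le_measure; rewrite ?inE.
- by apply: measurableI => //; exact: measurable_pnorm.
- by apply: bigsetU_measurable.
move=> t [Ot /= qt].
have [z zn hz] := net_cover (fcomp ord0 t (val x0)) (fcomp j t (val x0)) L0.
have [z1 z2] := netP zn.
rewrite -bigcup_seq; exists z => //=; rewrite /F zn; split; first exact/(Om_rot _ j0).
rewrite /=.
have th : theta <= 1 by rewrite /theta gerBl invr_ge0 sqr_ge0.
have pk : pnorm k.+1 t = fcomp ord0 t (val x0) ^+ 2 + fcomp j t (val x0) ^+ 2 +
    \sum_(i < N | (i < k)%N && (i != ord0)) fcomp i t (val x0) ^+ 2.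
  rewrite /pnorm (bigD1 ord0)//= (bigD1 j)/=; last by rewrite ltnSn.
  rewrite addrA; congr (_ + _); apply: eq_bigl => i.
  by rewrite ltnS leq_eqVlt -(val_eqE i j)/=; case: ltngtP; rewrite ?andbF ?andbT.
have pr : pnorm k (plane_rot ord0 j z.1 z.2 t) = (z.1 * fcomp ord0 t (val x0) - z.2 * fcomp j t (val x0)) ^+ 2 +
    \sum_(i < N | (i < k)%N && (i != ord0)) fcomp i t (val x0) ^+ 2.
  rewrite /pnorm (bigD1 ord0)//= fcomp_rot// eqxx; congr (_ + _).
  apply: eq_bigr => i /andP[ik i0]; rewrite fcomp_rot// (negbTE i0).
  by case: eqP => // ij; move: ik; rewrite ij/= ltnn.
rewrite pr; set s := \sum_(i < N | _) _ in pk *.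
have s0 : 0 <= s by apply: sumr_ge0 => i _; exact: sqr_ge0.
have th0 : 0 <= theta.
  rewrite /theta subr_ge0 invf_le1 ?exprn_gt0 ?ltr0n// exprn_ege1// ler1n//.
apply: (@le_trans _ _ (theta * pnorm k.+1 t)); first exact: ler_wpM2l.
rewrite pk mulrDr lerD// -[leRHS]mul1r; exact: ler_wpM2r.
Qed.

Lemma pnorm_tail (k : nat) (q : R) : (k < N)%N ->
  (mu (Om `&` [set t | (q <= pnorm k.+1 t)%R]) <=
   ((size (net R L))%:R ^+ k)%:E * mu (Om `&` [set t | (theta ^+ k * q <= pnorm 1 t)%R]))%E.
Proof.
elim: k q => [|k IH] q kN; first by rewrite !expr0 mul1e mul1r.
apply: (le_trans (pnorm_step q _ kN)) => //.
have := IH (theta * q) (ltnW kN); rewrite mulrA -exprSr => h.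
rewrite exprS EFinM -muleA; exact: lee_wpmul2l.
Qed.

(* Some rotation of the net carries all but a fraction [1 / L^2] of the squared length of the components
   [0, j] into component [0]; each [j] costs a factor [theta] in height and the size of the net
   in probability. *)
Lemma norm_tail (T e : R) : 0 <= T -> 0 <= e -> 0 < theta ->
  (forall s : bool, (mu (Om `&` [set t | (theta ^+ n * T <= (-1) ^+ s * fcomp ord0 t (val x0))%R]) <= e%:E * mu Om)%E) ->
  (mu (Om `&` [set t | (T <= enorm (tuple_to_field t x0))%R]) <=
   ((size (net R L))%:R ^+ n * (e + e))%:E * mu Om)%E.
Proof.
move=> T0 e0 th0 he.
have th1 : theta <= 1 by rewrite /theta gerBl invr_ge0 sqr_ge0.
have eE t : enorm (tuple_to_field t x0) = Num.sqrt (pnorm n.+1 t).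
  rewrite /enorm /pnorm; congr (Num.sqrt _); under eq_bigr do rewrite tuple_to_field_fcomp.
  by apply: eq_bigl => i; rewrite ltn_ord.
have -> : [set t : V | (T <= enorm (tuple_to_field t x0))%R] = [set t | (T ^+ 2 <= pnorm n.+1 t)%R].
  apply/funext => t /=; rewrite eE -{1}(ger0_norm T0) -sqrtr_sqr ler_sqrt//.
  by apply: sumr_ge0 => i _; exact: sqr_ge0.
apply: (le_trans (pnorm_tail _ (ltnSn n))).
rewrite EFinM -muleA; apply: lee_wpmul2l; first by rewrite lee_fin exprn_ge0.
pose U (s : bool) := Om `&` [set t : V | theta ^+ n * T <= (-1) ^+ s * fcomp ord0 t (val x0)].
have mU s : measurable (U s).
  apply: measurableI => //; apply: (measurable_set_le (f := cst _)) => //.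
  by apply: measurable_funM => //; exact: measurable_fcomp.
rewrite EFinD ge0_muleDl//.
apply: (@le_trans _ _ (mu (U false `|` U true))).
  apply: le_measure; rewrite ?inE.
  - by apply: measurableI => //; exact: measurable_pnorm.
  - exact: measurableU.
  move=> t [Ot /=]; rewrite /pnorm (bigD1 ord0)//= big1 ?addr0 => [|i]; last first.
    by rewrite ltnS leqn0 -(val_eqE i ord0)/= => /andP[/eqP ->].
  set y := fcomp _ _ _ => h.
  have tn0 : 0 <= theta ^+ n by rewrite exprn_ge0// ltW.
  have tn1 : theta ^+ n <= 1 by rewrite exprn_ile1// ltW.
  have z0 : 0 <= theta ^+ n * T by exact: mulr_ge0.
  (* The squared height has lost only [theta ^+ n]; weakening this to its square, since
     [theta <= 1], avoids a square root. *)
  have : (theta ^+ n * T) ^+ 2 <= y ^+ 2.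
    apply: le_trans h; rewrite exprMn; apply: ler_wpM2r; first exact: sqr_ge0.
    by rewrite expr2 ler_piMl.
  rewrite !expr2 => zy; have [y0|y0] := leP 0 y; [left|right]; split => //=.
    by rewrite expr0 mul1r -/y; nra.
  by rewrite expr1 mulN1r -/y; nra.
by apply: (le_trans (measureU2 _ (mU false) (mU true))); apply: leeD; exact: he.
Qed.
End norm_tail.

(** * Cell averages of test functions *)

Section integral_tools.
Context (R : realType).
Notation mR := (measurableTypeR R).
Notation leb := (@lebesgue_measure R).

(** The sigma-algebra is the product one, so an open set is exhausted by the countably many rational
    squares it contains. *)
Lemma measurable_open2 (U : set (R * R)) : open U -> measurable (U : set (mR * mR)).
Proof.
move=> oU.
pose itv (a r : rat) : set mR := `](ratr a - ratr r), (ratr a + ratr r)[%classic.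
pose box (q : rat * rat * rat) : set (mR * mR) := itv q.1.1 q.2 `*` itv q.1.2 q.2.
pose F q := if `[< box q `<=` U >] then box q else set0.
have mbox q : measurable (box q) by apply: measurableX; exact: measurable_itv.
rewrite (_ : (U : set (mR * mR)) = \bigcup_q F q); last first.
  apply/seteqP; split => [z Uz|z [q _]]; last by rewrite /F; case: asboolP => // h /h.
  have : nbhs z U by exact: open_nbhs_nbhs.
  move=> /nbhs_ballP[e /= e0 eU].
  have [q /andP[q0 qe]] : exists q : rat, (0 < ratr q :> R) && (ratr q < e / 2 :> R).
    have [q] := rat_in_itvoo (divr_gt0 e0 (ltr0n _ 2)).
    by rewrite in_itv/=; exists q.
  have ap (x : R) : exists a : rat, ratr a - ratr q < x < ratr a + ratr q.
    have [|a] := @rat_in_itvoo R (x - ratr q) (x + ratr q); first by lra.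
    by rewrite in_itv/= => h; exists a; lra.
  have [a ha] := ap z.1; have [b hb] := ap z.2.
  exists (a, b, q) => //; rewrite /F; case: asboolP => [_|[]]; first by split; rewrite /itv/= in_itv.
  move=> w []; rewrite /itv/= !in_itv/= => h1 h2; apply: eU; split; rewrite /ball/= ltr_norml; lra.
apply: countable_bigcupT_measurable => // q.
by rewrite /F; case: asboolP.
Qed.

Lemma continuous_measurable2 (f : R * R -> R) : continuous f ->
  measurable_fun [set: mR * mR] f.
Proof.
move=> /continuousP cf; apply: (measurability _ (RGenOpens.measurableE R)).
move=> _ [_ [a [b ->] <-]]; rewrite setTI.
by apply: measurable_open2; exact/cf/interval_open.
Qed.

(** Jensen's inequality, by integrating [(f - m) ^+ 2 >= 0] with [m] the mean of [f]. *)
Lemma Rintegral_sqr_le d (T : measurableType d) (mu : {measure set T -> \bar R}) (D : set T) (A : R) (f : T -> R) :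
  measurable D -> mu D = A%:E -> 0 < A ->
  mu.-integrable D (EFin \o f) -> mu.-integrable D (EFin \o (fun x => f x ^+ 2)) ->
  (\int[mu]_(x in D) f x) ^+ 2 <= A * \int[mu]_(x in D) (f x ^+ 2).
Proof.
move=> mD muD A0 if1 if2; set J := \int[mu]_(x in D) f x; set J2 := \int[mu]_(x in D) _.
pose m := J / A.
have ic : mu.-integrable D (EFin \o cst (m ^+ 2)).
  apply: measurable_bounded_integrable => //; first by rewrite muD ltry.
  by exists (`|m ^+ 2|); split; [exact: num_real|move=> M /ltW MM x _].
have i2 : mu.-integrable D (EFin \o (fun x => 2 * m * f x)).
  exact: (integrableZl mD (2 * m) if1).
have : \int[mu]_(x in D) (2 * m * f x) <= \int[mu]_(x in D) (f x ^+ 2 + m ^+ 2).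
  apply: le_Rintegral => //; first exact: (integrableD mD if2 ic).
  by move=> x _; have := sqr_ge0 (f x - m); lra.
rewrite RintegralZl// RintegralD// Rintegral_cst// muD/= -/J -/J2 => h.
have JA : J = m * A by rewrite /m mulfVK// gt_eqF.
by move: h; rewrite JA; nra.
Qed.


Lemma sqr_increment_le (u du : R -> R) (x y : R) : x < y ->
  (forall z : R, is_derive z 1 u (du z)) -> continuous du ->
  (((u y - u x) ^+ 2)%:E <= (y - x)%:E * \int[leb]_(z in `[x, y]) ((du z) ^+ 2)%:E)%E.
Proof.
move=> xy ud cdu.
have cu : continuous u.
  move=> z; apply: differentiable_continuous; apply/derivable1_diffP.
  by have [] := ud z.
have du1 (z : R) : derive1 u z = du z by rewrite derive1E; have [] := ud z.
have ftc : (\int[leb]_(z in `[x, y]) (du z)%:E = (u y)%:E - (u x)%:E)%E.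
  apply: continuous_FTC2 => //.
  - by apply: continuous_subspaceT.
  - split; first by move=> z _; have [] := ud z.
    + exact: cvg_at_right_filter (cu x).
    + exact: cvg_at_left_filter (cu y).
have cpt : compact (`[x, y]%classic : set R) by exact: segment_compact.
have i1 : leb.-integrable `[x, y] (EFin \o du).
  by apply: continuous_compact_integrable => //; exact: continuous_subspaceT.
have i2 : leb.-integrable `[x, y] (EFin \o (fun z => du z ^+ 2)).
  apply: continuous_compact_integrable => //; apply: continuous_subspaceT => z.
  by apply: cvgM; exact: cdu.
have lenE : leb `[x, y]%classic = (y - x)%:E.
  by rewrite lebesgue_measure_itv/= lte_fin xy EFinB.
have yx0 : 0 < y - x by rewrite subr_gt0.
have := @Rintegral_sqr_le _ mR leb `[x, y]%classic (y - x) du (measurable_itv _) lenE yx0 i1 i2.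
rewrite {1}/Rintegral ftc/= => h.
have mI : measurable (`[x, y]%classic : set mR) by exact: measurable_itv.
rewrite -(fineK (integrable_fin_num mI i2)) -EFinM lee_fin.
exact: h.
Qed.

Definition step (n : nat) (s : R) (a : int) : set mR :=
  `](a%:~R / n%:R + s), ((a + 1)%:~R / n%:R + s)]%classic.

Lemma step_disjoint n s (a b : int) x : (0 < n)%N -> step n s a x -> step n s b x -> a = b.
Proof.
move=> n0; rewrite /step/= !in_itv/= => /andP[h1 h2] /andP[h3 h4].
have n0' : 0 < n%:R :> R by rewrite ltr0n.
have lt1 (c d : int) : c%:~R / n%:R + s < (d + 1)%:~R / n%:R + s :> R -> (c < d + 1)%R.
  by rewrite ltrD2r ltr_pM2r ?invr_gt0// ltr_int.
have A := lt1 _ _ (lt_le_trans h1 h4); have B := lt1 _ _ (lt_le_trans h3 h2).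
lia.
Qed.

Lemma sum_integral_step n s (r : seq int) (J : set mR) (g : R -> \bar R) : (0 < n)%N ->
  uniq r -> measurable J -> (forall a, a \in r -> step n s a `<=` J) ->
  measurable_fun [set: mR] g -> (forall x, (0 <= g x)%E) ->
  (\sum_(a <- r) \int[leb]_(x in step n s a) g x <= \int[leb]_(x in J) g x)%E.
Proof.
move=> n0 ur mJ rJ mg g0.
have mgS A : measurable A -> measurable_fun A g by move=> mA; exact: measurable_funTS.
elim: r J ur mJ rJ => [|a r IH] J ur mJ rJ.
  by rewrite big_nil integral_ge0.
move: ur => /= /andP[ar ur].
have mst : measurable (step n s a) by exact: measurable_itv.
rewrite big_cons -[in leRHS](setDUK (rJ a (mem_head _ _))).
rewrite ge0_integral_setU//=; last 3 first.
- exact: measurableD.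
- exact: mgS (measurableU _ _ mst (measurableD mJ mst)).
- by apply/disj_setPS => x [h []].
apply: leeD => //; apply: IH => //; first exact: measurableD.
move=> b br x bx; split; first by apply: (rJ b) => //; rewrite inE br orbT.
by move=> ax; move: ar; rewrite (step_disjoint n0 ax bx) br.
Qed.

Lemma ge0_integral_shift_itv (f : R -> \bar R) (c x y : R) :
  measurable_fun [set: mR] f -> (forall z, (0 <= f z)%E) ->
  (\int[leb]_(z in `]x, y]) f (c + z)%R = \int[leb]_(z in `](c + x)%R, (c + y)%R]) f z)%E.
Proof.
move=> mf f0; rewrite integral_mkcond [RHS]integral_mkcond.
rewrite -[RHS](ge0_integral_shift c (f := f \_ `](c + x), (c + y)])); last 2 first.
- by apply/(measurable_restrictT _ _).1 => //; exact: measurable_funTS.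
- by move=> z; exact: erestrict_ge0.
apply: eq_integral => z _; rewrite !patchE [z + c]addrC.
have -> : (c + z \in `](c + x), (c + y)]%classic) = (z \in `]x, y]%classic).
  by apply/idP/idP; rewrite !inE/= !in_itv/= ltrD2l lerD2l.
by [].
Qed.

End integral_tools.

Section increments.
Context (R : realType).
Notation mR := (measurableTypeR R).
Notation leb := (@lebesgue_measure R).

Lemma integral_rect (F : R * R -> \bar R) (A B : set mR) :
  measurable_fun [set: mR * mR] F -> (forall z, (0 <= F z)%E) ->
  measurable A -> measurable B ->
  (\int[lebesgue2 R]_(z in A `*` B) F z = \int[leb]_(x in A) \int[leb]_(y in B) F (x, y))%E.
Proof.
move=> mF F0 mA mB.
have mAB : measurable (A `*` B : set (mR * mR)) by exact: measurableX.
rewrite integral_mkcond (@fubini_tonelli1 _ _ mR mR R leb leb (F \_ (A `*` B))).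
- rewrite [RHS]integral_mkcond; apply: eq_integral => x _.
  rewrite /fubini_F patchE; case: ifPn => xA.
    rewrite [RHS]integral_mkcond; apply: eq_integral => y _; rewrite !patchE.
    rewrite inE in xA.
    by congr (if _ then _ else _); apply/idP/idP; rewrite !inE; [case|split].
  rewrite (eq_integral (cst 0%E)) ?integral0// => y _; rewrite patchE.
  case: ifPn => //; rewrite inE => -[/= xA' _].
  by move: xA; rewrite notin_setE.
- apply/(measurable_restrictT _ mAB); exact: measurable_funTS.
- by move=> z; exact: erestrict_ge0.
Qed.

Lemma integral_rect_swap (F : R * R -> \bar R) (A B : set mR) :
  measurable_fun [set: mR * mR] F -> (forall z, (0 <= F z)%E) ->
  measurable A -> measurable B ->
  (\int[lebesgue2 R]_(z in A `*` B) F z = \int[leb]_(y in B) \int[leb]_(x in A) F (x, y))%E.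
Proof.
move=> mF F0 mA mB.
have mAB : measurable (A `*` B : set (mR * mR)) by exact: measurableX.
rewrite integral_mkcond (@fubini_tonelli1 _ _ mR mR R leb leb (F \_ (A `*` B))); last 2 first.
- by apply/(measurable_restrictT _ mAB); exact: measurable_funTS.
- by move=> z; exact: erestrict_ge0.
rewrite /fubini_F (@fubini_tonelli _ _ mR mR R leb leb (F \_ (A `*` B))); last 2 first.
- by apply/(measurable_restrictT _ mAB); exact: measurable_funTS.
- by move=> z; exact: erestrict_ge0.
rewrite [RHS]integral_mkcond; apply: eq_integral => y _.
rewrite patchE; case: ifPn => yB.
  rewrite [RHS]integral_mkcond; apply: eq_integral => x _; rewrite !patchE.
  rewrite inE in yB.
  by congr (if _ then _ else _); apply/idP/idP; rewrite !inE; [case|split].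
rewrite (eq_integral (cst 0%E)) ?integral0// => x _; rewrite patchE.
case: ifPn => //; rewrite inE => -[/= _ yB'].
by move: yB; rewrite notin_setE.
Qed.

Lemma measurable_integral_section (F : R * R -> \bar R) (B : set mR) :
  measurable_fun [set: mR * mR] F -> (forall z, (0 <= F z)%E) -> measurable B ->
  measurable_fun [set: mR] (fun x : R => \int[leb]_(y in B) F (x, y))%E.
Proof.
move=> mF F0 mB.
pose H (z : R * R) : \bar R := (F \_ (setT `*` B)) z.
have mH : measurable_fun [set: mR * mR] H.
  apply/(measurable_restrictT _ (measurableX measurableT mB)); exact: measurable_funTS.
have H0 z : (0 <= H z)%E by exact: erestrict_ge0.
have := @measurable_fun_fubini_tonelli_F _ _ mR mR R leb H mH H0.
congr (measurable_fun _ _); apply/funext => y.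
rewrite integral_mkcond; apply: eq_integral => x _; rewrite /H !patchE.
by congr (if _ then _ else _); apply/idP/idP; rewrite !inE => //; case.
Qed.

Definition unit_cell (n : nat) : set mR := `](- (n%:R^-1 / 2)), (n%:R^-1 / 2)]%classic.

Lemma measurable_unit_cell n : measurable (unit_cell n).
Proof. exact: measurable_itv. Qed.

Lemma leb_unit_cell n : (0 < n)%N -> leb (unit_cell n) = (n%:R^-1)%:E.
Proof.
move=> n0; have n0' : 0 < n%:R^-1 :> R by rewrite invr_gt0 ltr0n.
rewrite lebesgue_measure_itv/= lte_fin ifT; last by lra.
by rewrite -EFinB; congr EFin; lra.
Qed.

Lemma step_center n (b : int) :
  step n (- (n%:R^-1 / 2)) b = `](b%:~R / n%:R + - (n%:R^-1 / 2)), (b%:~R / n%:R + n%:R^-1 / 2)]%classic :> set R.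
Proof.
rewrite /step (_ : (b + 1)%:~R / n%:R + - (n%:R^-1 / 2) = b%:~R / n%:R + n%:R^-1 / 2 :> R)//.
by rewrite intrD; lra.
Qed.

Lemma continuous_pairl (y : R) : continuous (fun x : R => (x, y)).
Proof. by move=> x; apply: (@cvg_pair _ _ _ (nbhs x) (nbhs x) (nbhs y)); [exact: cvg_id|exact: cvg_cst]. Qed.

Variables (u du : R -> R -> R).
Hypothesis ud : forall x y : R, is_derive x 1 (u^~ y) (du x y).
Hypothesis cu : continuous (fun z : R * R => u z.1 z.2).
Hypothesis cdu : continuous (fun z : R * R => du z.1 z.2).

(** By Cauchy-Schwarz a squared increment is at most [1 / n] times the integral of [du ^+ 2] over a
    segment of length [1 / n], and for fixed [s] these segments are disjoint. Averaging over the
    offset [s] gives the second factor [1 / n], while [t] and [b] sweep disjoint parts of [K]. The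
    constant is exact, so the discrete energy cannot exceed the continuous one. *)
Lemma increments_le (n : nat) (r1 r2 : seq int) (J K : set mR) : (0 < n)%N ->
  uniq r1 -> uniq r2 -> measurable J -> measurable K ->
  (forall a s, a \in r1 -> unit_cell n s -> step n s a `<=` J) ->
  (forall b, b \in r2 -> step n (- (n%:R^-1 / 2)) b `<=` K) ->
  (\sum_(b <- r2) \int[leb]_(t in unit_cell n) \int[leb]_(s in unit_cell n)
     \sum_(a <- r1) ((u ((a + 1)%:~R / n%:R + s) (b%:~R / n%:R + t) -
                      u (a%:~R / n%:R + s) (b%:~R / n%:R + t)) ^+ 2)%:E <=
   (n%:R ^- 2)%:E * \int[leb]_(y in K) \int[leb]_(x in J) ((du x y) ^+ 2)%:E)%E.
Proof.
move=> n0 u1 u2 mJ mK hJ hK.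
have n0' : 0 < n%:R^-1 :> R by rewrite invr_gt0 ltr0n.
have cdu1 y : continuous (du^~ y).
  move=> x; apply: (@continuous_comp _ _ _ (fun x => (x, y)) (fun z : R * R => du z.1 z.2)); last exact: cdu.
  exact: continuous_pairl.
have mdu1 y : measurable_fun [set: mR] (fun x => ((du x y) ^+ 2)%:E).
  by apply: (measurable_EFinP (T := mR) setT (fun x => du x y ^+ 2)).2;
    apply: (@measurable_funX _ mR R setT (du^~ y) 2); exact: continuous_measurable_fun (cdu1 y).
pose m (y : R) := (\int[leb]_(x in J) ((du x y) ^+ 2)%:E)%E.
have m0 y : (0 <= m y)%E by apply: integral_ge0 => x _; rewrite lee_fin sqr_ge0.
have cdu2 : continuous (fun z : R * R => du z.1 z.2 ^+ 2).
  by move=> z; apply: cvgM; exact: cdu.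
have mm : measurable_fun [set: mR] m.
  apply: (measurable_integral_section (F := fun z => ((du z.2 z.1) ^+ 2)%:E)) => //.
    apply: (measurable_EFinP (T := (mR * mR)%type) setT (fun z => du z.2 z.1 ^+ 2)).2.
    apply: (measurableT_comp (continuous_measurable2 cdu2) (f := fun z => du z.1 z.2 ^+ 2) (g := fun z : mR * mR => (z.2, z.1))).
    exact: measurable_fun_pair.
  by move=> z; rewrite lee_fin sqr_ge0.
have row (y s : R) : unit_cell n s ->
    (\sum_(a <- r1) ((u ((a + 1)%:~R / n%:R + s) y - u (a%:~R / n%:R + s) y) ^+ 2)%:E <= (n%:R^-1)%:E * m y)%E.
  move=> cs.
  have H := @sum_integral_step R n s r1 J (fun x => ((du x y) ^+ 2)%:E) n0 u1 mJ (fun a ar => hJ a s ar cs) (mdu1 y).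
  apply: (@le_trans _ _ (\sum_(a <- r1) (n%:R^-1)%:E * \int[leb]_(x in step n s a) ((du x y) ^+ 2)%:E)%E).
    apply: lee_sum => a _.
    have lt : a%:~R / n%:R + s < (a + 1)%:~R / n%:R + s :> R.
      by rewrite ltrD2r ltr_pM2r// ltr_int ltrDl.
    have := sqr_increment_le lt (ud^~ y) (cdu1 y).
    have -> : (a + 1)%:~R / n%:R + s - (a%:~R / n%:R + s) = n%:R^-1 :> R.
      by rewrite intrD; lra.
    rewrite -integral_itv_obnd_cbnd//. exact: (measurable_funTS (mdu1 y)).
  rewrite -ge0_sume_distrr//; last by move=> a _; apply: integral_ge0 => x _; rewrite lee_fin sqr_ge0.
  apply: lee_wpmul2l; first by rewrite lee_fin ltW.
  by apply: H => x; rewrite lee_fin sqr_ge0.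
have cell (b : int) : (\int[leb]_(t in unit_cell n) \int[leb]_(s in unit_cell n)
     \sum_(a <- r1) ((u ((a + 1)%:~R / n%:R + s) (b%:~R / n%:R + t) -
                      u (a%:~R / n%:R + s) (b%:~R / n%:R + t)) ^+ 2)%:E <=
     (n%:R ^- 2)%:E * \int[leb]_(t in step n (- (n%:R^-1 / 2)) b) m t)%E.
  rewrite step_center -ge0_integral_shift_itv//.
  pose G (z : R * R) : \bar R := (\sum_(a <- r1) ((u ((a + 1)%:~R / n%:R + z.2) (b%:~R / n%:R + z.1) -
                      u (a%:~R / n%:R + z.2) (b%:~R / n%:R + z.1)) ^+ 2)%:E)%E.
  have mG : measurable_fun [set: mR * mR] G.
    have mt c d : measurable_fun [set: mR * mR] (fun z : mR * mR => u (c + z.2) (d + z.1)).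
      apply: (measurableT_comp (continuous_measurable2 cu) (g := fun z : mR * mR => (c + z.2, d + z.1))).
      by apply: measurable_fun_pair; apply: measurable_funD.
    apply: emeasurable_sum => a; apply: (measurable_EFinP (T := (mR * mR)%type) setT _).2.
    by apply: measurable_funX; apply: measurable_funB; exact: mt.
  have G0 z : (0 <= G z)%E by apply: sume_ge0 => a _; rewrite lee_fin sqr_ge0.
  have mmb : measurable_fun [set: mR] (fun t => m (b%:~R / n%:R + t)).
    apply: measurableT_comp => //; exact: measurable_funD.
  have mu0 := measurable_unit_cell n.
  rewrite -ge0_integralZl//; last exact: measurable_funTS.
  apply: ge0_le_integral => //.
  - by move=> t _; apply: integral_ge0 => s _; exact: (G0 (t, s)).
  - by apply: measurable_funTS; exact: (measurable_integral_section mG G0 mu0).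
  - by apply: measurable_funTS; exact: measurable_funeM.
  move=> t ct.
  apply: (@le_trans _ _ (\int[leb]_(s in unit_cell n) ((n%:R^-1)%:E * m (b%:~R / n%:R + t)%R))%E).
    apply: ge0_le_integral => //.
    - by move=> s _; exact: (G0 (t, s)).
    - apply: measurable_funTS; apply: (measurableT_comp mG (g := fun s : mR => (t, s))); exact: measurable_pair1.
    - by move=> s cs; exact: row.
  rewrite integral_cst// [X in (_ * X)%E](leb_unit_cell n0) muleC muleA -EFinM.
  by rewrite -invfM -expr2.
apply: (@le_trans _ _ (\sum_(b <- r2) (n%:R ^- 2)%:E * \int[leb]_(t in step n (- (n%:R^-1 / 2)) b) m t)%E).
  by apply: lee_sum => b _; exact: cell.
rewrite -ge0_sume_distrr; last by move=> b _; exact: integral_ge0.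
apply: lee_wpmul2l; first by rewrite lee_fin invr_ge0 sqr_ge0.
exact: sum_integral_step.
Qed.

End increments.

Section cell_average.
Context (R : realType).
Notation mR := (measurableTypeR R).
Notation leb := (@lebesgue_measure R).
Notation leb2 := (lebesgue2 R).

Definition square_cell (n : nat) : set (mR * mR) := unit_cell n `*` unit_cell n.

Lemma measurable_square_cell n : measurable (square_cell n).
Proof. by apply: measurableX; exact: measurable_unit_cell. Qed.

Lemma leb2_square_cell n : (0 < n)%N -> leb2 (square_cell n) = (n%:R ^- 2)%:E.
Proof.
move=> n0; have mc := @measurable_unit_cell R n.
have -> : (leb2 (square_cell n) = leb (unit_cell n) * leb (unit_cell n))%E by exact: product_measure1E.
by rewrite !leb_unit_cell// -EFinM -invfM -expr2.
Qed.

Definition cell_avg (n : nat) (f : R * R -> R) (x : Z2) : R :=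
  n%:R ^+ 2 * \int[leb2]_(z in square_cell n) f (x.1%:~R / n%:R + z.1, x.2%:~R / n%:R + z.2).

Lemma integrable_square_cell (n : nat) (f : R * R -> R) (B : R) : (0 < n)%N ->
  measurable_fun [set: mR * mR] f -> (forall z, `|f z| <= B) ->
  leb2.-integrable (square_cell n) (EFin \o f).
Proof.
move=> n0 mf fB; apply: measurable_bounded_integrable.
- exact: measurable_square_cell.
- by rewrite leb2_square_cell// ltry.
- exact: measurable_funTS.
- exists B; split; first exact: num_real.
  by move=> M /ltW BM x _; exact: le_trans (fB _) BM.
Qed.

Lemma measurable_translate2 (f : R * R -> R) (c d : R) : measurable_fun [set: mR * mR] f ->
  measurable_fun [set: mR * mR] (fun z : mR * mR => f (c + z.1, d + z.2)).
Proof.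
move=> mf; apply: (measurableT_comp mf (g := fun z : mR * mR => (c + z.1, d + z.2))).
by apply: measurable_fun_pair; apply: measurable_funD.
Qed.

Lemma cell_avg_diff_sqr (n : nat) (f : R * R -> R) (B : R) (x y : Z2) : (0 < n)%N ->
  measurable_fun [set: mR * mR] f -> (forall z, `|f z| <= B) ->
  (((cell_avg n f x - cell_avg n f y) ^+ 2)%:E <=
  (n%:R ^+ 2)%:E * \int[leb2]_(z in square_cell n)
    ((f (x.1%:~R / n%:R + z.1, x.2%:~R / n%:R + z.2) - f (y.1%:~R / n%:R + z.1, y.2%:~R / n%:R + z.2)) ^+ 2)%:E)%E.
Proof.
move=> n0 mf fB.
have n0' : 0 < n%:R :> R by rewrite ltr0n.
pose g (x : Z2) z := f (x.1%:~R / n%:R + z.1, x.2%:~R / n%:R + z.2).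
have mg w : measurable_fun [set: mR * mR] (g w) by exact: measurable_translate2.
have gB w z : `|g w z| <= B by exact: fB.
have ig w : leb2.-integrable (square_cell n) (EFin \o g w) by exact: integrable_square_cell (mg w) (gB w).
pose d z := g x z - g y z.
have md : measurable_fun [set: mR * mR] d by exact: measurable_funB.
have id : leb2.-integrable (square_cell n) (EFin \o d).
  apply: (@integrable_square_cell _ _ (B + B)) => // z.
  by apply: (le_trans (ler_normB _ _)); exact: lerD.
have id2 : leb2.-integrable (square_cell n) (EFin \o (fun z => d z ^+ 2)).
  apply: (@integrable_square_cell _ _ ((B + B) ^+ 2)) => //; first exact: measurable_funX.
  move=> z; rewrite normrX ler_sqr ?nnegrE//.
    by apply: (le_trans (ler_normB _ _)); exact: lerD.
  by apply: le_trans (lerD (gB x z) (gB x z)); rewrite addr_ge0.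
have q0 : 0 < n%:R ^- 2 :> R by rewrite invr_gt0 exprn_gt0.
have := @Rintegral_sqr_le R _ _ leb2 _ _ _ (measurable_square_cell n) (leb2_square_cell n0) q0 id id2.
rewrite RintegralB//; last exact: measurable_square_cell.
move=> h; rewrite -(fineK (integrable_fin_num (measurable_square_cell n) id2)) -EFinM lee_fin.
rewrite /cell_avg -mulrBr exprMn.
apply: le_trans (ler_wpM2l _ h) _; first by rewrite exprn_ge0// exprn_ge0// ltW.
rewrite mulrA /Rintegral; apply: ler_wpM2r.
  by apply: fine_ge0; apply: integral_ge0 => z _; rewrite lee_fin sqr_ge0.
by rewrite le_eqVlt; apply/orP; left; apply/eqP; field; rewrite gt_eqF.
Qed.

Variables (eta : R * R -> R) (deta : bool -> R * R -> R) (B : R).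
Hypothesis ceta : continuous eta.
Hypothesis cdeta : forall i, continuous (deta i).
Hypothesis eta_B : forall z, `|eta z| <= B.
Hypothesis etaD : forall i z, is_derive z (axis R i) eta (deta i z).

Lemma is_derive_fst (x y : R) : is_derive x 1 (fun x => eta (x, y)) (deta false (x, y)).
Proof.
have [d1 d2] := etaD false (x, y).
have E : (fun h : R => h^-1 *: (eta (h *: (1 : R) + x, y) - eta (x, y))) =
         (fun h : R => h^-1 *: (eta (h *: axis R false + (x, y)) - eta (x, y))).
  by apply/funext => h; rewrite /axis /=; congr (_ *: (eta _ - _)); congr pair; rewrite /= ?scaler0 ?add0r.
split.
  by move: d1; rewrite /derivable -E.
by move: d2; rewrite /derive -E.
Qed.

Lemma is_derive_snd (x y : R) : is_derive y 1 (fun y => eta (x, y)) (deta true (x, y)).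
Proof.
have [d1 d2] := etaD true (x, y).
have E : (fun h : R => h^-1 *: (eta (x, h *: (1 : R) + y) - eta (x, y))) =
         (fun h : R => h^-1 *: (eta (h *: axis R true + (x, y)) - eta (x, y))).
  by apply/funext => h; rewrite /axis /=; congr (_ *: (eta _ - _)); congr pair; rewrite /= ?scaler0 ?add0r.
split.
  by move: d1; rewrite /derivable -E.
by move: d2; rewrite /derive -E.
Qed.


(** The factor [n ^+ 2] from Jensen cancels the [n ^- 2] of [increments_le]: the Dirichlet energy is
    scale invariant in dimension two. *)
Lemma cell_avg_energy_fst (n : nat) (r1 r2 : seq int) (J K : set mR) : (0 < n)%N ->
  uniq r1 -> uniq r2 -> measurable J -> measurable K ->
  (forall a s, a \in r1 -> unit_cell n s -> step n s a `<=` J) ->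
  (forall b, b \in r2 -> step n (- (n%:R^-1 / 2)) b `<=` K) ->
  (\sum_(b <- r2) \sum_(a <- r1) ((cell_avg n eta (a + 1, b) - cell_avg n eta (a, b)) ^+ 2)%:E <=
   \int[leb2]_(z in J `*` K) ((deta false z) ^+ 2)%:E)%E.
Proof.
move=> n0 u1 u2 mJ mK hJ hK.
have n0' : 0 < n%:R :> R by rewrite ltr0n.
have meta := continuous_measurable2 ceta.
pose d (a b : int) (z : R * R) : R := eta ((a + 1)%:~R / n%:R + z.1, b%:~R / n%:R + z.2) - eta (a%:~R / n%:R + z.1, b%:~R / n%:R + z.2).
have md a b : measurable_fun [set: mR * mR] (fun z => ((d a b z) ^+ 2)%:E).
  apply: (measurable_EFinP (T := (mR * mR)%type) setT _).2; apply: measurable_funX.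
  by apply: measurable_funB; exact: measurable_translate2.
have mD : measurable_fun [set: mR * mR] (fun z => ((deta false z) ^+ 2)%:E).
  apply: (measurable_EFinP (T := (mR * mR)%type) setT _).2; apply: measurable_funX.
  exact: continuous_measurable2.
have mQ := measurable_square_cell n; have mc := @measurable_unit_cell R n.
rewrite (integral_rect_swap mD _ mJ mK); last by move=> z; rewrite lee_fin sqr_ge0.
have := @increments_le R (fun x y => eta (x, y)) (fun x y => deta false (x, y)) is_derive_fst
  _ _ n r1 r2 J K n0 u1 u2 mJ mK hJ hK.
have e (f : R * R -> R) : (fun z : R * R => f (z.1, z.2)) = f by apply/funext => -[].
rewrite !e => /(_ ceta (@cdeta false)).
set RH := (\int[leb]_(y in K) _)%E => H.
apply: (@le_trans _ _ ((n%:R ^+ 2)%:E * ((n%:R ^- 2)%:E * RH))%E); last first.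
  by rewrite muleA -EFinM mulfV ?mul1e// gt_eqF// exprn_gt0.
apply: le_trans (lee_wpmul2l _ H); last by rewrite lee_fin exprn_ge0// ltW.
rewrite ge0_sume_distrr; last first.
  move=> b _; apply: integral_ge0 => t _; apply: integral_ge0 => s _.
  by apply: sume_ge0 => a _; rewrite lee_fin sqr_ge0.
apply: lee_sum => b _.
apply: (@le_trans _ _ (\sum_(a <- r1) (n%:R ^+ 2)%:E * \int[leb2]_(z in square_cell n) ((d a b z) ^+ 2)%:E)%E).
  by apply: lee_sum => a _; exact: (cell_avg_diff_sqr (a + 1, b) (a, b) n0 meta eta_B).
rewrite -ge0_sume_distrr; last by move=> a _; apply: integral_ge0 => z _; rewrite lee_fin sqr_ge0.
apply: lee_wpmul2l; first by rewrite lee_fin exprn_ge0// ltW.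
rewrite -ge0_integral_sum//; last 2 first.
- by move=> a; exact: measurable_funTS (md a b).
- by move=> a z _; rewrite lee_fin sqr_ge0.
rewrite (integral_rect_swap (F := fun z => \sum_(a <- r1) ((d a b z) ^+ 2)%:E)%E)//.
- by apply: emeasurable_sum => a; exact: md.
- by move=> z; apply: sume_ge0 => a _; rewrite lee_fin sqr_ge0.
Qed.

Lemma cell_avg_energy_snd (n : nat) (r1 r2 : seq int) (J K : set mR) : (0 < n)%N ->
  uniq r1 -> uniq r2 -> measurable J -> measurable K ->
  (forall b s, b \in r1 -> unit_cell n s -> step n s b `<=` J) ->
  (forall a, a \in r2 -> step n (- (n%:R^-1 / 2)) a `<=` K) ->
  (\sum_(a <- r2) \sum_(b <- r1) ((cell_avg n eta (a, b + 1) - cell_avg n eta (a, b)) ^+ 2)%:E <=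
   \int[leb2]_(z in K `*` J) ((deta true z) ^+ 2)%:E)%E.
Proof.
move=> n0 u1 u2 mJ mK hJ hK.
have n0' : 0 < n%:R :> R by rewrite ltr0n.
have meta := continuous_measurable2 ceta.
pose d (a b : int) (z : R * R) : R := eta (a%:~R / n%:R + z.1, (b + 1)%:~R / n%:R + z.2) - eta (a%:~R / n%:R + z.1, b%:~R / n%:R + z.2).
have md a b : measurable_fun [set: mR * mR] (fun z => ((d a b z) ^+ 2)%:E).
  apply: (measurable_EFinP (T := (mR * mR)%type) setT _).2; apply: measurable_funX.
  by apply: measurable_funB; exact: measurable_translate2.
have mD : measurable_fun [set: mR * mR] (fun z => ((deta true z) ^+ 2)%:E).
  apply: (measurable_EFinP (T := (mR * mR)%type) setT _).2; apply: measurable_funX.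
  exact: continuous_measurable2.
have mQ := measurable_square_cell n; have mc := @measurable_unit_cell R n.
rewrite (integral_rect mD _ mK mJ); last by move=> z; rewrite lee_fin sqr_ge0.
have csw (f : R * R -> R) : continuous f -> continuous (fun z : R * R => f (z.2, z.1)).
  move=> cf z; apply: (@continuous_comp _ _ _ (fun z : R * R => (z.2, z.1)) f); last exact: cf.
  by apply: (@cvg_pair _ _ _ (nbhs z) (nbhs z.2) (nbhs z.1)); [exact: cvg_snd|exact: cvg_fst].
have := @increments_le R (fun x y => eta (y, x)) (fun x y => deta true (y, x)) (fun x y => is_derive_snd y x)
  (csw _ ceta) (csw _ (@cdeta true)) n r1 r2 J K n0 u1 u2 mJ mK hJ hK.
set RH := (\int[leb]_(y in K) _)%E => H.
apply: (@le_trans _ _ ((n%:R ^+ 2)%:E * ((n%:R ^- 2)%:E * RH))%E); last first.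
  by rewrite muleA -EFinM mulfV ?mul1e// gt_eqF// exprn_gt0.
apply: le_trans (lee_wpmul2l _ H); last by rewrite lee_fin exprn_ge0// ltW.
rewrite ge0_sume_distrr; last first.
  move=> b _; apply: integral_ge0 => t _; apply: integral_ge0 => s _.
  by apply: sume_ge0 => a _; rewrite lee_fin sqr_ge0.
apply: lee_sum => a _.
apply: (@le_trans _ _ (\sum_(b <- r1) (n%:R ^+ 2)%:E * \int[leb2]_(z in square_cell n) ((d a b z) ^+ 2)%:E)%E).
  by apply: lee_sum => b _; exact: (cell_avg_diff_sqr (a, b + 1) (a, b) n0 meta eta_B).
rewrite -ge0_sume_distrr; last by move=> b _; apply: integral_ge0 => z _; rewrite lee_fin sqr_ge0.
apply: lee_wpmul2l; first by rewrite lee_fin exprn_ge0// ltW.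
rewrite -ge0_integral_sum//; last 2 first.
- by move=> b; exact: measurable_funTS (md a b).
- by move=> b z _; rewrite lee_fin sqr_ge0.
rewrite (integral_rect (F := fun z => \sum_(b <- r1) ((d a b z) ^+ 2)%:E)%E)//.
- by apply: emeasurable_sum => b; exact: md.
- by move=> z; apply: sume_ge0 => b _; rewrite lee_fin sqr_ge0.
Qed.

End cell_average.

(** * Cell averages of test functions supported inside the unit square *)

Section test_functions.
Context (R : realType).
Notation mR := (measurableTypeR R).
Notation leb := (@lebesgue_measure R).
Notation leb2 := (lebesgue2 R).
Notation L := (unit_square R).

Definition grad (eta : R * R -> R) (i : bool) : R * R -> R := fun z => 'D_(axis R i) eta z.

Lemma test_function_continuous eta : test_function L eta -> continuous eta.
Proof. by case=> + _ _ => /(_ [::])[]. Qed.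

Lemma test_function_continuous_grad eta i : test_function L eta -> continuous (grad eta i).
Proof. by case=> + _ _ => /(_ [:: i])[]. Qed.

Lemma test_function_is_derive eta i z : test_function L eta ->
  is_derive z (axis R i) eta (grad eta i z).
Proof. by case=> + _ _ => /(_ [::])[_ /(_ i z) d]; split. Qed.

Lemma test_function_bounded eta : test_function L eta -> exists B, forall z, `|eta z| <= B.
Proof.
move=> te; have [_ cpt _] := te; have ce := test_function_continuous te.
have : compact (eta @` closure [set z | eta z != 0]).
  by apply: continuous_compact => //; exact: continuous_subspaceT.
move=> /compact_bounded[M [_ hM]]; exists (`|M| + 1) => z.
have [->|ez] := eqVneq (eta z) 0; first by rewrite normr0 addr_ge0.
apply: (hM (`|M| + 1)); first by rewrite ltr_pwDr// ler_norm.
by exists z => //; exact: subset_closure.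
Qed.

Lemma unit_square_interior z : (L°) z -> - (1 / 2) < z.1 < 1 / 2 /\ - (1 / 2) < z.2 < 1 / 2.
Proof.
move=> /nbhs_ballP[e /= e0 he].
have e2 : 0 < e / 2 by rewrite divr_gt0.
have b (x y : R) : `|x| <= e / 2 -> `|y| <= e / 2 -> L (z.1 + x, z.2 + y).
  move=> hx hy; apply: he; split => /=; rewrite /ball/= opprD addrA subrr add0r normrN; lra.
have n1 : `|e / 2| <= e / 2 by rewrite ger0_norm// ltW.
have n2 : `|- (e / 2)| <= e / 2 by rewrite normrN.
have [/andP[_ p1] /andP[_ p2]] := b _ _ n1 n1.
have [/andP[p3 _] /andP[p4 _]] := b _ _ n2 n2.
by move: p1 p2 p3 p4 => /= p1 p2 p3 p4; split; lra.
Qed.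

Lemma test_function_eq0 eta z : test_function L eta -> ~ (L° z) -> eta z = 0.
Proof.
case=> _ _ sub Lz; apply: contrapT => /eqP ez; apply: Lz; apply: sub.
exact: subset_closure.
Qed.

Lemma grad_eq0 eta i z : test_function L eta -> ~ (L° z) -> grad eta i z = 0.
Proof.
move=> te Lz; have [_ _ sub] := te.
have oC : open (~` closure [set z | eta z != 0]) by apply: closed_openC; exact: closed_closure.
have zC : (~` closure [set z | eta z != 0]) z by move=> /sub.
have nz : nbhs z (~` closure [set z | eta z != 0]) by apply: open_nbhs_nbhs; split.
have e0 : \forall y \near z, eta y = cst 0 y.
  near=> y; apply: contrapT => /eqP ey.
  have : (~` closure [set z | eta z != 0]) y by near: y.
  by apply; exact: subset_closure.
by rewrite /grad (near_eq_derive _ e0) derive_cst.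
Unshelve. all: by end_near.
Qed.


(** An integer beyond [n / 2] is beyond it by at least [1 / 2], so the cell around such a site
    misses the interior of the square. *)
Lemma half_ratio (n : nat) (a : int) : (0 < n)%N -> ~~ (`|a| * 2 <= n)%N ->
  a%:~R / n%:R <= - (1 / 2) - n%:R^-1 / 2 :> R \/ 1 / 2 + n%:R^-1 / 2 <= a%:~R / n%:R :> R.
Proof.
move=> n0 an; have n0' : 0 < n%:R :> R by rewrite ltr0n.
have [a0|a0] := leP 0 a; [right|left].
  rewrite ler_pdivlMr// (_ : _ * n%:R = (n%:R + 1) / 2); last by field; rewrite gt_eqF.
  have : (n%:Z + 1 <= 2 * a)%R by lia.
  by rewrite -(ler_int R) intrD intrM -[(n%:Z)%:~R]/(n%:R); lra.
rewrite ler_pdivrMr// (_ : _ * n%:R = - ((n%:R + 1) / 2)); last by field; rewrite gt_eqF.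
have : (2 * a <= - (n%:Z + 1))%R by lia.
by rewrite -(ler_int R) rmorphN/= intrD intrM -[(n%:Z)%:~R]/(n%:R); lra.
Qed.

Lemma cell_avg_eq0 (n : nat) eta (x : Z2) : (0 < n)%N -> test_function L eta ->
  x \notin box n -> cell_avg n eta x = 0.
Proof.
move=> n0 te xb; rewrite /cell_avg.
rewrite (_ : \int[leb2]_(z in square_cell n) _ = 0) ?mulr0//.
rewrite /Rintegral (eq_integral (cst 0%E)) ?integral0//= => z /[!inE] -[].
rewrite /unit_cell/= !in_itv/= => h1 h2; congr EFin.
apply: (test_function_eq0 te) => /unit_square_interior/= [i1 i2].
move: xb; rewrite mem_box negb_and => /orP[] /(half_ratio n0)[]; lra.
Qed.

Lemma measurable_unit_square : measurable (L : set (mR * mR)).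
Proof.
rewrite (_ : (L : set (mR * mR)) = `[- (1 / 2), 1 / 2]%classic `*` `[- (1 / 2), 1 / 2]%classic).
  by apply: measurableX; exact: measurable_itv.
by apply/seteqP; split => z; rewrite /unit_square/= !in_itv/=.
Qed.

Lemma unit_square_interior_sub z : L° z -> L z.
Proof. exact: interior_subset. Qed.

Lemma measurable_grad_sqr eta i : test_function L eta ->
  measurable_fun [set: mR * mR] (fun z => ((grad eta i z) ^+ 2)%:E).
Proof.
move=> te; apply: (measurable_EFinP (T := (mR * mR)%type) setT _).2; apply: measurable_funX.
exact: continuous_measurable2 (@test_function_continuous_grad _ i te).
Qed.

Lemma cell_avg_energy (n M : nat) eta : (0 < n)%N -> test_function L eta ->
  ((\sum_(x <- sq M) edge_energy (cell_avg n eta) x)%:E <= dirichlet_energy L (grad eta))%E.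
Proof.
move=> n0 te.
have [B eB] := test_function_bounded te.
have ce := test_function_continuous te.
have cg i := @test_function_continuous_grad _ i te.
have dg i z := @test_function_is_derive _ i z te.
have mT : measurable ([set: mR]) by [].
have E1 := cell_avg_energy_fst ce cg eB dg n0 (crange_uniq M) (crange_uniq M) mT mT (fun a s _ _ => @subsetT _ _) (fun b _ => @subsetT _ _).
have E2 := cell_avg_energy_snd ce cg eB dg n0 (crange_uniq M) (crange_uniq M) mT mT (fun a s _ _ => @subsetT _ _) (fun b _ => @subsetT _ _).
have dL i : (\int[leb2]_(z in setT `*` setT) ((grad eta i z) ^+ 2)%:E = \int[leb2]_(z in L) ((grad eta i z) ^+ 2)%:E)%E.
  rewrite setXTT [RHS]integral_mkcond; apply: eq_integral => z _; rewrite patchE.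
  case: ifPn => //; rewrite notin_setE => Lz; rewrite grad_eq0 ?expr0n//.
  by move=> /unit_square_interior_sub.
rewrite !dL in E1 E2.
rewrite /dirichlet_energy; under eq_integral do rewrite EFinD.
have mL := measurable_unit_square.
rewrite ge0_integralD//=; last 4 first.
- by move=> z _; rewrite lee_fin sqr_ge0.
- by apply: measurable_funTS; exact: measurable_grad_sqr.
- by move=> z _; rewrite lee_fin sqr_ge0.
- by apply: measurable_funTS; exact: measurable_grad_sqr.
rewrite exchange_big/= in E1.
have sum2 (F : int -> int -> R) : (\sum_(a <- crange M) \sum_(b <- crange M) (F a b)%:E =
    (\sum_(a <- crange M) \sum_(b <- crange M) F a b)%:E)%E.
  by under eq_bigr do rewrite sumEFin; rewrite sumEFin.
rewrite !sum2 in E1 E2; apply: le_trans (leeD E1 E2).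
rewrite -EFinD lee_fin sum_sq -big_split/=; apply: ler_sum => a _.
rewrite -big_split/=; apply: ler_sum => b _.
have e (p q : R) : (p - q) ^+ 2 = (q - p) ^+ 2 by rewrite -sqrrN opprB.
by rewrite /edge_energy/= e (e (cell_avg n eta (a, b)) (cell_avg n eta (a, b + 1))).
Qed.

Lemma leb_itv_oc (x y : R) : x <= y -> leb `]x, y]%classic = (y - x)%:E.
Proof.
move=> xy; rewrite lebesgue_measure_itv/= lte_fin; case: ltP => [_|yx]; first by rewrite EFinB.
by rewrite (le_anti (introT andP (conj xy yx))) subrr.
Qed.

Definition shift_axis (x : Z2) (i : bool) : Z2 := if i then (x.1, x.2 + 1) else (x.1 + 1, x.2).

(** [S] is the union of two adjacent cells and is chosen before [eta], so that smallness over [S]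
    can be taken from the limit gradient instead of from the approximating functions. *)
Lemma cell_avg_edge (n : nat) (x : Z2) (i : bool) : (0 < n)%N ->
  exists S : set (mR * mR), [/\ measurable S, (leb2 S <= (2 * n%:R ^- 2)%:E)%E &
    forall eta, test_function L eta ->
    (((cell_avg n eta (shift_axis x i) - cell_avg n eta x) ^+ 2)%:E <=
      \int[leb2]_(z in S) ((grad eta i z) ^+ 2)%:E)%E].
Proof.
move=> n0.
have n0' : 0 < n%:R^-1 :> R by rewrite invr_gt0 ltr0n.
pose J (a : int) : set mR := `](a%:~R / n%:R - n%:R^-1 / 2), ((a + 1)%:~R / n%:R + n%:R^-1 / 2)]%classic.
pose K (a : int) : set mR := step n (- (n%:R^-1 / 2)) a.
have mJ a : measurable (J a) by exact: measurable_itv.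
have mK a : measurable (K a) by exact: measurable_itv.
have lJ a : leb (J a) = (2 * n%:R^-1)%:E.
  by rewrite leb_itv_oc intrD; [congr EFin; lra|lra].
have lK a : leb (K a) = (n%:R^-1)%:E.
  by rewrite /K /step leb_itv_oc intrD; [congr EFin; lra|lra].
have hJ a b s : b \in [:: a] -> unit_cell n s -> step n s b `<=` J a.
  rewrite inE => /eqP ->; rewrite /unit_cell/= in_itv/= => /andP[s1 s2] y.
  by rewrite /step /J/= !in_itv/= => /andP[y1 y2]; apply/andP; split; lra.
have hK a b : b \in [:: a] -> step n (- (n%:R^-1 / 2)) b `<=` K a.
  by rewrite inE => /eqP ->.
have small : (2 * n%:R^-1 * n%:R^-1 <= 2 * n%:R ^- 2 :> R) by rewrite -mulrA -invfM -expr2.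
case: i.
  exists (K x.1 `*` J x.2); split; first exact: measurableX.
    have -> : (leb2 (K x.1 `*` J x.2) = leb (K x.1) * leb (J x.2))%E by exact: product_measure1E.
    by rewrite lJ lK -EFinM lee_fin; apply: le_trans small; rewrite mulrC.
  move=> eta te; have [B eB] := test_function_bounded te.
  have := cell_avg_energy_snd (test_function_continuous te) (fun i => @test_function_continuous_grad _ i te) eB
    (fun i z => @test_function_is_derive _ i z te) n0 (r1 := [:: x.2]) (r2 := [:: x.1]) isT isT (mJ x.2) (mK x.1)
    (@hJ x.2) (@hK x.1).
  by rewrite !big_seq1 -surjective_pairing.
exists (J x.1 `*` K x.2); split; first exact: measurableX.
  have -> : (leb2 (J x.1 `*` K x.2) = leb (J x.1) * leb (K x.2))%E by exact: product_measure1E.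
  by rewrite lJ lK -EFinM lee_fin.
move=> eta te; have [B eB] := test_function_bounded te.
have := cell_avg_energy_fst (test_function_continuous te) (fun i => @test_function_continuous_grad _ i te) eB
  (fun i z => @test_function_is_derive _ i z te) n0 (r1 := [:: x.1]) (r2 := [:: x.2]) isT isT (mJ x.1) (mK x.2)
  (@hJ x.1) (@hK x.2).
by rewrite !big_seq1 -surjective_pairing.
Qed.

Definition lattice_cell (n : nat) (x : Z2) : set (mR * mR) :=
  step n (- (n%:R^-1 / 2)) x.1 `*` step n (- (n%:R^-1 / 2)) x.2.

Lemma integral_lattice_cell (n : nat) (x : Z2) (G : R * R -> \bar R) :
  measurable_fun [set: mR * mR] G -> (forall z, (0 <= G z)%E) ->
  (\int[leb2]_(z in square_cell n) G (x.1%:~R / n%:R + z.1, x.2%:~R / n%:R + z.2)%R =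
   \int[leb2]_(z in lattice_cell n x) G z)%E.
Proof.
move=> mG G0.
have mc := @measurable_unit_cell R n.
have mst (b : int) : measurable (step n (- (n%:R^-1 / 2)) b : set mR) by exact: measurable_itv.
rewrite (integral_rect (F := fun z => G (x.1%:~R / n%:R + z.1, x.2%:~R / n%:R + z.2)%R))//; last first.
  apply: (measurableT_comp mG (g := fun z : mR * mR => (x.1%:~R / n%:R + z.1, x.2%:~R / n%:R + z.2))).
  by apply: measurable_fun_pair; apply: measurable_funD.
rewrite integral_rect//.
rewrite [in RHS]step_center -ge0_integral_shift_itv; last 2 first.
- exact: measurable_integral_section.
- by move=> z; exact: integral_ge0.
apply: eq_integral => s _.
rewrite [in RHS]step_center -ge0_integral_shift_itv//.
by apply: (measurableT_comp mG (g := fun t : mR => (x.1%:~R / n%:R + s, t))); exact: measurable_pair1.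
Qed.

Lemma cell_avg_ge (n : nat) (x : Z2) (D : set (R * R)) (f eta : R * R -> R) (delta : R) : (0 < n)%N ->
  test_function L eta -> D `<=` L -> lattice_cell n x `<=` D ->
  measurable_fun (L : set (mR * mR)) f ->
  {ae leb2, forall z, D z -> 1 <= f z} -> 0 <= delta ->
  ((n%:R ^+ 2)%:E * \int[leb2]_(z in L) ((f z - eta z) ^+ 2)%:E <= (delta ^+ 2)%:E)%E ->
  1 - delta <= cell_avg n eta x.
Proof.
move=> n0 te DL cD mf f1 delta0 small.
have n0' : 0 < n%:R :> R by rewrite ltr0n.
have [B eB] := test_function_bounded te.
have ce := test_function_continuous te.
have meta := continuous_measurable2 ce.
have mQ : measurable (square_cell n : set (mR * mR)) by exact: measurable_square_cell.
have mL := measurable_unit_square.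
(* On the cell [f >= 1] almost everywhere, so the deficit [p] is at most [|f - eta|]; by Jensen its
   mean is at most [n] times the [L^2] distance. *)
pose p (z : R * R) := Num.max (1 - eta z) 0.
have mp : measurable_fun [set: mR * mR] p.
  by apply: measurable_maxr => //; exact: measurable_funB.
have pB z : `|p z| <= 1 + B.
  have := eB z; rewrite ler_norml => /andP[e1 e2].
  by rewrite /p ger0_norm ?le_max ?lexx ?orbT// ge_max; lra.
pose sh (g : R * R -> R) (z : R * R) := g (x.1%:~R / n%:R + z.1, x.2%:~R / n%:R + z.2).
have ip : leb2.-integrable (square_cell n) (EFin \o sh p).
  exact: (integrable_square_cell n0 (measurable_translate2 _ _ mp) (fun z => pB _)).
have ie : leb2.-integrable (square_cell n) (EFin \o sh eta).
  exact: (integrable_square_cell n0 (measurable_translate2 _ _ meta) (fun z => eB _)).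
have ip2 : leb2.-integrable (square_cell n) (EFin \o (fun z => sh p z ^+ 2)).
  apply: (@integrable_square_cell _ _ _ ((1 + B) ^+ 2)) => //.
    by apply: measurable_funX; exact: (measurable_translate2 _ _ mp).
  by move=> z; rewrite normrX ler_sqr ?nnegrE// ?pB//; exact: le_trans (pB z).
have q0 : 0 < n%:R ^- 2 :> R by rewrite invr_gt0 exprn_gt0.
have JS := @Rintegral_sqr_le R _ _ leb2 _ _ _ mQ (@leb2_square_cell R n n0) q0 ip ip2.
set Jp := \int[leb2]_(z in square_cell n) sh p z in JS.
have mst (b : int) : measurable (step n (- (n%:R^-1 / 2)) b : set mR) by exact: measurable_itv.
have mcell : measurable (lattice_cell n x) by exact: measurableX.
have mp2 : measurable_fun [set: mR * mR] (fun z => (p z ^+ 2)%:E).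
  by apply: (measurable_EFinP (T := (mR * mR)%type) setT _).2; exact: measurable_funX.
have mfe : measurable_fun (L : set (mR * mR)) (fun z => ((f z - eta z) ^+ 2)%:E).
  apply: (measurable_EFinP (T := (mR * mR)%type) (L : set (mR * mR)) _).2; apply: measurable_funX.
  by apply: measurable_funB => //; exact: measurable_funTS.
have cL : lattice_cell n x `<=` L by exact: subset_trans cD DL.
have le1 : (\int[leb2]_(z in square_cell n) (sh p z ^+ 2)%:E <= \int[leb2]_(z in L) ((f z - eta z) ^+ 2)%:E)%E.
  rewrite (@integral_lattice_cell n x (fun z => (p z ^+ 2)%:E))//; last by move=> z; rewrite lee_fin sqr_ge0.
  apply: (@le_trans _ _ (\int[leb2]_(z in lattice_cell n x) ((f z - eta z) ^+ 2)%:E)%E); last first.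
    by apply: ge0_subset_integral => // z _; rewrite lee_fin sqr_ge0.
  apply: ae_ge0_le_integral => //.
  - by move=> z _; rewrite lee_fin sqr_ge0.
  - exact: measurable_funTS.
  - by move=> z _; rewrite lee_fin sqr_ge0.
  - exact: measurable_funS mfe.
  case: f1 => A [mA A0 sub]; exists A; split => // z /= nz; apply: sub => /= h; apply: nz => /cD /h {}h.
  rewrite lee_fin /p.
  by case: (leP (1 - eta z) 0) => e1; rewrite ?expr0n ?sqr_ge0//= !expr2; nra.
have le2 : \int[leb2]_(z in square_cell n) (sh p z ^+ 2) <= n%:R ^- 2 * delta ^+ 2.
  rewrite ler_pdivlMl ?exprn_gt0// -lee_fin EFinM.
  apply: le_trans small; apply: lee_wpmul2l; first by rewrite lee_fin exprn_ge0// ltW.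
  have fin := integrable_fin_num mQ ip2.
  by apply: le_trans le1; rewrite /Rintegral (fineK fin).
have le3 : Jp <= n%:R ^- 2 * delta.
  have z0 : 0 <= n%:R ^- 2 * delta by rewrite mulr_ge0// ltW.
  have : Jp ^+ 2 <= (n%:R ^- 2 * delta) ^+ 2.
    apply: (le_trans JS).
    have -> : (n%:R ^- 2 * delta) ^+ 2 = n%:R ^- 2 * (n%:R ^- 2 * delta ^+ 2) by rewrite exprMn mulrA -expr2.
    by apply: ler_wpM2l => //; exact: ltW.
  by rewrite !expr2 => h; nra.
have ic : leb2.-integrable (square_cell n) (EFin \o cst 1).
  by apply: (@integrable_square_cell _ _ _ 1) => // z; rewrite /= normr1.
have le4 : \int[leb2]_(z in square_cell n) (1 - sh p z) <= \int[leb2]_(z in square_cell n) sh eta z.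
  apply: le_Rintegral => //; first exact: (integrableB mQ ic ip).
  by move=> z _; rewrite /sh /p lerBlDr -lerBlDl le_max lexx.
rewrite RintegralB// Rintegral_cst//= leb2_square_cell//= mul1r -/Jp in le4.
rewrite /cell_avg -/(sh eta).
have -> : 1 - delta = n%:R ^+ 2 * (n%:R ^- 2 - n%:R ^- 2 * delta) by field; rewrite gt_eqF.
apply: ler_wpM2l; first by rewrite exprn_ge0// ltW.
by apply: le_trans le4; rewrite lerD2l lerN2.
Qed.

End test_functions.

(** * Lattice approximation of capacity competitors *)

Section geometry.
Context (R : realType).
Notation L := (unit_square R).

Definition shift_int (x : Z2) (i : bool) (k : int) : Z2 :=
  if i then (x.1, x.2 + k) else (x.1 + k, x.2).

(** Stated for every real point, and vacuous away from [D] and from lattice points, so that local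
    versions in [z] glue by compactness into one [K] valid for all [n >= K]. *)
Definition inner_cell_near (D : set (R * R)) (K : nat) (z : R * R) : Prop :=
  D z -> forall (n : nat) (x : Z2), (0 < n)%N -> (K <= n)%N -> z = (x.1%:~R / n%:R, x.2%:~R / n%:R) ->
  exists (i : bool) (k : int), (`|k| <= K)%N /\ lattice_cell n (shift_int x i k) `<=` D.

Lemma lattice_cell_near (n : nat) (x : Z2) (w : R * R) : lattice_cell n x w ->
  `|w.1 - x.1%:~R / n%:R| <= n%:R^-1 / 2 /\ `|w.2 - x.2%:~R / n%:R| <= n%:R^-1 / 2.
Proof.
rewrite /lattice_cell !step_center => -[]; rewrite /= !in_itv/= => h1 h2.
by rewrite !ler_norml; lra.
Qed.

Lemma smooth_lipschitz (gamma : R -> R) (a b : R) :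
  (forall (k : nat) (s : R), derivable (derive1n k gamma) s 1) ->
  exists C, forall s s', a <= s <= b -> a <= s' <= b -> `|gamma s - gamma s'| <= C * `|s - s'|.
Proof.
move=> dg.
have cg' : continuous (derive1 gamma).
  move=> s; apply: differentiable_continuous; apply/derivable1_diffP.
  exact: (dg 1%N s).
have : compact (derive1 gamma @` `[a, b]).
  by apply: continuous_compact; [exact: continuous_subspaceT|exact: segment_compact].
move=> /compact_bounded[M [_ hM]]; exists (`|M| + 1).
have hM' s : a <= s <= b -> `|derive1 gamma s| <= `|M| + 1.
  by move=> sab; apply: hM; [rewrite ltr_pwDr// ler_norm|exists s => //=; rewrite in_itv].
have key s s' : s <= s' -> a <= s <= b -> a <= s' <= b -> `|gamma s' - gamma s| <= (`|M| + 1) * `|s' - s|.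
  move=> ss' /andP[h1 h2] /andP[h3 h4].
  have isd (x : R) : is_derive x 1 gamma (derive1 gamma x).
    by split; [exact: (dg 0%N x)|rewrite derive1E].
  have [|c /[!in_itv]/= /andP[c1 c2] ->] := @MVT_segment R gamma (derive1 gamma) s s' ss' (fun z _ => isd z).
    apply: continuous_subspaceT => z; apply: differentiable_continuous; apply/derivable1_diffP.
    exact: (dg 0%N z).
  rewrite normrM; apply: ler_wpM2r => //; apply: hM'; lra.
move=> s s' h h'; have [ss'|/ltW ss'] := leP s s'; last exact: key.
by rewrite distrC (distrC s); exact: key.
Qed.

Lemma inner_cell_interior (D : set (R * R)) (p : R * R) : open D -> D p ->
  \forall z \near p & K \near \oo, inner_cell_near D K z.
Proof.
move=> oD Dp; have /nbhs_ballP[r /= r0 rD] : nbhs p D by exact: open_nbhs_nbhs.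
have r2 : 0 < r / 2 by rewrite divr_gt0.
exists (ball p (r / 2), [set K | (2 / r < K%:R)%R]) => /=.
  split; first exact: nbhsx_ballx.
  exact: nbhs_infty_gtr.
move=> [z K] /= [[pz1 pz2] Kr] Dz n x n0 Kn zE; exists false, 0; split => //.
move=> w /lattice_cell_near/=; rewrite addr0 => -[w1 w2]; apply: rD.
have n0' : 0 < n%:R :> R by rewrite ltr0n.
have nr : n%:R^-1 < r / 2.
  rewrite -[r / 2]invrK ltf_pV2 ?posrE ?invr_gt0// invf_div.
  by apply: (lt_le_trans Kr); rewrite ler_nat.
move: pz1 pz2; rewrite zE /ball/= /ball/= !ltr_norml !ler_norml in w1 w2 * => pz1 pz2.
by split; rewrite /ball/= ltr_norml; lra.
Qed.

(** Moving [K0] lattice steps vertically into [D] clears the graph: across half a cell the graph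
    varies by at most [|C| / (2 * n)], the cell extends [1 / (2 * n)] vertically, and
    [K0 >= |C| + 1]. Taking [K] large against [K0 / r] keeps the cell in the ball where the graph
    describes [D]. *)
Lemma inner_cell_boundary (D : set (R * R)) (p : R * R) : smooth_boundary D -> boundary D p ->
  \forall z \near p & K \near \oo, inner_cell_near D K z.
Proof.
move=> sD /sD[r [gamma [swap [flip [r0 dg hD]]]]].
have r2 : 0 < r / 2 by rewrite divr_gt0.
pose cs (z : R * R) := if swap then z.2 else z.1.
pose ct (z : R * R) := if swap then z.1 else z.2.
have {}hD z : ball p r z -> D z <-> (if flip then ct z < gamma (cs z) else gamma (cs z) < ct z).
  by move=> /hD; rewrite /cs /ct; case: (swap); case: z.
pose sp := if swap then p.2 else p.1.
have [C hC] := @smooth_lipschitz gamma (sp - r) (sp + r) dg.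
have [K0 hK0] : exists K0 : nat, `|C| + 1 <= K0%:R.
  by exists (Num.bound (`|C| + 1)); rewrite ltW// archi_boundP.
exists (ball p (r / 2), [set K | ((K0%:R + 1) * (2 / r) < K%:R)%R /\ (K0 <= K)%N]) => /=.
  split; first exact: nbhsx_ballx.
  by apply: filterI; [exact: nbhs_infty_gtr|exact: nbhs_infty_ge].
move=> [z K] /= [pz [Kr K0K]] Dz n x n0 Kn zE.
have n0' : 0 < n%:R :> R by rewrite ltr0n.
have nr : (K0%:R + 1) * n%:R^-1 < r / 2.
  rewrite ltr_pdivrMr// mulrC -ltr_pdivrMr// invf_div.
  by apply: (lt_le_trans Kr); rewrite ler_nat.
have nV : 0 < n%:R^-1 :> R by rewrite invr_gt0.
have n1 : n%:R^-1 < r / 2.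
  have : 0 <= K0%:R * n%:R^-1 :> R by apply: mulr_ge0 => //; exact: ltW.
  by move: nr; lra.
have key (zs zt ws wt e : R) : `|zs - sp| < r / 2 -> `|ws - zs| <= n%:R^-1 / 2 ->
    `|wt - (zt + e * (K0%:R / n%:R))| <= n%:R^-1 / 2 -> `|gamma ws - gamma zs| <= `|C| * (n%:R^-1 / 2).
  move=> hz hw _; apply: (le_trans (hC _ _ _ _)).
  - by move: hz hw; rewrite ltr_norml ler_norml; lra.
  - by move: hz; rewrite ltr_norml; lra.
  apply: (@le_trans _ _ (`|C| * `|ws - zs|)); first by apply: ler_wpM2r => //; exact: ler_norm.
  exact: ler_wpM2l.
have kC : `|C| * (n%:R^-1 / 2) + n%:R^-1 / 2 <= K0%:R / n%:R.
  have : (`|C| + 1) * n%:R^-1 <= K0%:R * n%:R^-1 by apply: ler_wpM2r => //; exact: ltW.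
  have : 0 <= `|C| * n%:R^-1 by apply: mulr_ge0 => //; exact: ltW.
  lra.
have nn : n%:R^-1 / 2 + K0%:R / n%:R < r / 2 by lra.
have kE : (if flip then - K0%:Z else K0%:Z)%:~R / n%:R = (if flip then -1 else 1) * (K0%:R / n%:R) :> R.
  by case: (flip); rewrite ?rmorphN/= ?mulN1r ?mul1r// mulNr.
have main (zs zt ws wt : R) : `|zs - sp| < r / 2 -> `|ws - zs| <= n%:R^-1 / 2 ->
    `|wt - (zt + (if flip then -1 else 1) * (K0%:R / n%:R))| <= n%:R^-1 / 2 ->
    (if flip then zt < gamma zs else gamma zs < zt) -> (if flip then wt < gamma ws else gamma ws < wt).
  move=> h1 h2 h3; have := key zs zt ws wt _ h1 h2 h3.
  by move: h3; case: (flip); rewrite !ler_norml => h3 h4; lra.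
have far (zt wt q : R) : `|zt - q| < r / 2 ->
    `|wt - (zt + (if flip then -1 else 1) * (K0%:R / n%:R))| <= n%:R^-1 / 2 -> `|q - wt| < r.
  have k0 : 0 <= K0%:R / n%:R :> R by apply: divr_ge0 => //; exact: ltW.
  by move: nn; case: (flip) => nn'; rewrite !ltr_norml !ler_norml; lra.
have close (zs ws q : R) : `|zs - q| < r / 2 -> `|ws - zs| <= n%:R^-1 / 2 -> `|q - ws| < r.
  by rewrite !ltr_norml !ler_norml; lra.
have [pz1 pz2] := pz.
have bz : ball p r z by apply: le_ball pz; lra.
have zDw := (hD z bz).1 Dz; rewrite zE/= in zDw pz1 pz2; rewrite /ball/= in pz1 pz2.
move: pz1 pz2; rewrite distrC => pz1; rewrite distrC => pz2.
(* The vertical direction of the graph is the second coordinate unless [swap] holds. *)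
exists (~~ swap), (if flip then - K0%:Z else K0%:Z); split; first by clear -K0K; case: (flip); lia.
move=> w /lattice_cell_near.
rewrite /shift_int; move: zDw hD main; rewrite /sp /cs /ct; case: swap {sp hC key cs ct} => /= zDw hD main; rewrite intrD mulrDl kE => -[h1 h2].
  have bw : ball p r w by split; rewrite /ball/=; [exact: far pz1 h1|exact: close pz2 h2].
  by apply/(hD w bw); exact: main pz2 h2 h1 zDw.
have bw : ball p r w by split; rewrite /ball/=; [exact: close pz1 h1|exact: far pz2 h2].
by apply/(hD w bw); exact: main pz1 h1 h2 zDw.
Qed.

(** Every point of the closure is in [D] or on the boundary and has a local [K]; compactness of the
    closure makes it uniform. *)
Lemma inner_cell (D : set (R * R)) : open D -> smooth_boundary D -> D `<=` L ->
  exists K : nat, forall z, inner_cell_near D K z.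
Proof.
move=> oD sD DL.
have cL : compact L.
  rewrite (_ : L = `[- (1 / 2), 1 / 2]%classic `*` `[- (1 / 2), 1 / 2]%classic).
    by apply: compact_setX; exact: segment_compact.
  by apply/seteqP; split => z; rewrite /unit_square/= !in_itv/=.
have cD : compact (closure D).
  apply: (subclosed_compact _ cL); first exact: closed_closure.
  have -> : L = closure L by apply/closure_id; apply: compact_closed => //; exact: norm_hausdorff.
  exact: closure_subset.
have /compact_near_coveringP := cD => /(_ nat \oo (fun K z => inner_cell_near D K z) _).
have h : forall x, closure D x -> \forall x' \near x & i \near \oo, inner_cell_near D i x'.
  move=> p cp; have [Dp|Dp] := pselect (D p); first exact: inner_cell_interior.
  apply: inner_cell_boundary => //; split => // Dp'; apply: Dp; exact: interior_subset.
move=> /(_ h) [K _ hK]; exists K => z Dz.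
exact: (hK K (leqnn K) z (subset_closure Dz)).
Qed.

End geometry.

(** * The lattice function raising the field, with nearly optimal energy *)

Section discrete_shift.
Context (R : realType).
Notation mR := (measurableTypeR R).
Notation leb2 := (lebesgue2 R).
Notation L := (unit_square R).

Lemma cell_avg_shift_int (n : nat) (eta : R * R -> R) (kap : R) (x : Z2) (i : bool) (k : int) :
  (forall x i, `|cell_avg n eta (shift_axis x i) - cell_avg n eta x| <= kap) ->
  `|cell_avg n eta (shift_int x i k) - cell_avg n eta x| <= `|k|%:~R * kap.
Proof.
move=> hk.
have pos (y : Z2) (m : nat) : `|cell_avg n eta (shift_int y i m%:Z) - cell_avg n eta y| <= m%:R * kap.
  elim: m => [|m IH].
    have -> : shift_int y i 0 = y by case: y => a b; rewrite /shift_int; case: i; rewrite /= addr0.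
    by rewrite subrr normr0 mul0r.
  have -> : shift_int y i m.+1%:Z = shift_axis (shift_int y i m%:Z) i.
    by rewrite /shift_int /shift_axis; case: (i) => /=; congr pair; lia.
  apply: le_trans (ler_distD (cell_avg n eta (shift_int y i m%:Z)) _ _) _.
  by rewrite -natr1 mulrDl mul1r addrC lerD.
case: k => k; first exact: pos.
have := pos (shift_int x i (Negz k)) k.+1.
have -> : shift_int (shift_int x i (Negz k)) i k.+1%:Z = x.
  by case: x => a b; rewrite /shift_int NegzE; case: (i) => /=; congr pair; lia.
by rewrite distrC.
Qed.

(** Young's inequality for [q = p - (p - q)]; a small [th] keeps the main coefficient close to
    [1]. *)
Lemma integral_sqr_le (A : set (mR * mR)) (p q : R * R -> R) (th : R) : measurable A -> 0 < th ->
  measurable_fun A p -> measurable_fun A q ->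
  (\int[leb2]_(z in A) ((q z) ^+ 2)%:E <=
   (1 + th)%:E * \int[leb2]_(z in A) ((p z) ^+ 2)%:E +
   (1 + th^-1)%:E * \int[leb2]_(z in A) ((p z - q z) ^+ 2)%:E)%E.
Proof.
move=> mA th0 mp mq.
have mE (r : R * R -> R) : measurable_fun A r -> measurable_fun A (fun z => ((r z) ^+ 2)%:E).
  by move=> mr; apply: (measurable_EFinP (T := (mR * mR)%type) A _).2; exact: measurable_funX.
have m1 := mE _ mp; have m2 := mE _ mq; have m3 := mE _ (measurable_funB mp mq).
have t1 : 0 <= 1 + th by lra.
have t2 : 0 <= 1 + th^-1 by rewrite addr_ge0// invr_ge0 ltW.
rewrite -!ge0_integralZl//; [|by move=> z _; rewrite lee_fin sqr_ge0..].
rewrite -ge0_integralD//; last 4 first.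
- by move=> z _; rewrite -EFinM lee_fin mulr_ge0// sqr_ge0.
- exact: measurable_funeM.
- by move=> z _; rewrite -EFinM lee_fin mulr_ge0// sqr_ge0.
- exact: measurable_funeM.
apply: ge0_le_integral => //.
- by move=> z _; rewrite lee_fin sqr_ge0.
- by apply: emeasurable_funD; exact: measurable_funeM.
move=> z _; rewrite -!EFinM -EFinD lee_fin.
set a := p z; set b := q z.
have -> : (1 + th) * a ^+ 2 + (1 + th^-1) * (a - b) ^+ 2 =
  b ^+ 2 + th^-1 * (th * a + (a - b)) ^+ 2 by field; rewrite gt_eqF.
by rewrite lerDl mulr_ge0 ?invr_ge0 ?sqr_ge0// ltW.
Qed.

Lemma small_sets (g : R * R -> R) (e : R) : L2_on L g -> 0 < e ->
  exists2 d : R, 0 < d & forall A : set (mR * mR), measurable A -> (leb2 A < d%:E)%E ->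
    (\int[leb2]_(z in A `&` L) ((g z) ^+ 2)%:E <= e%:E)%E.
Proof.
move=> [mg gfin] e0.
have mL : measurable (L : set (mR * mR)) by exact: measurable_unit_square.
pose G := (fun z => g z ^+ 2) \_ L.
have mg2 : measurable_fun (L : set (mR * mR)) (fun z => g z ^+ 2) by exact: measurable_funX.
have iG : leb2.-integrable setT (EFin \o G).
  rewrite /G -restrict_EFin; apply/integrable_restrict => //; rewrite setTI.
  apply/integrableP; split; first exact: (measurable_EFinP (T := (mR * mR)%type) (L : set (mR * mR)) _).2.
  by under eq_integral do rewrite /= ger0_norm ?sqr_ge0//.
have [d [d0 hd]] := integral_normr_continuous iG e0.
exists d => // A mA Ad; have := ltW (hd A mA Ad).
have E : (\int[leb2]_(z in A `&` L) ((g z) ^+ 2)%:E = \int[leb2]_(z in A) (`|G z|)%:E)%E.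
  rewrite integral_mkcondr; apply: eq_integral => z _.
  rewrite /G /patch; case: ifP => _ /=; last by rewrite normr0.
  by rewrite ger0_norm// sqr_ge0.
have fin : ((\int[leb2]_(z in A `&` L) ((g z) ^+ 2)%:E)%E \is a fin_num).
  rewrite ge0_fin_numE; last by apply: integral_ge0 => z _; rewrite lee_fin sqr_ge0.
  apply: le_lt_trans gfin; apply: ge0_subset_integral => //.
  - exact: measurableI.
  - exact: (measurable_EFinP (T := (mR * mR)%type) (L : set (mR * mR)) _).2.
  - by move=> z _; rewrite lee_fin sqr_ge0.
by rewrite /Rintegral -E -lee_fin fineK.
Qed.

Theorem discrete_shift (D : set (R * R)) (f : R * R -> R) (g : bool -> R * R -> R) (eps : R) :
  open D -> smooth_boundary D -> D `<=` L -> in_H10 L f g ->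
  {ae leb2, forall z, D z -> 1 <= f z} -> 0 < eps ->
  \forall n \near \oo, exists h : Z2 -> R,
    [/\ forall x, x \notin box n -> h x = 0,
        forall M, ((\sum_(x <- sq M) edge_energy h x)%:E <= dirichlet_energy L g + eps%:E)%E &
        forall x, lattice_blowup D n x -> 1 - eps <= h x].
Proof.
move=> oD sD DL [[Lf Hg] [eta [te cv]]] f1 eps0.
have mL : measurable (L : set (mR * mR)) by exact: measurable_unit_square.
have Lg i : L2_on L (g i) by have [] := Hg i.
have [K hK] := inner_cell oD sD DL.
(* At most [K] lattice steps lead from a cell inside [D] to a site of the blow-up, and together they
   may lose [eps / 2]. *)
pose kap := eps / 2 / (K.+1)%:R.
have kap0 : 0 < kap by rewrite !divr_gt0// ltr0n.
have Kk : K%:R * kap <= eps / 2.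
  rewrite /kap mulrCA -[leRHS]mulr1; apply: ler_wpM2l; first by rewrite ltW// divr_gt0.
  by rewrite ler_pdivrMr ?ltr0n// mul1r ler_nat.
have mgi i : measurable_fun (L : set (mR * mR)) (g i) by have [] := Lg i.
have mg2 i : measurable_fun (L : set (mR * mR)) (fun z => ((g i z) ^+ 2)%:E).
  by apply: (measurable_EFinP (T := (mR * mR)%type) (L : set (mR * mR)) _).2; exact: measurable_funX.
have DE (v : bool -> R * R -> R) : (forall i, measurable_fun (L : set (mR * mR)) (v i)) ->
    (dirichlet_energy L v = \int[leb2]_(z in L) ((v false z) ^+ 2)%:E + \int[leb2]_(z in L) ((v true z) ^+ 2)%:E)%E.
  move=> mv; rewrite /dirichlet_energy; under eq_integral do rewrite EFinD.
  have mv2 i : measurable_fun (L : set (mR * mR)) (fun z => ((v i z) ^+ 2)%:E).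
    by apply: (measurable_EFinP (T := (mR * mR)%type) (L : set (mR * mR)) _).2; exact: measurable_funX.
  by rewrite ge0_integralD//; move=> z _; rewrite lee_fin sqr_ge0.
have Efin : (dirichlet_energy L g < +oo)%E.
  by rewrite DE//; apply: lte_add_pinfty; [have [] := Lg false|have [] := Lg true].
have E0 : (0 <= dirichlet_energy L g)%E.
  by apply: integral_ge0 => z _; rewrite lee_fin addr_ge0// sqr_ge0.
pose E := fine (dirichlet_energy L g).
have EE : dirichlet_energy L g = E%:E by rewrite fineK// ge0_fin_numE.
have E0' : 0 <= E by rewrite -lee_fin -EE.
(* The energy budget [eps] is shared equally between the factor [1 + th] on the energy of [g] and
   the approximation error weighted by [1 + th^-1]. *)
pose th := eps / 2 / (E + 1).
have th0 : 0 < th by rewrite !divr_gt0// ltr_wpDl.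
have thE : th * E <= eps / 2.
  rewrite /th mulrAC ler_pdivrMr; last by rewrite ltr_wpDl.
  by apply: ler_wpM2l; [rewrite ltW// divr_gt0|lra].
have thV : 0 < th^-1 by rewrite invr_gt0.
(* The squared [H^1] error allowed at scale [1 / n] is [rho / n^2], since cells have area [n^-2]. *)
pose rho := Num.min (eps / 2 / (1 + th^-1)) (Num.min ((eps / 2) ^+ 2) (kap ^+ 2 / 4)).
have rho0 : 0 < rho.
  rewrite !lt_min; apply/and3P; split; first by rewrite !divr_gt0// ltr_wpDl// ltW.
    by rewrite exprn_gt0// divr_gt0.
  by rewrite divr_gt0// exprn_gt0.
have rho1 : (1 + th^-1) * rho <= eps / 2.
  by rewrite mulrC -ler_pdivlMr ?ge_min ?lexx//; lra.
have rho2 : rho <= (eps / 2) ^+ 2 by rewrite !ge_min lexx orbT.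
have rho3 : rho <= kap ^+ 2 / 4 by rewrite !ge_min lexx !orbT.
have e0 : 0 < kap ^+ 2 / 4 by rewrite divr_gt0// exprn_gt0.
have [d1 d10 hd1] := small_sets (Lg false) e0.
have [d2 d20 hd2] := small_sets (Lg true) e0.
near=> n.
have n0 : (0 < n)%N by near: n; exact: nbhs_infty_gt.
have n0' : 0 < n%:R :> R by rewrite ltr0n.
have n1' : 1 <= n%:R :> R by rewrite ler1n.
have Kn : (K <= n)%N by near: n; exact: nbhs_infty_ge.
have nn1 : 1 <= n%:R ^+ 2 :> R by rewrite exprn_ege1.
have nd (d : R) : 2 / d < n%:R -> 0 < d -> 2 * n%:R ^- 2 < d.
  move=> h d0; rewrite ltr_pdivrMr ?exprn_gt0// mulrC -ltr_pdivrMr//.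
  by apply: (lt_le_trans h); rewrite expr2 -[leLHS]mulr1 ler_pM2l.
have nd1 : 2 * n%:R ^- 2 < d1 by apply: nd => //; near: n; exact: nbhs_infty_gtr.
have nd2 : 2 * n%:R ^- 2 < d2 by apply: nd => //; near: n; exact: nbhs_infty_gtr.
pose tau := rho * n%:R ^- 2.
have tau0 : 0 < tau by rewrite mulr_gt0// invr_gt0 exprn_gt0.
have taurho : tau <= rho by apply: ler_piMr; [exact: ltW|rewrite invf_le1// exprn_gt0].
have [k Hk] : exists k, (H1_sqnorm L (fun z => f z - eta k z)%R (fun i z => g i z - grad (eta k) i z)%R <= tau%:E)%E.
  have : nbhs (0 : \bar R) [set x | (x < tau%:E)%E].
    by apply: open_nbhs_nbhs; split; [exact: open_ereal_lt_ereal|rewrite /= lte_fin].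
  by move=> /cv[k _ /(_ k (leqnn k))] /ltW; exists k.
have tk := te k.
have mgr i : measurable_fun (L : set (mR * mR)) (grad (eta k) i).
  by apply: measurable_funTS; exact: continuous_measurable2 (@test_function_continuous_grad _ _ i tk).
have mer i : measurable_fun (L : set (mR * mR)) (fun z => g i z - grad (eta k) i z) by exact: measurable_funB.
have err0 : (\int[leb2]_(z in L) ((f z - eta k z) ^+ 2)%:E <= tau%:E)%E.
  apply: le_trans Hk; rewrite /H1_sqnorm leeDl//.
  by apply: integral_ge0 => z _; rewrite lee_fin addr_ge0// sqr_ge0.
have errg : (dirichlet_energy L (fun i z => g i z - grad (eta k) i z)%R <= tau%:E)%E.
  apply: le_trans Hk; rewrite /H1_sqnorm leeDr//.
  by apply: integral_ge0 => z _; rewrite lee_fin sqr_ge0.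
have erri i : (\int[leb2]_(z in L) ((g i z - grad (eta k) i z) ^+ 2)%:E <= tau%:E)%E.
  apply: le_trans errg; rewrite DE//; case: i; [rewrite leeDr//|rewrite leeDl//];
    by apply: integral_ge0 => z _; rewrite lee_fin sqr_ge0.
exists (cell_avg n (eta k)); split.
- by move=> x xb; exact: cell_avg_eq0.
- move=> M; apply: (le_trans (cell_avg_energy M n0 tk)).
  have sq i := integral_sqr_le mL th0 (mgi i) (mgr i).
  rewrite DE//; apply: (le_trans (leeD (sq false) (sq true))).
  rewrite addeACA -ge0_muleDr; [|by apply: integral_ge0 => z _; rewrite lee_fin sqr_ge0..].
  rewrite -ge0_muleDr; [|by apply: integral_ge0 => z _; rewrite lee_fin sqr_ge0..].
  rewrite -(DE g)// -(DE (fun i z => g i z - grad (eta k) i z)%R)// EE; apply: (@le_trans _ _ ((1 + th)%:E * E%:E + (1 + th^-1)%:E * tau%:E)%E).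
    apply: leeD => //.
    apply: lee_wpmul2l; [by rewrite lee_fin addr_ge0// ltW|exact: errg].
  rewrite -!EFinM -!EFinD lee_fin.
  have : (1 + th^-1) * tau <= (1 + th^-1) * rho by apply: ler_wpM2l => //; rewrite addr_ge0// ltW.
  clear -rho1 thE; lra.
move=> x xD.
have [z Dz zx] := xD.
have zE : z = (x.1%:~R / n%:R, x.2%:~R / n%:R).
  case: z zx {Dz} => z1 z2 /= [<- <-].
  by congr pair; rewrite /GRing.scale/= mulrAC mulfV ?mul1r// gt_eqF.
have [i [l [lK cD]]] := hK z Dz n x n0 Kn zE.
have low : 1 - eps / 2 <= cell_avg n (eta k) (shift_int x i l).
  have [mf _] := Lf.
  apply: (cell_avg_ge n0 tk DL cD mf f1); first by rewrite ltW// divr_gt0.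
  apply: (@le_trans _ _ ((n%:R ^+ 2)%:E * tau%:E)%E).
    by apply: lee_wpmul2l => //; rewrite lee_fin exprn_ge0// ltW.
  by rewrite -EFinM lee_fin /tau mulrCA mulfV ?mulr1// gt_eqF// exprn_gt0.
(* The gradient of [eta k] over two cells is compared with [g], small there by absolute continuity
   of its integral. With [th = 1] both terms get the factor [2], and twice [2 * (kap ^+ 2 / 4)] is
   [kap ^+ 2]. *)
have edge y j : `|cell_avg n (eta k) (shift_axis y j) - cell_avg n (eta k) y| <= kap.
  have [S [mS lS hS]] := @cell_avg_edge R n y j n0.
  have mSL : measurable (S `&` L : set (mR * mR)) by exact: measurableI.
  have SL0 : S `&` L `<=` L by exact: subIsetr.
  have gi2 : (\int[leb2]_(z in S `&` L) ((g j z) ^+ 2)%:E <= (kap ^+ 2 / 4)%:E)%E.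
    by case: (j); [apply: hd2|apply: hd1] => //; apply: (le_lt_trans lS); rewrite lte_fin.
  have er2 : (\int[leb2]_(z in S `&` L) ((g j z - grad (eta k) j z) ^+ 2)%:E <= (kap ^+ 2 / 4)%:E)%E.
    apply: (@le_trans _ _ tau%:E); last by rewrite lee_fin (le_trans taurho).
    apply: le_trans (erri j); apply: ge0_subset_integral => //.
      by apply: (measurable_EFinP (T := (mR * mR)%type) (L : set (mR * mR)) _).2; exact: measurable_funX.
    by move=> w _; rewrite lee_fin sqr_ge0.
  have := hS _ tk.
  have -> : (\int[leb2]_(z in S) (grad (eta k) j z ^+ 2)%:E = \int[leb2]_(z in S `&` L) (grad (eta k) j z ^+ 2)%:E)%E.
    rewrite integral_mkcondr; apply: eq_integral => w _.
    rewrite patchE; case: ifPn => //; rewrite notin_setE => zL.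
    rewrite (grad_eq0 j tk); first by rewrite expr0n.
    by move=> /interior_subset.
  have := @integral_sqr_le _ _ _ 1 mSL ltr01 (measurable_funS mL SL0 (mgi j)) (measurable_funS mL SL0 (mgr j)).
  rewrite invr1 => b1 /le_trans/(_ b1) {}b1.
  have : ((cell_avg n (eta k) (shift_axis y j) - cell_avg n (eta k) y) ^+ 2 <= kap ^+ 2)%R.
    rewrite -lee_fin; apply: (le_trans b1).
    apply: (@le_trans _ _ ((1 + 1)%:E * (kap ^+ 2 / 4)%:E + (1 + 1)%:E * (kap ^+ 2 / 4)%:E)%E).
      by apply: leeD; apply: lee_wpmul2l => //; rewrite lee_fin.
    by rewrite -!EFinM -!EFinD lee_fin; clear; lra.
  by rewrite -[X in X <= _]real_normK ?num_real// ler_pXn2r// nnegrE ltW.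
have := cell_avg_shift_int x i l edge.
have : `|l|%:~R * kap <= K%:R * kap.
  by apply: ler_wpM2r; [exact: ltW|rewrite -[K%:R]/(K%:Z%:~R) ler_int; clear -lK; lia].
rewrite ler_norml => h1 /andP[_ h2]; clear -h1 h2 low Kk; lra.
Unshelve. all: by end_near.
Qed.

End discrete_shift.

(** * Asymptotics *)

Section forbidden.
Context (R : realType) (N : nat) (I : set 'rV[R]_N) (hI : forbidden_set I).

Lemma forbidden_dim : (0 < N)%N.
Proof. by case: hI => // N' r N2 _; exact: ltn_trans N2. Qed.

Lemma forbidden_bounded : exists M : R, forall v j, I v -> `|v ord0 j| < M.
Proof.
case: hI => [a b _|N' r _ r0].
  have bd (w : R) : a < w < b -> `|w| < `|a| + `|b| + 1.
    move=> /andP[aw wb]; have := ler_norm b; have := ler_norm (- a); rewrite normrN.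
    have := normr_ge0 a; have := normr_ge0 b => *.
    by rewrite ltr_norml; apply/andP; split; lra.
  by exists (`|a| + `|b| + 1) => v j; rewrite (ord1 j); exact: bd.
exists r => v j /=; apply: le_lt_trans; rewrite /enorm -sqrtr_sqr; apply: ler_wsqrtr.
by rewrite (bigD1 j)//= lerDl; apply: sumr_ge0 => i _; exact: sqr_ge0.
Qed.

Lemma forbidden_measurable (G : {fset Z2}) (x : G) :
  measurable [set t : #|Defs.coord G N|.-tuple (measurableTypeR R) | I (tuple_to_field t x)].
Proof.
case: hI => [a b _|N' r _ r0].
  have mf : measurable_fun setT (fun t : #|Defs.coord G 1|.-tuple (measurableTypeR R) => fcomp ord0 t (val x)).
    exact: measurable_fcomp.
  have -> : [set t | [set v : 'rV[R]_1 | a < v ord0 ord0 < b] (tuple_to_field t x)] =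
    (fun t : #|Defs.coord G 1|.-tuple (measurableTypeR R) => fcomp ord0 t (val x)) @^-1` `]a, b[%classic.
    by apply/seteqP; split => t /=; rewrite tuple_to_field_fcomp in_itv.
  by rewrite -[X in measurable X]setTI; exact: mf.
pose S (t : #|Defs.coord G N'|.-tuple (measurableTypeR R)) := Num.sqrt (\sum_(j < N') fcomp j t (val x) ^+ 2).
have mS : measurable_fun setT S.
  apply: (measurableT_comp (measurable_funTS (continuous_measurable_fun (@sqrt_continuous R)))).
  by apply: measurable_sum => j; apply: measurable_funX; exact: measurable_fcomp.
have -> : [set t | [set v : 'rV[R]_N' | enorm v < r] (tuple_to_field t x)] = S @^-1` `]-oo, r[%classic.
  apply/funext => t /=; rewrite in_itv/= /enorm /S.
  by under eq_bigr do rewrite tuple_to_field_fcomp.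
by rewrite -[X in measurable X]setTI; exact: mS.
Qed.

Lemma forbidden_rot (G : {fset Z2}) (x : G) (j j' : 'I_N) a b t : j' != j ->
  a ^+ 2 + b ^+ 2 = 1 -> 1 + a != 0 ->
  I (tuple_to_field (plane_rot j j' a b t) x) <-> I (tuple_to_field t x).
Proof.
(* The interval case has a single component, so [j' != j] is contradictory. *)
case: hI j j' t => [? ? _ j j'|N' r _ r0 j j' t jj ab a1]; first by rewrite !ord1.
by rewrite /= /enorm (field_norm_rot jj a1 ab).
Qed.

End forbidden.

Section box_constants.
Context (R : realType).

Lemma box_interior n (x : Z2) : x \in box n -> `|x.1| + 1 < n.+2%:Z /\ `|x.2| + 1 < n.+2%:Z.
Proof. rewrite mem_box; lia. Qed.

Lemma box_Dform n (f : Z2 -> R) : supported (box n) f ->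
  Dform (box n) f f = (2 * pi)^-1 * \sum_(x <- sq n.+2) edge_energy f x.
Proof.
move=> sf; rewrite /Dform -mulrA; congr (_ * _).
by rewrite (edge_pairs_sum sf (@box_interior n)) mulrA mulVf ?mul1r.
Qed.

Lemma box_green n (f : Z2 -> R) x : supported (box n) f ->
  f x ^+ 2 <= (ln (n.+2)%:R + 28) * Dform (box n) f f.
Proof. by move=> sf; rewrite box_Dform//; exact: point_le_energy. Qed.

Lemma card_box n : (0 < n)%N -> (#|{: box n}| <= 9 * n ^ 2)%N.
Proof.
move=> n0; have c (m : nat) : (size (centered_range m) <= m.*2.+1)%N.
  by rewrite size_map size_filter; apply: leq_trans (count_size _ _) _; rewrite size_iota.
rewrite -cardfE.
apply: (@leq_trans (size (centered_range n) * size (centered_range n))).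
  by rewrite -(size_allpairs pair) /box card_fseq; exact: size_undup.
have := c n; nia.
Qed.

End box_constants.

Lemma dgff_law (d : measure_display) (T : measurableType d) (R : realType) (P : probability T R)
    (N : nat) (G : {fset Z2}) (phi : T -> G -> 'rV[R]_N) : is_dgff P phi ->
  exists (mu : probability (#|Defs.coord G N|.-tuple (measurableTypeR R)) R) (c : R),
    [/\ 0 < c, forall A, measurable A -> mu A = law c A &
        forall A, mu A = P [set w | A (field_to_tuple (phi w))]].
Proof.
move=> [mf [c c0 hc]].
pose X : {RV P >-> #|Defs.coord G N|.-tuple (measurableTypeR R)} := mfun_Sub (mem_set mf).
exists [the probability _ _ of distribution P X], c; split => //.
move=> A mA; rewrite -[LHS]/(P [set w | A (field_to_tuple (phi w))]) hc// /law.
by apply: eq_integral => t _; rewrite /dens gff_weightE.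
Qed.

Section asymptotics.
Context (R : realType).

Lemma near_ln (y : R) : \forall n \near \oo, y <= ln (n%:R : R).
Proof.
near=> n.
have n0 : (0 < n)%N by near: n; exact: nbhs_infty_gt.
rewrite -(expRK y) ler_ln ?posrE ?expR_gt0 ?ltr0n//.
by apply: ltW; near: n; exact: nbhs_infty_gtr.
Unshelve. all: by end_near.
Qed.

Lemma ln_addn2 n : (2 <= n)%N -> ln (n.+2%:R : R) <= ln n%:R + 1.
Proof.
move=> n2; have n0 : 0 < n%:R :> R by rewrite ltr0n; lia.
have e2 : 2 <= expR 1 :> R by have := @expR_ge1Dx R 1; lra.
rewrite -[X in _ + X]expRK -lnM ?posrE ?expR_gt0// ler_ln ?posrE ?mulr_gt0 ?expR_gt0//.
apply: (@le_trans _ _ (n%:R * 2)); first by rewrite -natrM ler_nat; lia.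
by rewrite ler_pM2l.
Qed.

Definition green (n : nat) : R := ln n.+2%:R + 28.

Lemma green_gt0 n : 0 < green n.
Proof. by rewrite ltr_wpDl// ln_ge0// ler1n. Qed.

Lemma green_le n : (2 <= n)%N -> green n <= ln n%:R + 30.
Proof. by move=> n2; have := ln_addn2 n2; rewrite /green; lra. Qed.

(* [green n <= (1 + o(1)) log n], so Gaussian tails at height [(2 + k) log n] beat the [O(n^2)] sites of the box. *)
Lemma sites_small (k : R) : 0 < k -> \forall n \near \oo, forall S, (2 + k) * ln n%:R <= S ->
  #|{: box n}|%:R * expR (- (S ^+ 2 / (2 * green n))) <= 2^-1.
Proof.
move=> k0; near=> n => S hS.
have n0 : (2 <= n)%N by near: n; exact: nbhs_infty_ge.
have n0' : 0 < n%:R :> R by rewrite ltr0n; lia.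
(* This ensures [2 * K <= (2 + k) * l], so the exponent [S ^+ 2 / (2 * K)] is at least
   [(2 + k) * l]: it cancels [n ^+ 2] and leaves [exp (- k * l)]. *)
have l1 : 30 * (4 + 2 * k) / (2 * k) <= ln (n%:R : R) by near: n; exact: near_ln.
(* Chosen so that [9 / (1 + k * l) <= 1 / 2], with the [9] of [card_box]. *)
have l2 : 17 / k <= ln (n%:R : R) by near: n; exact: near_ln.
move: l1 l2; rewrite !ler_pdivrMr ?mulr_gt0// => l1 l2.
have K0 := green_gt0 n; have KL := green_le n0.
set l := ln n%:R in hS l1 l2 KL; set K := green n in K0 KL *.
have l0 : 0 < l by rewrite -(pmulr_lgt0 _ k0); lra.
have S2 : ((2 + k) * l) ^+ 2 <= S ^+ 2 by rewrite ler_pXn2r ?nnegrE//; [rewrite mulr_ge0|apply: le_trans hS; rewrite mulr_ge0]; lra.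
have low : (2 + k) * l <= S ^+ 2 / (2 * K).
  rewrite ler_pdivlMr ?mulr_gt0//; apply: le_trans S2.
  have -> : ((2 + k) * l) ^+ 2 = (2 + k) * l * ((2 + k) * l) by rewrite expr2.
  by apply: ler_wpM2l; [rewrite mulr_ge0; lra|nra].
apply: (@le_trans _ _ (9 * n%:R ^+ 2 * expR (- ((2 + k) * l)))).
  apply: ler_pM => //; first by rewrite -natrX -natrM ler_nat card_box//; clear -n0; lia.
  by rewrite ler_expR lerN2.
have -> : expR (- ((2 + k) * l)) = (n%:R ^+ 2)^-1 * (expR (k * l))^-1.
  rewrite mulrDl opprD expRD !expRN; congr (_ * _).
  by rewrite expRM_natl lnK// posrE.
rewrite -mulrA mulVKf; last by rewrite gt_eqF// exprn_gt0.
rewrite ler_pdivrMr ?expR_gt0//; have := @expR_ge1Dx R (k * l); lra.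
Unshelve. all: by end_near.
Qed.

Lemma near_expRN (k C e : R) : 0 < k -> 0 <= C -> 0 < e ->
  \forall n \near \oo, C * expR (- (k * ln (n%:R : R))) <= e.
Proof.
move=> k0 C0 e0; near=> n.
have l1 : C / e / k <= ln (n%:R : R) by near: n; exact: near_ln.
move: l1; rewrite !ler_pdivrMr// => l1.
rewrite expRN ler_pdivrMr ?expR_gt0//.
have := @expR_ge1Dx R (k * ln n%:R); nra.
Unshelve. all: by end_near.
Qed.

End asymptotics.

(** * Lower bound on avoidance and conditional tail for large boxes *)

Section avoidance.
Context (R : realType).
Notation L := (unit_square R).
Notation vec G N := (#|Defs.coord G N|.-tuple (measurableTypeR R)).

Lemma avoidance_lower (D : set (R * R)) (N : nat) (I : set 'rV[R]_N)
    (f : R * R -> R) (g : bool -> R * R -> R) (E e0 : R) :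
  open D -> smooth_boundary D -> D `<=` L -> forbidden_set I ->
  in_H10 L f g -> {ae lebesgue2 R, forall z, D z -> 1 <= f z} ->
  dirichlet_energy L g = E%:E -> 0 <= E -> 0 < e0 ->
  \forall n \near \oo, forall (c : R) (mu : probability (vec (box n) N) R), 0 < c ->
    (forall A, measurable A -> mu A = law c A) ->
    ((expR (- ((E / pi + e0) * ln n%:R ^+ 2)))%:E <= mu (avoiding (lattice_blowup D n) I))%E.
Proof.
move=> oD sD DL hI fg f1 gE E0 e00.
have [M IM] := forbidden_bounded hI.
(* For [e <= 1 / 2] the quantity [(1 + 4 * e) ^+ 2 * (E + e)] exceeds [E] by at most
   [e * (9 + 16 * E)]. *)
pose e : R := Num.min 2^-1 (e0 / 2 / (9 + 16 * E)).
have e_gt0 : 0 < e by rewrite lt_min invr_gt0 ltr0n/= !divr_gt0// ltr_wpDr// mulr_ge0.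
have e2 : e <= 2^-1 by rewrite ge_min lexx.
have eE : e * (9 + 16 * E) <= e0 / 2.
  by rewrite -ler_pdivlMr ?ge_min ?lexx ?orbT// ltr_wpDr// mulr_ge0.
have pi0 := pi_gt0 R; have pi1 := pi_ge2 R.
near=> n => c mu c0 muE.
have [h [hs hE hD]] : exists h : Z2 -> R,
    [/\ forall x, x \notin box n -> h x = 0,
        forall M, ((\sum_(x <- sq M) edge_energy h x)%:E <= dirichlet_energy L g + e%:E)%E &
        forall x, lattice_blowup D n x -> 1 - e <= h x].
  by near: n; exact: discrete_shift oD sD DL fg f1 e_gt0.
have small : forall S, (2 + e) * ln n%:R <= S ->
  #|{: box n}|%:R * expR (- (S ^+ 2 / (2 * green R n))) <= 2^-1.
  by near: n; exact: sites_small.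
have l1 : 1 <= ln (n%:R : R) by near: n; exact: near_ln.
have l2 : M / e <= ln (n%:R : R) by near: n; exact: near_ln.
have l3 : 72 * (E + 2) / e0 <= ln (n%:R : R) by near: n; exact: near_ln.
have l4 : 4 * ln 4 / e0 <= ln (n%:R : R) by near: n; exact: near_ln.
move: l2 l3 l4; rewrite !ler_pdivrMr// => l2 l3 l4.
set l := ln n%:R in small l1 l2 l3 l4 *.
(* The excess pays for [h] being only [1 - e], for [M <= e * l] and for the level [(2 + e) * l],
   since [2 * (1 + 4 * e) * (1 - e) >= 2 + 2 * e]. *)
pose s := 2 * (1 + 4 * e) * l.
have s0 : 0 < s by rewrite /s; clear -l1 e_gt0; nra.
pose B := s ^+ 2 * ((2 * pi)^-1 * (E + e)).
(* The cross term has standard deviation at most the square root of [B], of order [l], so a cut-off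
   linear in [l] suffices and is negligible against [l ^+ 2]. *)
pose m := 3 * s * (E + 2).
have hE' : \sum_(x <- sq n.+2) edge_energy h x <= E + e.
  by rewrite -lee_fin EFinD -gE; exact: hE.
have Ee : 0 < E + e by rewrite ltr_wpDl.
have B0 : 0 < B.
  by apply: mulr_gt0; [exact: exprn_gt0|apply: mulr_gt0 => //; rewrite invr_gt0 mulr_gt0].
have m0 : 0 <= m by apply: mulr_ge0; [apply: mulr_ge0 => //; exact: ltW|exact: addr_ge0].
have K_ge f' x : supported (box n) f' -> f' x ^+ 2 <= green R n * Dform (box n) f' f'.
  exact: box_green.
have mI := forbidden_measurable hI.
have := @repulsion_lower R (box n) N c c0 mu muE (green R n) (green_gt0 R n) K_ge
  (lattice_blowup D n) I (Ordinal (forbidden_dim hI)) M (fun v => IM v _) (mI _)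
  (fun x => s * h x) B m ((2 + e) * l).
move=> H; apply: (le_trans _ (H _ B0 m0 _ _ _ _ _)) => {H}.
- have -> : expR (- (m + B / 2)) / 4 = expR (- (m + B / 2 + ln 4)).
    by rewrite [in RHS]opprD expRD [expR (- ln 4)]expRN lnK// posrE.
  rewrite lee_fin ler_expR lerN2.
  (* The exponent is split into [E / pi + e0 / 2] for the energy and [e0 / 4] each for the cut-off
     and for the factor [1 / 4]. *)
  have m1 : m <= e0 / 4 * l ^+ 2.
    rewrite /m /s; clear -l1 l3 e2 e_gt0 E0; set x := 72 * (E + 2) in l3.
    have : 3 * (2 * (1 + 4 * e) * l) * (E + 2) <= l * (x / 4).
      have -> : 3 * (2 * (1 + 4 * e) * l) * (E + 2) = l * (E + 2) * (6 * (1 + 4 * e)) by ring.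
      have -> : l * (x / 4) = l * (E + 2) * 18 by rewrite /x; field.
      by apply: ler_wpM2l; [rewrite mulr_ge0; lra|lra].
    move/le_trans; apply; rewrite mulrC expr2 mulrA.
    by apply: ler_wpM2r; lra.
  have l5 : ln 4 <= e0 / 4 * l ^+ 2.
    clear -l1 l4 e00; apply: (@le_trans _ _ (e0 / 4 * l)); first lra.
    by apply: ler_wpM2l; [lra|rewrite expr2 ler_peMr//; lra].
  have B1 : B / 2 <= (E / pi + e0 / 2) * l ^+ 2.
    have -> : B / 2 = (1 + 4 * e) ^+ 2 * (E + e) / pi * l ^+ 2.
      by rewrite /B /s; move: (pi : R) pi0 => p p0; field; exact: lt0r_neq0.
    apply: ler_wpM2r; first exact: sqr_ge0.
    rewrite ler_pdivrMr// [leRHS]mulrDl divfK; last exact: lt0r_neq0.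
    apply: (@le_trans _ _ (E + e0 / 2)).
      have ee : e * e <= e / 2 by clear -e2 e_gt0; apply: ler_wpM2l; lra.
      apply: (@le_trans _ _ ((1 + 16 * e) * (E + e))); last by clear -ee eE; lra.
      by apply: ler_wpM2r; [exact: ltW|rewrite expr2; clear -ee; lra].
    by clear -e00 pi1; nra.
  clear -m1 l5 B1; lra.
- by move=> x xb; rewrite hs// mulr0.
- rewrite DformZl DformZr box_Dform// mulrA -expr2 /B; apply: ler_wpM2l; first exact: sqr_ge0.
  by apply: ler_wpM2l => //; rewrite invr_ge0 mulr_ge0// ltW.
- have -> : m ^+ 2 = s ^+ 2 * (9 * (E + 2) ^+ 2) by rewrite /m; ring.
  rewrite /B mulrCA; apply: ler_wpM2l; first exact: sqr_ge0.
  apply: (@le_trans _ _ (8 * (1 * (E + e)))).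
    apply: ler_wpM2l => //; apply: ler_wpM2r; first by rewrite addr_ge0// ltW.
    by rewrite invf_le1 ?mulr_gt0//; clear -pi1; lra.
  by clear -E0 e2; nra.
- by apply: mulr_ge0; clear -l1 e_gt0; lra.
- move=> x xD; apply: (@le_trans _ _ (s * (1 - e))); last by apply: ler_wpM2l; [exact: ltW|exact: hD].
  rewrite /s; clear -l1 l2 e2 e_gt0.
  have : 0 <= l * e * (1 - 2 * e) by apply: mulr_ge0; [apply: mulr_ge0|]; lra.
  lra.
- exact: small.
Unshelve. all: by end_near.
Qed.

Lemma ler_one_subX (u : R) (k : nat) : 0 <= u <= 1 -> 1 - k%:R * u <= (1 - u) ^+ k.
Proof.
move=> /andP[u0 u1]; elim: k => [|k IH]; first by rewrite mul0r subr0 expr0.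
rewrite exprS -natr1; apply: (@le_trans _ _ ((1 - u) * (1 - k%:R * u))).
  have : 0 <= k%:R * u * u by rewrite !mulr_ge0.
  lra.
by apply: ler_wpM2l => //; lra.
Qed.

(** By Bernoulli's inequality, [N] successive relative losses of [L ^- 2] consume at most half of
    the margin [beta]. *)
Lemma net_mesh (N : nat) (beta : R) : 0 < beta -> exists L : nat,
  [/\ (0 < L)%N, 0 < 1 - (L%:R ^+ 2)^-1 :> R &
      2 + beta / 2 <= (1 - (L%:R ^+ 2)^-1) ^+ N * (2 + beta)].
Proof.
move=> b0; pose L := (Num.truncn (2 * N%:R * (2 + beta) / beta)).+2; exists L.
have L2 : 2 <= L%:R :> R by rewrite ler_nat.
have : 2 * N%:R * (2 + beta) <= L%:R * beta.
  rewrite -ler_pdivrMr//; apply: ltW; apply: lt_le_trans (truncnS_gt _) _.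
  by rewrite ler_nat.
move: (L%:R : R) L2 => x x2 Lb.
have x0 : 0 < x by lra.
have LL : (x ^+ 2)^-1 <= x^-1.
  by rewrite lef_pV2 ?posrE ?exprn_gt0// expr2 ler_peMr//; lra.
have LV : x^-1 <= 2^-1 by rewrite lef_pV2 ?posrE//.
have u0 : 0 <= (x ^+ 2)^-1 by rewrite invr_ge0 exprn_ge0// ltW.
split => //; first by lra.
apply: (@le_trans _ _ ((1 - N%:R * x^-1) * (2 + beta))).
  have : N%:R * x^-1 * (2 + beta) <= beta / 2.
    by rewrite mulrAC ler_pdivrMr//; lra.
  lra.
apply: ler_wpM2r; first lra.
apply: (@le_trans _ _ (1 - N%:R * (x ^+ 2)^-1)).
  by rewrite lerD2l lerN2; apply: ler_wpM2l.
by apply: ler_one_subX; lra.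
Qed.

(** The raise [S] must exceed [M] by a level that the field is unlikely to reach anywhere in the
    box, yet stay a multiple of [log n] below the tail level; the margin [beta / 2] left by the net
    is shared between the two. *)
Lemma levels (beta l M t : R) (S := (2 + beta / 4) * l) : 0 < beta -> 0 <= l ->
  M <= l * (beta / 8) -> 2 + beta / 2 <= t ->
  [/\ 0 <= S, M <= S, (2 + beta / 8) * l <= S - M, S <= t * l & beta / 4 * l <= t * l - S].
Proof.
move=> b0 l0 Ml bt.
have tl : (2 + beta / 2) * l <= t * l by exact: ler_wpM2r.
have bl : 0 <= beta * l by rewrite mulr_ge0// ltW.
by rewrite /S; split; lra.
Qed.

(** [l >= 30] gives [2 * K <= 4 * l], and [(beta / 4) ^+ 2 / 4 = beta ^+ 2 / 64]. *)
Lemma tail_level (beta l K X : R) : 0 < beta -> 30 <= l -> 0 < K -> K <= l + 30 ->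
  beta / 4 * l <= X -> beta ^+ 2 / 64 * l <= X ^+ 2 / (2 * K).
Proof.
move=> b0 l1 K0 Kl lX; rewrite ler_pdivlMr ?mulr_gt0//.
have bl : 0 <= beta / 4 * l by rewrite mulr_ge0 ?divr_ge0//; lra.
apply: (@le_trans _ _ ((beta / 4 * l) ^+ 2)); last first.
  by rewrite ler_pXn2r// nnegrE// (le_trans bl).
have -> : (beta / 4 * l) ^+ 2 = beta ^+ 2 / 64 * l * (4 * l) by field.
apply: ler_wpM2l; last lra.
by rewrite mulr_ge0 ?divr_ge0 ?sqr_ge0//; lra.
Qed.

Lemma avoidance_upper (D : nat -> set Z2) (N : nat) (I : set 'rV[R]_N.+1) (beta e : R) :
  forbidden_set I -> 0 < beta -> 0 < e ->
  \forall n \near \oo, forall (c : R) (mu : probability (vec (box n) N.+1) R), 0 < c ->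
    (forall A, measurable A -> mu A = law c A) -> forall x0 : box n,
    (mu (avoiding (D n) I `&` [set t | ((2 + beta) * ln n%:R <= enorm (tuple_to_field t x0))%R]) <=
     e%:E * mu (avoiding (D n) I))%E.
Proof.
move=> hI b0 e0.
have [M IM] := forbidden_bounded hI.
have mI := forbidden_measurable hI.
have [L [L0 th0 thN]] := net_mesh N b0.
(* [4] is the factor [2] of [repulsion_upper] for each of the two signs. *)
pose C : R := (size (net R L))%:R ^+ N * 4.
have C0 : 0 <= C by rewrite mulr_ge0// exprn_ge0.
near=> n => c mu c0 muE x0.
have n2 : (2 <= n)%N by near: n; exact: nbhs_infty_ge.
have small : forall S, (2 + beta / 8) * ln n%:R <= S ->
  #|{: box n}|%:R * expR (- (S ^+ 2 / (2 * green R n))) <= 2^-1.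
  by near: n; apply: sites_small; rewrite divr_gt0.
have l1 : 30 <= ln (n%:R : R) by near: n; exact: near_ln.
have l2 : M / (beta / 8) <= ln (n%:R : R) by near: n; exact: near_ln.
have dec : C * expR (- (beta ^+ 2 / 64 * ln n%:R)) <= e.
  by near: n; apply: near_expRN => //; rewrite divr_gt0// exprn_gt0.
move: l2; rewrite ler_pdivrMr ?divr_gt0// => l2.
have K0 := green_gt0 R n; have KL := green_le R n2.
set l := ln n%:R in small l1 l2 dec KL *.
have l0 : 0 <= l := le_trans (ler0n _ 30) l1.
have K_ge f' x : supported (box n) f' -> f' x ^+ 2 <= green R n * Dform (box n) f' f'.
  exact: box_green.
have mOm := measurable_avoiding (D n) (mI (box n)).
have Om_rot (j : 'I_N.+1) a b (t : vec (box n) N.+1) : j != ord0 -> a ^+ 2 + b ^+ 2 = 1 -> 1 + a != 0 ->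
    avoiding (D n) I (plane_rot ord0 j a b t) <-> avoiding (D n) I t.
  by move=> j0 ab a1; split => H x Dx /(forbidden_rot hI x t j0 ab a1); exact: H.
have T0 : 0 <= (2 + beta) * l by rewrite mulr_ge0// addr_ge0// ltW.
pose e' := 2 * expR (- (beta ^+ 2 / 64 * l)).
have e'0 : 0 <= e' by rewrite mulr_ge0// expR_ge0.
have := @norm_tail R (box n) N c c0 mu muE _ mOm Om_rot x0 L L0 _ e' T0 e'0 th0.
move=> H; apply: (le_trans (H _)) => {H}; last first.
  apply: lee_wpmul2r; first exact: measure_ge0.
  rewrite lee_fin; apply: le_trans dec; rewrite /C -mulrA; apply: ler_wpM2l; first exact: exprn_ge0.
  by rewrite /e' -mulrDl -natrD.
move=> s; rewrite mulrA.
have [S0 MS small' ST ST'] := levels b0 l0 l2 thN.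
have := @repulsion_upper R (box n) N.+1 c c0 mu muE (green R n) K0 K_ge (D n) I ord0 M
  (fun v => IM v ord0) (mI (box n)) s _ _ x0 MS S0 ST (small _ small').
move/le_trans; apply; apply: lee_wpmul2r; first exact: measure_ge0.
by rewrite lee_fin ler_pM2l// ler_expR lerN2; exact: tail_level.
Unshelve. all: by end_near.
Qed.

End avoidance.

(** * Passage to the limit *)

Lemma limn_einf_ge (R : realType) (u : (\bar R)^nat) (x : \bar R) :
  (\forall n \near \oo, (x <= u n)%E) -> (x <= limn_einf u)%E.
Proof.
move=> [n0 _ H]; rewrite limn_einf_lim; apply: lime_ge; first exact: is_cvg_einfs.
exists n0 => // n nn; apply: le_ereal_inf_tmp => _ [k nk <-]; apply: H.
exact: leq_trans nk.
Qed.

Lemma ereal_cvg0 (R : realType) (u : (\bar R)^nat) :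
  (forall e : R, 0 < e -> \forall n \near \oo, (0 <= u n <= e%:E)%E) -> u @ \oo --> 0%E.
Proof.
move=> H; apply/fine_cvgP; split.
  near=> n; have /andP[u0 u1] : (0 <= u n <= 1%:E)%E by near: n; exact: H.
  by rewrite ge0_fin_numE//; exact: le_lt_trans (ltry 1).
apply/cvgr0Pnorm_le => e e0; near=> n.
have /andP[u0 u1] : (0 <= u n <= e%:E)%E by near: n; exact: H.
have uf : (u n \is a fin_num)%E by rewrite ge0_fin_numE//; exact: le_lt_trans (ltry e).
by rewrite /= ger0_norm ?fine_ge0// -lee_fin fineK.
Unshelve. all: by end_near.
Qed.

Lemma lne_div_ge (R : realType) (a y l : R) (p : \bar R) : 0 < l -> (p <= 1)%E ->
  ((expR (- (a * l)))%:E <= p)%E -> ((- a)%:E <= lne p / l%:E)%E.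
Proof.
move=> l0 p1 ap; have p0 : (0 < p)%E by apply: lt_le_trans ap; rewrite lte_fin expR_gt0.
have pf : p \is a fin_num by rewrite gt0_fin_numE//; exact: le_lt_trans p1 (ltry 1).
move: p pf p0 p1 ap => [r| |]// _; rewrite lte_fin => r0 _; rewrite lee_fin => ar.
rewrite lne_EFin// inver gt_eqF// -EFinM lee_fin ler_pdivlMr// mulNr.
by rewrite -[leLHS]expRK ler_ln// posrE ?expR_gt0.
Qed.

Unset Implicit Arguments.

Theorem corollary4p2 (R : realType) (D : set (R * R))
    (D_open : open D) (D_smooth : smooth_boundary D)
    (D_sub : D `<=` unit_square R) (D_0 : D (0, 0))
    (D_dist : 0 < set_dist2 D (boundary (unit_square R)))
    (N : nat) (I : set 'rV[R]_N) (hI : forbidden_set I)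
    (d : nat -> measure_display) (T : forall n, measurableType (d n))
    (P : forall n, probability (T n) R)
    (phi : forall n, T n -> box n -> 'rV[R]_N)
    (hphi : forall n, is_dgff (P n) (phi n))
    (beta : R) (beta_gt0 : 0 < beta) :
  let Omega n := avoids (phi n) I (lattice_blowup D n) in
  (- (2 / pi)%:E * capacity (unit_square R) D <=
     limn_einf (fun n => lne (P n (Omega n)) / ((ln n%:R) ^+ 2)%:E))%E /\
  ereal_sup [set cond_prob (P n)
                   [set w | (2 + beta) * ln n%:R <= enorm (phi n w x)]
                   (Omega n)
            | x in [set x : box n | lattice_blowup D n (val x)]]
    @[n --> \oo] --> 0%E.
Proof.
move=> Omega.
have OmE n : Omega n = [set w | avoiding (lattice_blowup D n) I (field_to_tuple (phi n w))].
  by apply/funext => w; rewrite /Omega /avoids /avoiding/= field_to_tupleK.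
have Om1 n : (P n (Omega n) <= 1)%E.
  have [mu [c [c0 muE muP]]] := dgff_law (hphi n).
  by rewrite OmE -muP; apply: probability_le1; apply: measurable_avoiding; exact: forbidden_measurable.
have pi0 := pi_gt0 R.
split.
  set X := limn_einf _.
  have low f g (E : R) : in_H10 (unit_square R) f g ->
      {ae lebesgue2 R, forall z, D z -> (1 <= f z)} ->
      dirichlet_energy (unit_square R) g = E%:E -> 0 <= E -> ((- (E / pi))%:E <= X)%E.
    move=> fg f1 gE E0; apply/lee_addgt0Pr => e e0.
    rewrite -leeBlDr// -EFinB -opprD; apply: limn_einf_ge; near=> n.
    apply: lne_div_ge => //.
      by rewrite exprn_gt0//; apply: (lt_le_trans ltr01); near: n; exact: near_ln.
    have [mu [c [c0 muE muP]]] := dgff_law (hphi n).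
    (* How large [n] must be does not depend on the law, so [c] and [mu], which vary with [n], are
       generalised first. *)
    rewrite OmE -muP; move: c mu c0 muE {muP}; near: n.
    exact: avoidance_lower fg f1 gE E0 e0.
  (* [2 / pi] times the [1 / 2] of the capacity is [1 / pi], and the minus sign turns the infimum
     into one bound per competitor. *)
  rewrite /capacity muleA -EFinN -EFinM.
  have -> : - (2 / pi) * (1 / 2) = - pi^-1 :> R.
    by move: (pi : R) pi0 => p p0; field; exact: lt0r_neq0.
  rewrite EFinN mulNe leeNl lee_pdivlMl//; apply: le_ereal_inf_tmp => _ [f [g [fg f1 ->]]].
  have : (0 <= dirichlet_energy (unit_square R) g)%E.
    by apply: integral_ge0 => z _; rewrite lee_fin addr_ge0// sqr_ge0.
  case gE : (dirichlet_energy _ _) => [E| |]//; last by move=> _; exact: leey.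
  rewrite lee_fin => E0; rewrite -lee_pdivlMl// leeNl -EFinM -EFinN mulrC.
  exact: low fg f1 gE E0.
apply: ereal_cvg0 => e e0; near=> n; apply/andP; split.
  (* The supremum of the empty set is [-oo]; the origin lies in the box and, by [D (0, 0)], in the
     blow-up, which makes the supremum nonnegative. *)
  have O : ((0, 0) : Z2) \in box n by rewrite mem_box.
  have DO : lattice_blowup D n (val [` O]%fset).
    by exists (0, 0) => //; rewrite scaler0.
  apply: (@le_trans _ _ (cond_prob (P n) [set w | (2 + beta) * ln n%:R <= enorm (phi n w [` O]%fset)] (Omega n))).
    by rewrite /cond_prob mule_ge0// inve_ge0 measure_ge0.
  by apply: ereal_sup_ubound; exists [` O]%fset.
apply: ge_ereal_sup => _ [x Dx <-]; rewrite /cond_prob.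
have [mu [c [c0 muE muP]]] := dgff_law (hphi n).
have : (mu (avoiding (lattice_blowup D n) I `&` [set t | ((2 + beta) * ln n%:R <= enorm (tuple_to_field t x))%R]) <=
     e%:E * mu (avoiding (lattice_blowup D n) I))%E.
  move: x {Dx}; move: c mu c0 muE {muP}; near: n.
  (* Component [ord0] requires a successor dimension, and no set is forbidden in dimension zero. *)
  clear Om1; case: N I hI phi hphi @Omega OmE => [|N'] I hI phi hphi Omega OmE; first by have := forbidden_dim hI.
  exact: avoidance_upper.
rewrite !muP OmE.
have -> : [set w | (avoiding (lattice_blowup D n) I `&` [set t | (2 + beta) * ln n%:R <= enorm (tuple_to_field t x)]) (field_to_tuple (phi n w))] =
  [set w | (2 + beta) * ln n%:R <= enorm (phi n w x)] `&` [set w | avoiding (lattice_blowup D n) I (field_to_tuple (phi n w))].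
  by rewrite setIC; apply/funext => w /=; rewrite field_to_tupleK.
set A := P n (_ `&` _); set B := P n _.
have A0 : (0 <= A)%E by exact: measure_ge0.
have B1 : (B <= 1)%E by rewrite /B -OmE; exact: Om1.
have B0 : (0 <= B)%E by exact: measure_ge0.
case: B B0 B1 => [b| |]//; rewrite !lee_fin => b0 _; rewrite -EFinM.
(* If the conditioning event is null, so is the numerator, and [0] times any value given to the
   inverse of [0] is [0]. *)
have [->|bn0] := eqVneq b 0.
  rewrite mulr0 => A0'; have -> : A = 0%E by apply/eqP; rewrite eq_le A0 A0'.
  by rewrite mul0e lee_fin ltW.
have bp : 0 < b by rewrite lt_neqAle eq_sym bn0.
by rewrite inver (negbTE bn0) lee_pdivrMr.
Unshelve. all: by end_near.
Qed.
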